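(* Let $s,s_1,s_2\in\mathbb{R}$, $1<p,p_1,p_2<\infty$, $1\le q,q_1,q_2,r,r_1,r_2\le\infty$ and $0<\theta<1$. Put $s_*=(1-\theta)s_1+\theta s_2$, $\frac1{p_*}=\frac{1-\theta}{p_1}+\frac{\theta}{p_2}$, $\frac1{q_*}=\frac{1-\theta}{q_1}+\frac{\theta}{q_2}$, $\frac1{r_*}=\frac{1-\theta}{r_1}+\frac{\theta}{r_2}$. Assume that $$s_*-s=\frac{n}{p_*}-\frac{n}{p}\ge0 .$$ Then there is a constant $C>0$ such that $$\|f\|_{\dot F^{s,r}_{p,q}}\le C\,\|f\|_{\dot F^{s_1,r_1}_{p_1,q_1}}^{1-\theta}\|f\|_{\dot F^{s_2,r_2}_{p_2,q_2}}^{\theta}\quad\text{for all } f\in \dot F^{s_1,r_1}_{p_1,q_1}\cap \dot F^{s_2,r_2}_{p_2,q_2},$$ if one of the following conditions is satisfied: (i) $q_*\le q$, $r_*\le r$; (ii) $s=s_1=s_2$, $p_1\ne p_2$, $\max(r_1,r_2)\le r$; (iii) $s_*=s$, $s_1\ne s_2$, $q_*\le q$; (iv) $s_*>s$, $q_*\le q$; (v) $s_*>s$, $s_2-s_1\ne n/p_2-n/p_1$.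
   Context: All spaces are on $\mathbb{R}^n$. $\mathscr{S}$ is the Schwartz class, $\mathscr{S}'$ its dual, $\mathscr{S}_0=\{\psi\in\mathscr{S}: D^\alpha\hat\psi(0)=0\text{ for all multi-indices }\alpha\}$ (a closed subspace of $\mathscr{S}$), and $\mathscr{S}_0'$ its dual. Every $f\in\mathscr{S}_0'$ has an extension $F\in\mathscr{S}'$, unique up to polynomials. Lorentz spaces: for $1\le p<\infty$, $1\le q\le\infty$, $L^{p,q}$ is the space of measurable $f$ on $\mathbb{R}^n$ with finite quasi-norm $\|f\|_{L^{p,q}}=\left(p\int_0^\infty[\alpha\mu_f(\alpha)^{1/p}]^q\frac{d\alpha}{\alpha}\right)^{1/q}$ if $q<\infty$, and $\sup_{\alpha>0}\alpha\mu_f(\alpha)^{1/p}$ if $q=\infty$, where $\mu_f(\alpha)=|\{x:|f(x)|>\alpha\}|$. Homogeneous Triebel-Lizorkin-Lorentz spaces: fix $\{\varphi_j\}_{j\in\mathbb{Z}}\subset C_c^\infty(\mathbb{R}^n)$ with $\operatorname{supp}\varphi_j\subset\{2^{j-1}\le|\xi|\le2^{j+1}\}$, $\sup_{j,\xi}2^{j|\alpha|}|D^\alpha\varphi_j(\xi)|<\infty$ for every multi-index $\alpha$, and $\sum_{j\in\mathbb{Z}}\varphi_j=1$ on $\mathbb{R}^n\setminus\{0\}$. For $f\in\mathscr{S}_0'$ let $\dot\Delta_jf=(\varphi_j\hat F)^\vee$ for any extension $F\in\mathscr{S}'$ of $f$ (independent of the choice). Then $\dot F^{s,r}_{p,q}$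 is the space of $f\in\mathscr{S}_0'$ with $$\|f\|_{\dot F^{s,r}_{p,q}}=\Big\|\,\big\|\{2^{js}\dot\Delta_jf\}_{j\in\mathbb{Z}}\big\|_{l^r}\Big\|_{L^{p,q}}<\infty .$$ *)

(* Defs.v *)
From HB Require Import structures.
From mathcomp Require Import all_boot all_order all_algebra.
From mathcomp.real_closed Require Import complex.
From mathcomp Require Import all_classical all_reals all_analysis.

Set Implicit Arguments.
Unset Strict Implicit.
Unset Printing Implicit Defensive.
Import Order.TTheory GRing.Theory Num.Theory.
Import numFieldNormedType.Exports.

Local Open Scope classical_set_scope.
Local Open Scope ring_scope.
Local Open Scope complex_scope.

(* R^n is 'rV[R]_n.  The topology of 'rV[R]_n is the usual one, but the norm
   provided by the library is the sup norm; the Euclidean norm is enorm. *)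

Definition rV_display : measure_display.
Proof. exact: default_measure_display. Qed.

Section measurable_rV.
Variables (R : realType) (n : nat).

Let coors : 'I_n -> 'rV[R]_n -> measurableTypeR R := fun i x => x ord0 i.

Let rV_set0 : g_sigma_preimage coors set0.
Proof. exact: sigma_algebra0. Qed.

Let rV_setC A : g_sigma_preimage coors A -> g_sigma_preimage coors (~` A).
Proof. exact: sigma_algebraC. Qed.

Let rV_bigcup (F : (set 'rV[R]_n)^nat) :
  (forall i, g_sigma_preimage coors (F i)) ->
  g_sigma_preimage coors (\bigcup_i (F i)).
Proof. exact: sigma_algebra_bigcup. Qed.

(* The sigma-algebra generated by the coordinates, as for n.-tuple T in the
   library; it is the Borel sigma-algebra of R^n. *)
HB.instance Definition _ := @isMeasurable.Build rV_display
  'rV[R]_n (g_sigma_preimage coors) rV_set0 rV_setC rV_bigcup.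

Lemma measurable_coord (i : 'I_n) :
  measurable_fun [set: 'rV[R]_n] (fun x => x ord0 i : measurableTypeR R).
Proof.
move=> _ Y mY; rewrite setTI; apply: sub_sigma_algebra => /=.
rewrite -bigcup_seq/=; exists i => /=; first by rewrite mem_index_enum.
by exists Y => //; rewrite setTI.
Qed.

End measurable_rV.

Lemma measurable_fun_rV d (T : measurableType d) (R : realType) n
    (f : T -> 'rV[R]_n) :
  (forall i, measurable_fun [set: T] (fun t => f t ord0 i : measurableTypeR R)) ->
  measurable_fun [set: T] f.
Proof.
move=> mf _ Y mY.
have h : g_sigma_preimage
    (fun i (x : 'rV[R]_n) => x ord0 i : measurableTypeR R) `<=`
    [set A : set 'rV[R]_n | measurable ([set: T] `&` f @^-1` A)].
  apply: smallest_sub.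
    split => /=.
    - by rewrite preimage_set0 setI0.
    - move=> A; rewrite !setTI => mA.
      rewrite [X in measurable X](_ : _ = ~` (f @^-1` A)); first exact: measurableC.
      by apply/seteqP; split=> t //= [].
    - move=> F mF; rewrite preimage_bigcup setI_bigcupr.
      exact: bigcup_measurable.
  move=> A; rewrite -bigcup_seq => -[i _ [B mB <-]].
  by rewrite /mkset setTI; exact: (mf i measurableT B mB).
exact: (h Y mY).
Qed.

Section lebesgue_rV.
Variable R : realType.

Definition rV_snoc n (z : 'rV[R]_n * measurableTypeR R) : 'rV[R]_n.+1 :=
  \row_i (if unlift ord_max i is Some j then z.1 ord0 j else z.2).

Lemma measurable_rV_snoc n : measurable_fun setT (@rV_snoc n).
Proof.
apply: measurable_fun_rV => i; rewrite /rV_snoc.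
under eq_fun do rewrite mxE.
case: (unlift ord_max i) => [j|]; last exact: measurable_snd.
exact: (measurableT_comp (measurable_coord j) measurable_fst).
Qed.

Definition pushforward_measure d1 d2 (T1 : measurableType d1)
    (T2 : measurableType d2) (mu : {measure set T1 -> \bar R}) (f : T1 -> T2)
    (mf : measurable_fun setT f) : {measure set T2 -> \bar R} :=
  measure_function_pushforward__canonical__measure_function_Measure mu mf.

(* n-dimensional Lebesgue measure: the Dirac mass on R^0, and the image of the
   product of the measure on R^n with the one on R for R^(n+1). *)
Fixpoint lebesgue_rV n : {measure set 'rV[R]_n -> \bar R} :=
  match n return {measure set 'rV[R]_n -> \bar R} with
  | 0 => dirac (0 : 'rV[R]_0)
  | m.+1 => pushforward_measure
      (product_measure1 (lebesgue_rV m) lebesgue_measure)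
      (@measurable_rV_snoc m)
  end.

End lebesgue_rV.

Section calculus.
Variables (R : realType) (n : nat).
Local Notation E := 'rV[R]_n.
Local Notation C := R[i].

Definition dot (x y : E) : R := \sum_(i < n) x ord0 i * y ord0 i.

Definition enorm (x : E) : R := Num.sqrt (dot x x).

Definition multi_index := 'I_n -> nat.

Definition mi_abs (a : multi_index) : nat := (\sum_(i < n) a i)%N.

Definition monomial (a : multi_index) (x : E) : R :=
  \prod_(i < n) x ord0 i ^+ a i.

Definition partial (i : 'I_n) (g : E -> R) : E -> R :=
  fun x => 'D_(delta_mx ord0 i) g x.

Definition partials (s : seq 'I_n) (g : E -> R) : E -> R := foldr partial g s.

Definition smooth (g : E -> R) : Prop := forall s : seq 'I_n,
  continuous (partials s g) /\
  forall x i, derivable (partials s g) x (delta_mx ord0 i).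

Definition Dmulti (a : multi_index) (g : E -> R) : E -> R :=
  partials (flatten [seq nseq (a i) i | i <- enum 'I_n]) g.

(* Continuity, derivatives and integrals of complex-valued functions are taken
   on the real and imaginary parts. *)

Definition cRe (f : E -> C) : E -> R := fun x => complex.Re (f x).
Definition cIm (f : E -> C) : E -> R := fun x => complex.Im (f x).

Definition cmod (z : C) : R := ComplexField.Normc.normc z.

Definition ccontinuous (f : E -> C) : Prop :=
  continuous (cRe f) /\ continuous (cIm f).

Definition csmooth (f : E -> C) : Prop := smooth (cRe f) /\ smooth (cIm f).

Definition cDmulti (a : multi_index) (f : E -> C) : E -> C :=
  fun x => Dmulti a (cRe f) x +i* Dmulti a (cIm f) x.

Definition csupport (f : E -> C) : set E := closure [set x | f x != 0].

Definition Cc_smooth (f : E -> C) : Prop :=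
  csmooth f /\ compact (csupport f).

Definition cintegrable (f : E -> C) : Prop :=
  (lebesgue_rV R n).-integrable setT (EFin \o cRe f) /\
  (lebesgue_rV R n).-integrable setT (EFin \o cIm f).

Definition cintegral (f : E -> C) : C :=
  (\int[lebesgue_rV R n]_x cRe f x) +i* (\int[lebesgue_rV R n]_x cIm f x).

(* The Fourier transform is normalized as
   int f(x) e^(-2 pi i x.xi) dx, so that its inverse has no constant. *)

Definition cis (t : R) : C := cos t +i* sin t.

Definition fourier (f : E -> C) : E -> C := fun xi =>
  cintegral (fun x => f x * cis (- (2 * pi * dot x xi))).

Definition invfourier (f : E -> C) : E -> C := fun x =>
  cintegral (fun xi => f xi * cis (2 * pi * dot x xi)).

End calculus.

Section distributions.
Variables (R : realType) (n : nat).
Local Notation E := 'rV[R]_n.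
Local Notation C := R[i].

Definition schwartz_seminorm (a b : multi_index n) (f : E -> C) : \bar R :=
  ereal_sup (range (fun x => (`|monomial a x| * cmod (cDmulti b f x))%:E)).

Definition schwartz : set (E -> C) := [set f | csmooth f /\
  forall a b, (schwartz_seminorm a b f < +oo)%E].

Definition schwartz0 : set (E -> C) := [set f | schwartz f /\
  forall a, cDmulti a (fourier f) 0 = 0].

(* A functional on a set A of Schwartz functions is a function on all of
   E -> C whose values outside A are irrelevant.  Continuity is with respect to
   the topology of the seminorms, a basis of neighbourhoods of f in A being
   given by the g in A with schwartz_seminorm a b (g - f) < d for all
   multi-indices a, b of length at most N. *)

Definition linear_on (A : set (E -> C)) (u : (E -> C) -> C) : Prop :=
  forall c f g, A f -> A g -> u (fun x => c * f x + g x) = c * u f + u g.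

Definition schwartz_continuous_on (A : set (E -> C)) (u : (E -> C) -> C) : Prop :=
  forall f, A f -> forall e : R, 0 < e ->
  exists (N : nat) (d : R), 0 < d /\
    forall g, A g ->
      (forall a b, (mi_abs a <= N)%N -> (mi_abs b <= N)%N ->
        (schwartz_seminorm a b (fun x => (g x - f x)%R) < d%:E)%E) ->
      cmod (u g - u f) < e.

Definition dual_of (A : set (E -> C)) : set ((E -> C) -> C) :=
  [set u | linear_on A u /\ schwartz_continuous_on A u].

Definition tempered : set ((E -> C) -> C) := dual_of schwartz.

Definition tempered0 : set ((E -> C) -> C) := dual_of schwartz0.

Definition dist_fourier (u : (E -> C) -> C) : (E -> C) -> C :=
  fun psi => u (fourier psi).

Definition dist_invfourier (u : (E -> C) -> C) : (E -> C) -> C :=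
  fun psi => u (invfourier psi).

Definition dist_mul (h : E -> C) (u : (E -> C) -> C) : (E -> C) -> C :=
  fun psi => u (fun x => h x * psi x).

Definition represents (g : E -> C) (u : (E -> C) -> C) : Prop :=
  forall psi, schwartz psi ->
    cintegrable (fun x => g x * psi x) /\
    u psi = cintegral (fun x => g x * psi x).

(* The continuous function that a distribution is given by; there is at most
   one, and for a tempered distribution whose Fourier transform has compact
   support there is one (Paley-Wiener-Schwartz). *)
Definition dist_function (u : (E -> C) -> C) : E -> C :=
  xget (fun=> 0) [set g | ccontinuous g /\ represents g u].

Definition extends0 (F f : (E -> C) -> C) : Prop :=
  forall psi, schwartz0 psi -> F psi = f psi.

Definition extension (f : (E -> C) -> C) : (E -> C) -> C :=
  xget (fun=> 0) [set F | tempered F /\ extends0 F f].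

(* Any other extension of f gives the same function. *)
Definition dyadic_block (phi : int -> E -> C) (j : int) (f : (E -> C) -> C) :
    E -> C :=
  dist_function
    (dist_invfourier (dist_mul (phi j) (dist_fourier (extension f)))).

Definition dyadic_partition (phi : int -> E -> C) : Prop :=
  [/\ forall j, Cc_smooth (phi j),
      forall j, csupport (phi j) `<=`
        [set xi | (2 : R) ^ (j - 1) <= enorm xi <= (2 : R) ^ (j + 1)],
      forall a : multi_index n,
        (ereal_sup [set ((2 : R) ^ (j * (mi_abs a)%:Z) *
                         cmod (cDmulti a (phi j) xi))%:E
                   | j in [set: int] & xi in [set: E]] < +oo)%E &
      (* a sum with at most three nonzero terms *)
      forall xi, xi != 0 -> \sum_(j \in [set: int]) phi j xi = 1].

End distributions.

Section lorentz.
Local Open Scope ereal_scope.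
Context d (T : measurableType d) (R : realType).
Variable mu : {measure set T -> \bar R}.

Definition distr_fun (f : T -> \bar R) (a : R) : \bar R :=
  mu [set x | a%:E < `|f x|].

Definition lorentz_norm (p : R) (q : \bar R) (f : T -> \bar R) : \bar R :=
  match q with
  | q'%:E => (p%:E * \int[lebesgue_measure]_(a in `]0%R, +oo[)
      ((a%:E * distr_fun f a `^ p^-1) `^ q' * (a^-1)%:E)) `^ q'^-1
  | +oo => ereal_sup [set a%:E * distr_fun f a `^ p^-1 | a in `]0%R, +oo[]
  | -oo => 0
  end.

End lorentz.

Definition lr_norm (R : realType) (r : \bar R) (u : int -> R) : \bar R :=
  (match r with
  | r'%:E => (\esum_(j in [set: int]) (`|u j| `^ r')%:E) `^ r'^-1
  | +oo => ereal_sup (range (fun j => `|u j|%:E))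
  | -oo => 0
  end)%E.

Section triebel_lizorkin_lorentz.
Variables (R : realType) (n : nat) (phi : int -> 'rV[R]_n -> R[i]).

Definition tll_norm (s : R) (r : \bar R) (p : R) (q : \bar R)
    (f : ('rV[R]_n -> R[i]) -> R[i]) : \bar R :=
  lorentz_norm (lebesgue_rV R n) p q (fun x =>
    lr_norm r (fun j => 2 `^ (j%:~R * s) * cmod (dyadic_block phi j f x))).

Definition tll_space (s : R) (r : \bar R) (p : R) (q : \bar R) :
    set (('rV[R]_n -> R[i]) -> R[i]) :=
  [set f | tempered0 f /\ (tll_norm s r p q f < +oo)%E].

End triebel_lizorkin_lorentz.

(* Main.v *)
Require Import Defs.
From HB Require Import structures.
From mathcomp Require Import all_boot all_order all_algebra.
From mathcomp.real_closed Require Import complex.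
From mathcomp Require Import all_classical all_reals all_analysis.
From mathcomp Require Import measurable_realfun.
From mathcomp Require Import ring lra zify.

Set Implicit Arguments.
Unset Strict Implicit.
Unset Printing Implicit Defensive.
Import Order.TTheory GRing.Theory Num.Theory.
Import numFieldNormedType.Exports.

Local Open Scope classical_set_scope.
Local Open Scope ring_scope.

(** A Lorentz quasi-norm depends on a function only through its decreasing
    rearrangement, and up to constants only through the values [a k] of the
    rearrangement at the points 2^(k n): it is comparable to the norm in l^q of
    the sequence 2^(k n / p) a_k ([lorentz_norm_levels],
    [lorentz_norm_le_levels]).  Let [a] and [b] be such sequences for the two
    functions whose quasi-norms are on the right.  Outside a set of measure at
    most 2 times 2^(k n) the first function is at most [a k] and the second at
    most [b k].  Hence it is enough to bound the function on the left, at the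
    points where this holds, by some number [c k], and then to bound the weighted
    l^q norm of [c] by the geometric mean of the weighted norms of [a] and [b];
    this is [level_inequality], and [lorentz_interpolation] draws the conclusion.

    The dyadic blocks enter through a single property.  The spectrum of the block
    of index j lies in a ball of radius 2^(j+1), so that the block is equal to its
    averages against a rapidly decreasing kernel of width 2^(-j)
    ([average_reproduces], [block_le_average]).  In such an average a function
    with rearrangement [a] contributes through the numbers [a i], weighted by a
    two-sided geometric sequence centred at i = -j ([integral_decay_weight_le]).
    Therefore the block of index j is bounded everywhere, and not only outside an
    exceptional set, in terms of the levels near -j ([block_le_levels]).  The
    kernel is a tensor power of a Schwartz function on the line whose Fourier
    transform is constant near the origin.  It is built as the cosine transform
    of a bump that is cut out of the given partition of unity ([exists_bump]).
    That its own transform is constant near the origin is Fourier inversion for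
    the bump; this is proved by writing the kernel as a superposition of the
    functions (1 - cos (t x)) / x^2, whose integrals over x are proportional to
    the absolute value of t ([kernel1_integral]).

    It remains to prove the level inequality under each of the five conditions;
    t is the interpolation parameter and F_j the modulus of the block of index j.
    - If the smoothness s is the interpolated one and both exponents q and r are
      large enough, the function on the left is at most the geometric mean of the
      functions on the right by Hölder's inequality in l^r, and Hölder's
      inequality in l^q concludes ([level_inequality_holder]).
    - If s1 = s2 and p1, p2 are distinct, c_k is the smaller of a_k and b_k.  Its
      weighted terms are bounded by an increasing and by a decreasing geometric
      sequence, and such a minimum sums to the geometric mean
      ([level_inequality_min], through [zsum_two_sided]).
    - If s1 and s2 are distinct, the same two-sided bound holds for the terms
      2^(js) F_j at every point, which bounds their sum over j and so their norm in
      l^r for every r ([level_inequality_sum]).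
    - If s is smaller than the interpolated smoothness, the terms with -j at most
      k are bounded at level k by c_k and decrease geometrically in j, while the
      others are bounded by their averages at level -j; the decay of the latter
      comes from p being finite.  The sum over j is a convolution of the weighted
      levels with a geometric sequence, to which Young's inequality applies
      ([level_inequality_embedding]).
    - If moreover the two spaces on the right do not lie on the same Sobolev line,
      the same splitting is combined with the minimum of the bounds coming from
      each of the two spaces in weak form.  For fixed j + k the minimum sums over
      j in both directions, and the splitting gives the decay in j + k
      ([level_inequality_generic]). *)

(** * Sums over the integers *)

Section zsum.
Variable R : realType.
Local Open Scope ereal_scope.
Implicit Types (F G : int -> \bar R).

Definition zsum F : \bar R := \esum_(j in [set: int]) F j.

(** An enumeration of the integers, through which the results on series indexed
    by natural numbers apply to [zsum]. *)
Definition nat_to_int (i : nat) : int := if odd i then Negz i./2 else Posz i./2.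

Lemma nat_to_int_bij : set_bij [set: nat] [set: int] nat_to_int.
Proof.
split => //.
- move=> i j _ _; rewrite /nat_to_int.
  case: ifPn => oi; case: ifPn => oj // -[eij].
  + by rewrite -(odd_double_half i) -(odd_double_half j) oi oj eij.
  + by rewrite -(odd_double_half i) -(odd_double_half j) (negbTE oi) (negbTE oj) eij.
- move=> [k|k] _ /=.
  + by exists k.*2 => //; rewrite /nat_to_int odd_double doubleK.
  + by exists k.*2.+1 => //; rewrite /nat_to_int /= odd_double /= uphalf_double.
Qed.

Lemma zsumE F : (forall j, 0 <= F j) ->
  zsum F = \sum_(i <oo) F (nat_to_int i).
Proof.
move=> F0; rewrite /zsum (reindex_esum _ _ _ _ nat_to_int_bij).
by rewrite nneseries_esumT.
Qed.

Lemma zsum_ge0 F : (forall j, 0 <= F j) -> 0 <= zsum F.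
Proof. by move=> F0; apply: esum_ge0. Qed.

Lemma le_zsum F G : (forall j, F j <= G j) -> zsum F <= zsum G.
Proof. by move=> FG; apply: le_esum. Qed.

Lemma eq_zsum F G : F =1 G -> zsum F = zsum G.
Proof. by move=> /funext ->. Qed.

Lemma zsum_ge_term F i : (forall j, 0 <= F j) -> F i <= zsum F.
Proof.
move=> F0; apply: esum_ge; exists [set i]; first by split.
by rewrite fsbig_set1.
Qed.

Lemma zsum0 : zsum (fun=> 0) = 0.
Proof. exact: esum1. Qed.

Lemma zsumZ F (c : \bar R) : 0 <= c -> (forall j, 0 <= F j) ->
  zsum (fun j => c * F j) = c * zsum F.
Proof.
case: c => [c| |//] c0 F0.
  rewrite !zsumE//; last by move=> j; exact: mule_ge0.
  by rewrite nneseriesZl.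
(* For an infinite factor both sides are infinite, unless all terms vanish. *)
have [F00|/existsNP[j /eqP Fj0]] := pselect (forall j, F j = 0).
  rewrite (eq_zsum F00) (eq_zsum (F := fun j => +oo * F j) (G := fun=> 0)).
    by rewrite zsum0 mule0.
  by move=> j; rewrite F00 mule0.
have Fj : 0 < F j by rewrite lt0e Fj0 F0.
rewrite gt0_mulye; last exact: lt_le_trans (zsum_ge_term j F0).
apply/eqP; rewrite -leye_eq.
apply: le_trans (zsum_ge_term j _); last by move=> i; exact: mule_ge0.
by rewrite gt0_mulye.
Qed.

Lemma zsumD F G : (forall j, 0 <= F j) -> (forall j, 0 <= G j) ->
  zsum (fun j => F j + G j) = zsum F + zsum G.
Proof. by move=> F0 G0; apply: esumD. Qed.

Lemma zsum_reindex F (e e' : int -> int) : cancel e e' -> cancel e' e ->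
  zsum F = zsum (fun j => F (e j)).
Proof.
move=> ee' e'e; rewrite /zsum (@reindex_esum R int int setT setT e) //.
split => //; first by move=> i j _ _; exact: can_inj ee' _ _.
by move=> j _; exists (e' j).
Qed.

Lemma zsum_shift F k : zsum F = zsum (fun j => F (j + k)%R).
Proof. exact: (zsum_reindex _ (addrK k) (subrK k)). Qed.

Lemma zsum_rev F k : zsum F = zsum (fun j => F (k - j)%R).
Proof. by apply: (@zsum_reindex _ _ (fun j => k - j)%R) => j; rewrite subKr. Qed.

Lemma zsum_swap (a : int -> int -> \bar R) : (forall i j, 0 <= a i j) ->
  zsum (fun i => zsum (a i)) = zsum (fun j => zsum (a ^~ j)).
Proof.
move=> a0; rewrite zsumE; last by move=> i; exact: zsum_ge0.
rewrite [RHS]zsumE; last by move=> i; exact: zsum_ge0.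
under eq_eseriesr do rewrite zsumE//.
under [RHS]eq_eseriesr do rewrite zsumE//.
by rewrite nneseries_interchange.
Qed.

End zsum.

(** * Powers of 2 and geometric sums *)

Section powers.
Variable R : realType.

Definition pow2 (x : R) : R := 2 `^ x.

Lemma pow2_gt0 x : 0 < pow2 x. Proof. exact: powR_gt0. Qed.
Lemma pow2_ge0 x : 0 <= pow2 x. Proof. exact: powR_ge0. Qed.
Lemma pow20 : pow2 0 = 1. Proof. exact: powRr0. Qed.
Lemma pow2D x y : pow2 (x + y) = pow2 x * pow2 y.
Proof. by rewrite /pow2 powRD//; apply/implyP => _; rewrite pnatr_eq0. Qed.
Lemma pow2N x : pow2 (- x) = (pow2 x)^-1. Proof. exact: powRN. Qed.
Lemma pow2M x y : pow2 (x * y) = pow2 x `^ y. Proof. exact: powRrM. Qed.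
Lemma ler_pow2 x y : x <= y -> pow2 x <= pow2 y.
Proof. by move=> xy; apply: ler_powR => //; rewrite ler1n. Qed.
Lemma ler_pow2E x y : (pow2 x <= pow2 y) = (x <= y).
Proof.
apply/idP/idP; last exact: ler_pow2.
apply: contraLR; rewrite -!ltNge => yx.
rewrite -(subrK y x) pow2D -[ltLHS]mul1r ltr_pM2r ?pow2_gt0//.
rewrite /pow2 /powR pnatr_eq0/= expR_gt1 mulr_gt0 ?subr_gt0// ln_gt0//.
by rewrite ltr1n.
Qed.
Lemma ltr_pow2E x y : (pow2 x < pow2 y) = (x < y).
Proof. by rewrite !ltNge ler_pow2E. Qed.
Lemma pow2_int (j : int) : pow2 j%:~R = 2 ^ j.
Proof. by rewrite /pow2 powR_intmul. Qed.

Lemma pow2_surj a : 0 < a -> exists x, a = pow2 x.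
Proof.
move=> a0; exists (ln a / ln 2); have l2 : ln (2 : R) != 0.
  by rewrite gt_eqF// ln_gt0// ltr1n.
by rewrite /pow2 /powR pnatr_eq0/= mulfVK// lnK.
Qed.

Definition decay (g : R) (d : int) : R := pow2 (- (g * `|d|%:~R)).

Lemma decay_ge0 g d : 0 <= decay g d. Proof. exact: pow2_ge0. Qed.

Lemma decayN g d : decay g (- d) = decay g d.
Proof. by rewrite /decay normrN. Qed.

Lemma decay0 g : decay g 0 = 1.
Proof. by rewrite /decay normr0 mulr0 oppr0 pow20. Qed.

Local Open Scope ereal_scope.

Lemma geometric_nneseries (x : R) : (0 <= x < 1)%R ->
  \sum_(i <oo) (x ^+ i)%:E = ((1 - x)^-1)%:E.
Proof.
move=> /andP[x0 x1]; apply: cvg_lim => //.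
rewrite (_ : (fun n => _) = EFin \o series (geometric 1%R x)); last first.
  apply/funext => n /=; rewrite /series/= -sumEFin; apply: eq_bigr => i _.
  by rewrite mul1r.
apply: cvg_EFin; first exact: nearW.
rewrite -[X in _ --> X]mul1r; apply: cvg_geometric_series.
by rewrite ger0_norm.
Qed.

Lemma zsum_decay g : (0 < g)%R -> exists2 C : R, (0 < C)%R &
  forall m : int, zsum (fun j => (decay g (j - m))%:E) <= C%:E.
Proof.
move=> g0; pose x := pow2 (- g).
have x01 : (0 <= x < 1)%R.
  by rewrite pow2_ge0/= -pow20 ltr_pow2E oppr_lt0.
have dE (i : nat) : (pow2 (- (g * i%:R)) = x ^+ i)%R.
  by rewrite -mulNr pow2M powR_mulrn// pow2_ge0.
have C0 : (0 < (1 - x)^-1)%R by rewrite invr_gt0 subr_gt0; case/andP: x01.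
exists ((1 - x)^-1 + (1 - x)^-1)%R; first exact: addr_gt0.
move=> m; rewrite (zsum_shift _ m) (eq_zsum (G := fun j => (decay g j)%:E)); last first.
  by move=> j; rewrite addrK.
(* The nonnegative and the negative indices give one geometric series each. *)
rewrite /zsum (esumID (range Posz)); last by move=> *; rewrite lee_fin decay_ge0.
rewrite EFinD; apply: leeD.
  rewrite setTI (reindex_esum [set: nat] _ Posz); last first.
    by split => // i j _ _ [].
  rewrite -nneseries_esumT; last by move=> i; rewrite lee_fin decay_ge0.
  rewrite -geometric_nneseries//; apply: lee_nneseries => i *.
    by rewrite lee_fin decay_ge0.
  by rewrite lee_fin -dE /decay.
rewrite setTI (_ : ~` _ = range Negz); last first.
  apply/seteqP; split=> [[i|i]|_ [i _ <-] [j _]]//=.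
    by case; exists i.
  by move=> _; exists i.
rewrite (reindex_esum [set: nat] _ Negz); last by split => // i j _ _ [].
rewrite -nneseries_esumT; last by move=> i; rewrite lee_fin decay_ge0.
rewrite -geometric_nneseries//; apply: lee_nneseries => i *.
  by rewrite lee_fin decay_ge0.
rewrite lee_fin -dE /decay ler_pow2E lerN2 ler_pM2l// NegzE normrN.
by rewrite ler_nat.
Qed.

Let poweR_pinfty (x : \bar R) (t : R) : (0 < t)%R -> x = +oo -> x `^ t = +oo.
Proof. by move=> t0 ->; rewrite poweRyr// gt_eqF. Qed.

(** The smaller of an increasing and a decreasing geometric sequence decays
    geometrically away from the point where they cross, where both have the
    value on the right. *)
Lemma zsum_min_geometric (a b : R) : (0 < a)%R -> (0 < b)%R ->
  exists2 C : R, (0 < C)%R & forall A B : \bar R, 0 <= A -> 0 <= B ->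
  zsum (fun j => mine ((pow2 (j%:~R * a))%:E * A) ((pow2 (- (j%:~R * b)))%:E * B))
    <= C%:E * (A `^ (b / (a + b)) * B `^ (a / (a + b))).
Proof.
move=> a0 b0; have ab0 : (0 < a + b)%R by exact: addr_gt0.
pose g := Num.min a b; have g0 : (0 < g)%R by rewrite lt_min a0.
have [C C0 CP] := zsum_decay g0.
exists (pow2 g * C)%R; first by rewrite mulr_gt0// pow2_gt0.
have t1 : (0 < b / (a + b))%R by exact: divr_gt0.
have t2 : (0 < a / (a + b))%R by exact: divr_gt0.
have RHS0 A B : 0 <= (pow2 g * C)%:E * (A `^ (b / (a + b)) * B `^ (a / (a + b))).
  by rewrite mule_ge0// ?mule_ge0 ?poweR_ge0// lee_fin ltW// mulr_gt0// pow2_gt0.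
have pe x : 0 <= (pow2 x)%:E by rewrite lee_fin pow2_ge0.
have minAB A B : 0 <= A -> 0 <= B -> A = 0 \/ B = 0 -> 
    zsum (fun j => mine ((pow2 (j%:~R * a))%:E * A) ((pow2 (- (j%:~R * b)))%:E * B)) = 0.
  move=> A0 B0 AB; rewrite (eq_zsum (G := fun=> 0)) ?zsum0// => j.
  by case: AB => ->; rewrite mule0; [apply: min_l|apply: min_r]; exact: mule_ge0.
move=> A B A0 B0.
have [/(minAB _ _ A0 B0) -> //|/not_orP[/eqP An0 /eqP Bn0]] := pselect (A = 0 \/ B = 0).
have {}A0 : 0 < A by rewrite lt0e An0.
have {}B0 : 0 < B by rewrite lt0e Bn0.
have C'0 : 0 < (pow2 g * C)%:E by rewrite lte_fin mulr_gt0// pow2_gt0.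
have [Ay|/eqP Ay] := pselect (A = +oo).
  by rewrite (poweR_pinfty _ Ay)// gt0_mulye ?poweR_gt0// gt0_muley// leey.
have [By|/eqP By] := pselect (B = +oo).
  by rewrite (poweR_pinfty _ By)// gt0_muley ?poweR_gt0// gt0_muley// leey.
have : A \is a fin_num by rewrite ge0_fin_numE ?ltey ?ltW.
have : B \is a fin_num by rewrite ge0_fin_numE ?ltey ?ltW.
move=> /fineK BE /fineK AE; move: A0 B0; rewrite -AE -BE !lte_fin.
move: (fine A) (fine B) => {An0 Bn0 Ay By AE BE}{}A {}B.
move=> /pow2_surj[x ->] /pow2_surj[y ->].
rewrite !poweR_EFin -!pow2M -!EFinM -pow2D.
(* [u] is the real abscissa where the two exponents cross, and [T] their common
   value; the decay is counted from the integer below [u]. *)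
set T := (x * _ + _)%R; pose u := ((y - x) / (a + b))%R.
have TA : T = (u * a + x)%R by rewrite /T /u; field; rewrite gt_eqF.
have TB : T = (- (u * b) + y)%R by rewrite /T /u; field; rewrite gt_eqF.
have um : (`|u - (Num.floor u)%:~R| <= 1)%R.
  have := floor_itv u; rewrite intrD => /andP[? ?].
  by rewrite ler_norml; apply/andP; split; lra.
move: (Num.floor u) um => m um.
rewrite mulrAC EFinM; apply: le_trans; last first.
  by apply: lee_wpmul2l (CP m); rewrite lee_fin mulr_ge0// pow2_ge0.
rewrite -zsumZ; [|by rewrite lee_fin mulr_ge0// pow2_ge0|by move=> ?; rewrite lee_fin decay_ge0].
apply: le_zsum => j; rewrite -!EFinM -EFin_min lee_fin -!pow2D.
have -> : (j%:~R * a + x = T + (j%:~R - u) * a)%R by rewrite TA; ring.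
have -> : (- (j%:~R * b) + y = T - (j%:~R - u) * b)%R by rewrite TB; ring.
rewrite ge_min; apply/orP.
rewrite !ler_pow2E intr_norm intrD intrN.
have [ju|ju] := leP u j%:~R.
  right; have gb : (g <= b)%R by rewrite ge_min lexx orbT.
  have : (`|j%:~R - m%:~R| <= (j%:~R - u) + 1 :> R)%R.
    by move: um; rewrite !ler_norml => /andP[? ?]; apply/andP; split; lra.
  move=> h; have := ler_wpM2l (ltW g0) h.
  have : (g * (j%:~R - u) <= b * (j%:~R - u))%R by rewrite ler_wpM2r// subr_ge0.
  by lra.
left; have ga : (g <= a)%R by rewrite ge_min lexx.
have : (`|j%:~R - m%:~R| <= (u - j%:~R) + 1 :> R)%R.
  by move: um; rewrite !ler_norml => /andP[? ?]; apply/andP; split; lra.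
move=> h; have := ler_wpM2l (ltW g0) h.
have : (g * (u - j%:~R) <= a * (u - j%:~R))%R by rewrite ler_wpM2r// subr_ge0 ltW.
by lra.
Qed.

Lemma zsum_min_geometric_neg (a b : R) : (a < 0)%R -> (b < 0)%R ->
  exists2 C : R, (0 < C)%R & forall A B : \bar R, 0 <= A -> 0 <= B ->
  zsum (fun j => mine ((pow2 (j%:~R * a))%:E * A) ((pow2 (- (j%:~R * b)))%:E * B))
    <= C%:E * (A `^ (b / (a + b)) * B `^ (a / (a + b))).
Proof.
move=> a0 b0.
have [|//|C C0 CP] := @zsum_min_geometric (- a) (- b) _ _; rewrite ?oppr_gt0//.
exists C => // A B A0 B0; rewrite (zsum_rev _ 0).
have := CP A B A0 B0; rewrite -opprD !invrN !mulrNN; apply: le_trans.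
by apply: le_zsum => j; rewrite sub0r !mulrN intrN !mulNr.
Qed.

End powers.

(** * The sequence spaces l^q over the integers *)

Section lq.
Variable R : realType.
Local Open Scope ereal_scope.
Implicit Types (u v : int -> \bar R) (q : \bar R).

(** The values may be infinite, as those of a decreasing rearrangement. *)
Definition lq q u : \bar R :=
  match q with
  | r%:E => (zsum (fun j => u j `^ r)) `^ r^-1
  | +oo => ereal_sup (range u)
  | -oo => 0
  end.

Lemma lr_normE q (u : int -> R) : lr_norm q u = lq q (fun j => (`|u j|)%:E).
Proof. by case: q. Qed.

Lemma lee_poweR (x y : \bar R) (r : R) : (0 <= r)%R -> 0 <= x -> x <= y ->
  x `^ r <= y `^ r.
Proof.
move=> r0 x0 xy; apply: gt0_ler_poweR => //; rewrite in_itv/= leey andbT//.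
exact: le_trans xy.
Qed.

Lemma poweRD_gt0 (x : \bar R) (r s : R) : (0 < r)%R -> (0 < s)%R ->
  x `^ (r + s) = x `^ r * x `^ s.
Proof. by move=> r0 s0; apply/poweRD/add_neq0_poweRD_def; rewrite gt_eqF ?addr_gt0. Qed.

Lemma poweR_invK (x : \bar R) (r : R) : (0 < r)%R -> 0 <= x ->
  (x `^ r) `^ r^-1 = x.
Proof. by move=> r0 x0; rewrite -poweRrM divff ?gt_eqF// poweRe1. Qed.

Lemma poweRK_inv (x : \bar R) (r : R) : (0 < r)%R -> 0 <= x ->
  (x `^ r^-1) `^ r = x.
Proof. by move=> r0 x0; rewrite -poweRrM mulVf ?gt_eqF// poweRe1. Qed.

Lemma lq_ge0 q u : (forall j, 0 <= u j) -> 0 <= lq q u.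
Proof.
move=> u0; case: q => [r| |] //=; first exact: poweR_ge0.
by apply: le_trans (u0 0%R) _; apply: ereal_sup_ubound; exists 0%R.
Qed.

Lemma le_lq q u v : 1 <= q -> (forall j, 0 <= u j) -> (forall j, u j <= v j) ->
  lq q u <= lq q v.
Proof.
case: q => [r| |] //=; rewrite ?lee_fin => r1 u0 uv.
  have r0 : (0 <= r)%R by exact: le_trans r1.
  apply: lee_poweR; rewrite ?invr_ge0//.
    by apply: zsum_ge0 => j; exact: poweR_ge0.
  by apply: le_zsum => j; exact: lee_poweR.
apply: ge_ereal_sup => _ [j _ <-]; apply: le_trans (uv j) _.
by apply: ereal_sup_ubound; exists j.
Qed.

Lemma lq_ge_term q u i : 1 <= q -> (forall j, 0 <= u j) -> u i <= lq q u.
Proof.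
case: q => [r| |] //=; rewrite ?lee_fin => r1 u0; last first.
  by apply: ereal_sup_ubound; exists i.
have r0 : (0 < r)%R by exact: lt_le_trans r1.
rewrite -[leLHS](poweR_invK r0)//; apply: lee_poweR; [|exact: poweR_ge0|].
  by rewrite invr_ge0 ltW.
by apply: (zsum_ge_term (F := fun j => u j `^ r) i) => j; exact: poweR_ge0.
Qed.

Lemma lqZ q u (c : R) : 1 <= q -> (0 <= c)%R -> (forall j, 0 <= u j) ->
  lq q (fun j => c%:E * u j) <= c%:E * lq q u.
Proof.
case: q => [r| |] //=; rewrite ?lee_fin => r1 c0 u0.
  have r0 : (0 < r)%R by exact: lt_le_trans r1.
  have cr : (0 <= c `^ r)%R by exact: powR_ge0.
  rewrite (eq_zsum (G := fun j => (c `^ r)%:E * u j `^ r)); last first.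
    by move=> j; rewrite poweRM.
  rewrite zsumZ//; last by move=> j; exact: poweR_ge0.
  rewrite poweRM//; last by apply: zsum_ge0 => j; exact: poweR_ge0.
  by rewrite -poweR_EFin poweR_invK.
apply: ge_ereal_sup => _ [j _ <-]; apply: lee_wpmul2l => //.
by apply: ereal_sup_ubound; exists j.
Qed.

Lemma lq_shift q u k : lq q (fun j => u (j + k)%R) = lq q u.
Proof.
case: q => [r| |] //=; first by rewrite -(zsum_shift (fun j => u j `^ r)).
congr ereal_sup; apply/seteqP; split=> [_ [j _ <-]|_ [j _ <-]].
  by exists (j + k)%R.
by exists (j - k)%R; rewrite // subrK.
Qed.

Lemma lq1 u : (forall j, 0 <= u j) -> lq 1 u = zsum u.
Proof.
move=> u0; rewrite /lq invr1 poweRe1.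
  by apply: eq_zsum => j; rewrite poweRe1.
by apply: zsum_ge0 => j; exact: poweR_ge0.
Qed.

(** Every term is at most the norm, and the surplus of the larger exponent is
    spent on this bound. *)
Lemma lq_nested q q' u : 1 <= q -> q <= q' -> (forall j, 0 <= u j) ->
  lq q' u <= lq q u.
Proof.
case: q => [r| |] //; rewrite ?lee_fin => r1; last first.
  by rewrite leye_eq => /eqP ->.
have r0 : (0 < r)%R by exact: lt_le_trans r1.
case: q' => [r'| |] //; last first.
  move=> _ u0; apply: ge_ereal_sup => _ [j _ <-].
  exact: (@lq_ge_term r%:E).
rewrite lee_fin le_eqVlt => /predU1P[->//|rr'] u0.
have r'0 : (0 < r')%R by exact: lt_trans rr'.
rewrite /=; set S := zsum (fun j => u j `^ r).
have S0 : 0 <= S by apply: zsum_ge0 => j; exact: poweR_ge0.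
have d0 : (0 < r' - r)%R by rewrite subr_gt0.
have uS j : u j `^ r' <= S `^ ((r' - r) / r) * u j `^ r.
  rewrite -[X in _ `^ X](subrK r) poweRD_gt0//.
  apply: lee_wpmul2r; first exact: poweR_ge0.
  have -> : u j `^ (r' - r) = (u j `^ r) `^ ((r' - r) / r).
    by rewrite -poweRrM mulrC divfK// gt_eqF.
  apply: lee_poweR; [by rewrite divr_ge0 ?ltW|exact: poweR_ge0|].
  by apply: (zsum_ge_term (F := fun j => u j `^ r) j) => i; exact: poweR_ge0.
have -> : S `^ r^-1 = (S `^ (r' / r)) `^ r'^-1.
  by rewrite -poweRrM mulrAC divff ?gt_eqF// mul1r.
apply: lee_poweR; [by rewrite invr_ge0 ltW| |].
  by apply: zsum_ge0 => j; exact: poweR_ge0.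
apply: le_trans (le_zsum uS) _.
rewrite zsumZ ?poweR_ge0//; last by move=> j; exact: poweR_ge0.
have -> : (r' / r = (r' - r) / r + 1)%R by field; rewrite gt_eqF.
by rewrite poweRD_gt0 ?divr_gt0// poweRe1.
Qed.

(** Young's inequality for the conjugate exponents 1 / (1 - t) and 1 / t. *)
Lemma weighted_AMGM (x y t : R) : (0 < t < 1)%R -> (0 <= x)%R -> (0 <= y)%R ->
  (x `^ (1 - t) * y `^ t <= (1 - t) * x + t * y)%R.
Proof.
move=> /andP[t0 t1] x0 y0; have t'0 : (0 < 1 - t)%R by rewrite subr_gt0.
have := @conjugate_powR _ (x `^ (1 - t))%R (y `^ t)%R (1 - t)^-1%R t^-1%R
  (powR_ge0 _ _) (powR_ge0 _ _).
rewrite !invr_gt0 => /(_ t'0 t0); rewrite !invrK subrK => /(_ erefl).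
rewrite -!powRrM !divff ?gt_eqF// !powRr1//.
by rewrite [(x * _)%R]mulrC [(y * _)%R]mulrC.
Qed.

(** Hölder's inequality in the form of the logarithmic convexity of sums. *)
Lemma zsum_holder (x y : int -> \bar R) (t : R) : (0 < t < 1)%R ->
  (forall j, 0 <= x j) -> (forall j, 0 <= y j) ->
  zsum (fun j => x j `^ (1 - t) * y j `^ t) <=
  (zsum x) `^ (1 - t) * (zsum y) `^ t.
Proof.
move=> t01 x0 y0; have /andP[t0 t1] := t01.
have t'0 : (0 < 1 - t)%R by rewrite subr_gt0.
have X0 : 0 <= zsum x by exact: zsum_ge0.
have Y0 : 0 <= zsum y by exact: zsum_ge0.
have term0 (z : int -> \bar R) : (forall j, 0 <= z j) -> zsum z = 0 -> forall j, z j = 0.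
  move=> z0 zs j; apply/eqP; rewrite eq_le z0 andbT -zs.
  exact: zsum_ge_term.
have [/(term0 _ x0) xj|/eqP Xn0] := pselect (zsum x = 0).
  rewrite (eq_zsum (G := fun=> 0)) ?zsum0; first by rewrite mule_ge0 ?poweR_ge0.
  by move=> j; rewrite xj poweR0r ?mul0e// gt_eqF.
have [/(term0 _ y0) yj|/eqP Yn0] := pselect (zsum y = 0).
  rewrite (eq_zsum (G := fun=> 0)) ?zsum0; first by rewrite mule_ge0 ?poweR_ge0.
  by move=> j; rewrite yj poweR0r ?mule0// gt_eqF.
have {}X0 : 0 < zsum x by rewrite lt0e Xn0.
have {}Y0 : 0 < zsum y by rewrite lt0e Yn0.
have [Xy|/eqP Xy] := pselect (zsum x = +oo).
  by rewrite Xy poweRyr ?gt_eqF// gt0_mulye ?leey// poweR_gt0.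
have [Yy|/eqP Yy] := pselect (zsum y = +oo).
  by rewrite Yy poweRyr ?gt_eqF// gt0_muley ?leey// poweR_gt0.
have Xf : zsum x \is a fin_num by rewrite ge0_fin_numE ?ltey ?ltW.
have Yf : zsum y \is a fin_num by rewrite ge0_fin_numE ?ltey ?ltW.
have xf j : x j \is a fin_num.
  rewrite ge0_fin_numE//; apply: le_lt_trans (zsum_ge_term j x0) _.
  by rewrite ltey.
have yf j : y j \is a fin_num.
  rewrite ge0_fin_numE//; apply: le_lt_trans (zsum_ge_term j y0) _.
  by rewrite ltey.
(* Both sums are now positive and finite: normalize the terms by them, apply the
   weighted mean inequality to each, and add up. *)
pose a := fine (zsum x); pose b := fine (zsum y).
have aE : zsum x = a%:E by rewrite fineK.
have bE : zsum y = b%:E by rewrite fineK.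
have a0 : (0 < a)%R by rewrite -lte_fin -aE.
have b0 : (0 < b)%R by rewrite -lte_fin -bE.
pose T := (a `^ (1 - t) * b `^ t)%R.
have T0 : (0 <= T)%R by rewrite mulr_ge0 ?powR_ge0.
have step j : x j `^ (1 - t) * y j `^ t <=
    (T * (1 - t) / a)%:E * x j + (T * t / b)%:E * y j.
  rewrite -(fineK (xf j)) -(fineK (yf j)) !poweR_EFin -!EFinM -EFinD lee_fin.
  have fx : (0 <= fine (x j))%R by exact: fine_ge0.
  have fy : (0 <= fine (y j))%R by exact: fine_ge0.
  have := weighted_AMGM t01 (divr_ge0 fx (ltW a0)) (divr_ge0 fy (ltW b0)).
  move=> /(ler_wpM2l T0); rewrite /T.
  rewrite mulrACA -!powRM ?divr_ge0 ?(ltW a0) ?(ltW b0)//.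
  rewrite [(a * _)%R]mulrC [(b * _)%R]mulrC !divfK ?gt_eqF//.
  by move=> /le_trans; apply; rewrite le_eqVlt; apply/orP; left; apply/eqP; ring.
have c1 : (0 <= T * (1 - t) / a)%R by rewrite divr_ge0 ?mulr_ge0 ?powR_ge0 ?(ltW t'0) ?(ltW a0).
have c2 : (0 <= T * t / b)%R by rewrite divr_ge0 ?mulr_ge0 ?powR_ge0 ?(ltW t0) ?(ltW b0).
apply: le_trans (le_zsum step) _.
rewrite zsumD; [|by move=> j; rewrite mule_ge0..].
rewrite !zsumZ// aE bE -!EFinM -EFinD lee_fin.
rewrite !divfK ?gt_eqF// -/T.
by rewrite -mulrDr subrK mulr1.
Qed.

(** The relation between the exponents is an equation between extended reals; it
    becomes usable for computations once the infinite exponents are separated. *)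
Lemma holder_exponents (q1 q2 qs : \bar R) (t : R) : (0 < t < 1)%R ->
  1 <= q1 -> 1 <= q2 -> 1 / qs = (1 - t)%:E / q1 + t%:E / q2 ->
  [\/ exists r1 r2 r, [/\ q1 = r1%:E, q2 = r2%:E, qs = r%:E, (1 <= r)%R &
                       (r^-1 = (1 - t) / r1 + t / r2)%R],
      exists r1 r, [/\ q1 = r1%:E, q2 = +oo, qs = r%:E, (1 <= r)%R &
                    (r^-1 = (1 - t) / r1)%R],
      exists r2 r, [/\ q1 = +oo, q2 = r2%:E, qs = r%:E, (1 <= r)%R &
                    (r^-1 = t / r2)%R] |
      [/\ q1 = +oo, q2 = +oo & qs = +oo]].
Proof.
move=> /andP[t0 t1].
have t'0 : (0 < 1 - t)%R by rewrite subr_gt0.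
have inv1 (r : R) : (1 <= r)%R -> (r%:E^-1 = (r^-1)%:E) /\ (0 < r^-1 <= 1)%R.
  move=> r1; have r0 : (0 < r)%R by exact: lt_le_trans r1.
  by rewrite inver gt_eqF// invr_gt0 r0 invf_le1.
have qsE (z : R) : (0 < z <= 1)%R -> 1 / qs = z%:E ->
    exists r, [/\ qs = r%:E, (1 <= r)%R & (r^-1 = z)%R].
  move=> /andP[z0 z1]; rewrite mul1e; case: qs => [r| |]; last 2 first.
  - by rewrite invey => -[] z0E; rewrite -z0E ltxx in z0.
  - by rewrite inveNy.
  rewrite inver; case: ifPn => // r0 [rz]; exists r; split => //.
  by rewrite -[r]invrK rz invf_ge1.
have le1 (s x : R) : (0 < s < 1)%R -> (0 < x <= 1)%R -> (0 < s * x < 1)%R.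
  move=> /andP[s0 s1] /andP[x0 x1]; rewrite mulr_gt0//=.
  by apply: le_lt_trans s1; rewrite ler_piMr// ltW.
have ht : (0 < t < 1)%R by rewrite t0.
have ht' : (0 < 1 - t < 1)%R by rewrite t'0 gtrBl.
case: q1 => [r1| |//]; case: q2 => [r2| |//]; rewrite ?lee_fin => r11 r21.
- have [-> e1] := inv1 _ r11; have [-> e2] := inv1 _ r21.
  rewrite -!EFinM -EFinD => /qsE[|r [-> ? ?]]; last first.
    by constructor 1; exists r1, r2, r.
  case/andP: e1 => e1 e1'; case/andP: e2 => e2 e2'.
  rewrite addr_gt0 ?mulr_gt0//=.
  rewrite [leRHS](_ : 1 = (1 - t) * 1 + t * 1 :> R)%R; last by rewrite !mulr1 subrK.
  by apply: (@lerD R); rewrite ler_pM2l.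
- have [-> e1] := inv1 _ r11; rewrite invey mule0 adde0 -EFinM.
  move=> /qsE[|r [-> ? ?]]; last by constructor 2; exists r1, r.
  by have /andP[-> /ltW->] := le1 _ _ ht' e1.
- have [-> e2] := inv1 _ r21; rewrite invey mule0 add0e -EFinM.
  move=> /qsE[|r [-> ? ?]]; last by constructor 3; exists r2, r.
  by have /andP[-> /ltW->] := le1 _ _ ht e2.
- rewrite invey !mule0 adde0 mul1e => qs0; constructor 4; split => //.
  case: qs qs0 {qsE} => [r| |] //.
  rewrite inver; case: ifPn => // r0 [] /eqP.
  by rewrite invr_eq0 (negbTE r0).
Qed.

Lemma holder_exponent_ge1 (q1 q2 qs : \bar R) (t : R) : (0 < t < 1)%R ->
  1 <= q1 -> 1 <= q2 -> 1 / qs = (1 - t)%:E / q1 + t%:E / q2 -> 1 <= qs.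
Proof.
move=> t01 q11 q21 /(holder_exponents t01 q11 q21).
by case=> [[r1 [r2 [r [_ _ -> +]]]]|[r1 [r [_ _ -> +]]]|[r2 [r [_ _ -> +]]]|[_ _ ->]];
  rewrite ?lee_fin ?leey.
Qed.

(** For finite exponents this is [zsum_holder] with the parameter [s = t qs / q2]
    for which both sides are the right powers. *)
Lemma lq_holder (q1 q2 qs : \bar R) (t : R) u v : (0 < t < 1)%R ->
  1 <= q1 -> 1 <= q2 -> 1 / qs = (1 - t)%:E / q1 + t%:E / q2 ->
  (forall j, 0 <= u j) -> (forall j, 0 <= v j) ->
  lq qs (fun j => u j `^ (1 - t) * v j `^ t) <=
  lq q1 u `^ (1 - t) * lq q2 v `^ t.
Proof.
move=> t01 q11 q21 hq u0 v0; have /andP[t0 t1] := t01.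
have t'0 : (0 < 1 - t)%R by rewrite subr_gt0.
have sup_ge (w : int -> \bar R) j : w j <= ereal_sup (range w) by apply: ereal_sup_ubound; exists j.
have sup_ge0 (w : int -> \bar R) : (forall j, 0 <= w j) -> 0 <= ereal_sup (range w).
  by move=> w0; exact: le_trans (w0 0%R) (sup_ge w 0%R).
have p0 (x : \bar R) (s : R) : 0 <= x `^ s by exact: poweR_ge0.
(* one exponent is infinite: its sequence is bounded by its supremum *)
have mixed (s a r : R) (w z : int -> \bar R) (B : \bar R) :
    (0 < s)%R -> (0 < a)%R -> (1 <= r)%R -> (r^-1 = s / a)%R ->
    (forall j, 0 <= w j) -> 0 <= B ->
    (forall j, 0 <= z j <= w j `^ s * B) ->
    zsum (fun j => z j `^ r) `^ r^-1 <= (zsum (fun j => w j `^ a) `^ a^-1) `^ s * B.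
  move=> s0 a0 r1 rE w0 B0 zle.
  have r0 : (0 < r)%R by exact: lt_le_trans r1.
  have srE : (s * r = a)%R.
    by rewrite -[r]invrK rE invf_div mulrC divfK// gt_eqF.
  rewrite -poweRrM mulrC -rE.
  rewrite -[B](poweR_invK r0)// -poweRM//; last first.
    by apply: zsum_ge0.
  apply: lee_poweR; [by rewrite invr_ge0 ltW|exact: zsum_ge0|].
  rewrite muleC -zsumZ//; apply: le_zsum => j.
  rewrite muleC -srE poweRrM -poweRM//.
  by have /andP[? ?] := zle j; apply: lee_poweR => //; exact: ltW.
case: (holder_exponents t01 q11 q21 hq).
- move=> [r1 [r2 [r [q1E q2E -> r_ge1 rE]]]].
  move: q11 q21; rewrite q1E q2E !lee_fin => q11 q21 /=.
  have r10 : (0 < r1)%R by exact: lt_le_trans q11.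
  have r20 : (0 < r2)%R by exact: lt_le_trans q21.
  have r0 : (0 < r)%R by exact: lt_le_trans r_ge1.
  pose s := (t * r / r2)%R.
  have s1 : (1 - s = (1 - t) * r / r1)%R.
    have e : (1 = r * ((1 - t) / r1 + t / r2))%R by rewrite -rE mulfV ?gt_eqF.
    by rewrite /s [X in (X - _)%R]e; field; rewrite !gt_eqF.
  have s0 : (0 < s)%R by rewrite divr_gt0 ?mulr_gt0.
  have s01 : (0 < s < 1)%R by rewrite s0 -subr_gt0 s1 divr_gt0 ?mulr_gt0.
  have term j : (u j `^ (1 - t) * v j `^ t) `^ r =
      (u j `^ r1) `^ (1 - s) * (v j `^ r2) `^ s.
    rewrite poweRM// -!poweRrM s1 /s; congr (_ `^ _ * _ `^ _).
      by field; rewrite gt_eqF.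
    by field; rewrite gt_eqF.
  rewrite (eq_zsum term).
  have := @zsum_holder (fun j => u j `^ r1) (fun j => v j `^ r2) s s01
    (fun j => p0 _ _) (fun j => p0 _ _).
  move=> h; apply: le_trans (lee_poweR _ _ h) _; [by rewrite invr_ge0 ltW| |].
    by apply: zsum_ge0 => j; exact: mule_ge0.
  rewrite poweRM// -!poweRrM s1 /s le_eqVlt; apply/orP; left; apply/eqP.
  by congr (_ `^ _ * _ `^ _); field; rewrite !gt_eqF.
- move=> [r1 [r [q1E -> -> r_ge1 rE]]].
  move: q11; rewrite q1E lee_fin => q11 /=.
  apply: mixed => //; first exact: lt_le_trans q11.
  move=> j; rewrite mule_ge0//=; apply: lee_wpmul2l => //.
  by apply: lee_poweR => //; exact: ltW.
- move=> [r2 [r [-> q2E -> r_ge1 rE]]].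
  move: q21; rewrite q2E lee_fin => q21 /=.
  rewrite [leRHS]muleC; apply: mixed => //; first exact: lt_le_trans q21.
  move=> j; rewrite mule_ge0//= muleC; apply: lee_wpmul2l => //.
  by apply: lee_poweR => //; exact: ltW.
- move=> [-> -> ->] /=; apply: ge_ereal_sup => _ [j _ <-].
  apply: lee_pmul => //; apply: lee_poweR => //; exact: ltW.
Qed.

(** Young's inequality for the convolution with a geometrically decaying kernel;
    the constant, the sum of the kernel, is the same for all exponents. *)
Lemma lq_decay (g : R) : (0 < g)%R -> exists2 C : R, (0 < C)%R &
  forall q u, 1 <= q -> (forall j, 0 <= u j) ->
  lq q (fun k => zsum (fun i => (decay g (i - k))%:E * u i)) <= C%:E * lq q u.
Proof.
move=> g0; have [C C0 CP] := zsum_decay g0; exists C => // q u q1 u0.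
have d0 (i k : int) : 0 <= (decay g (i - k))%:E by rewrite lee_fin decay_ge0.
have du i k : 0 <= (decay g (i - k))%:E * u i by exact: mule_ge0.
have CP' i : zsum (fun k => (decay g (i - k))%:E) <= C%:E.
  apply: le_trans (CP i); apply: le_zsum => k.
  by rewrite -opprB decayN.
have sumC w : (forall j, 0 <= w j) ->
    zsum (fun k => zsum (fun i => (decay g (i - k))%:E * w i)) <= C%:E * zsum w.
  move=> w0; rewrite zsum_swap; last by move=> k i; exact: mule_ge0.
  rewrite -zsumZ ?lee_fin ?(ltW C0)//; apply: le_zsum => i.
  under eq_zsum do rewrite muleC.
  by rewrite zsumZ// muleC; exact: lee_wpmul2r.
case: q q1 => [r| |//]; rewrite ?lee_fin => r1; last first.
  rewrite /=; apply: ge_ereal_sup => _ [k _ <-].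
  apply: (@le_trans _ _ (zsum (fun i => (decay g (i - k))%:E * ereal_sup (range u)))).
    apply: le_zsum => i; apply: lee_wpmul2l => //.
    by apply: ereal_sup_ubound; exists i.
  have U0 : 0 <= ereal_sup (range u).
    by apply: le_trans (u0 0%R) _; apply: ereal_sup_ubound; exists 0%R.
  under eq_zsum do rewrite muleC.
  by rewrite zsumZ// muleC; exact: lee_wpmul2r.
move: r1; rewrite le_eqVlt => /predU1P[<-|r1].
  by rewrite !lq1//; [exact: sumC|move=> k; exact: zsum_ge0].
have r0 : (0 < r)%R by exact: lt_trans r1.
have t01 : (0 < r^-1 < 1)%R by rewrite invr_gt0 r0 invf_lt1.
have t'0 : (0 < 1 - r^-1)%R by rewrite subr_gt0; case/andP: t01.
have Cp0 : (0 <= C `^ (r - 1))%R by exact: powR_ge0.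
(* Hölder's inequality with the kernel as a measure of total mass at most [C]. *)
have step k : zsum (fun i => (decay g (i - k))%:E * u i) `^ r <=
    (C `^ (r - 1))%:E * zsum (fun i => (decay g (i - k))%:E * u i `^ r).
  have S0 : 0 <= zsum (fun i => (decay g (i - k))%:E * u i `^ r).
    by apply: zsum_ge0 => i; rewrite mule_ge0 ?poweR_ge0.
  have h : zsum (fun i => (decay g (i - k))%:E * u i) <=
    C%:E `^ (1 - r^-1) * zsum (fun i => (decay g (i - k))%:E * u i `^ r) `^ r^-1.
    have -> : zsum (fun i => (decay g (i - k))%:E * u i) =
        zsum (fun i => (decay g (i - k))%:E `^ (1 - r^-1) *
          ((decay g (i - k))%:E * u i `^ r) `^ r^-1).
      apply: eq_zsum => i; rewrite poweRM ?poweR_ge0// poweR_invK// muleA.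
      congr (_ * _); rewrite -poweRD_gt0 ?invr_gt0// subrK poweRe1//.
    apply: le_trans (zsum_holder t01 _ _) _ => //.
      by move=> i; rewrite mule_ge0 ?poweR_ge0.
    apply: lee_wpmul2r; first exact: poweR_ge0.
    by apply: lee_poweR; [exact: ltW|exact: zsum_ge0|exact: CP].
  apply: le_trans (lee_poweR _ _ h) _; [exact: ltW|by apply: zsum_ge0|].
  rewrite poweRM ?poweR_ge0// poweRK_inv// -poweRrM mulrBl mul1r mulVf ?gt_eqF//.
rewrite /= -[C](@powRr1 _ _); last exact: ltW.
have -> : (C `^ 1)%:E = ((C `^ r)%:E) `^ r^-1.
  by rewrite poweR_EFin -powRrM mulfV ?gt_eqF.
have Z0 : 0 <= zsum (fun j => u j `^ r) by apply: zsum_ge0 => j; exact: poweR_ge0.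
rewrite -poweRM ?lee_fin ?powR_ge0//.
apply: lee_poweR; [by rewrite invr_ge0 ltW| |].
  by apply: zsum_ge0 => j; exact: poweR_ge0.
apply: le_trans (le_zsum step) _.
rewrite zsumZ ?lee_fin//; last first.
  by move=> k; apply: zsum_ge0 => i; rewrite mule_ge0 ?poweR_ge0.
have -> : (C `^ r = C `^ (r - 1) * C)%R by rewrite mulrC mulr_powRB1// ltW.
rewrite EFinM -muleA; apply: lee_wpmul2l; first by rewrite lee_fin.
by apply: sumC => j; exact: poweR_ge0.
Qed.

End lq.

(** * Lorentz quasi-norms through dyadic levels of the distribution function *)

Section zsum_integral.
Context d (T : measurableType d) (R : realType).
Variable mu : {measure set T -> \bar R}.
Local Open Scope ereal_scope.

Lemma measurable_zsum (D : set T) (f : int -> T -> \bar R) :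
  measurable D -> (forall k, measurable_fun D (f k)) ->
  (forall k x, D x -> 0 <= f k x) ->
  measurable_fun D (fun x => zsum (f ^~ x)).
Proof.
move=> mD mf f0.
apply: (eq_measurable_fun (fun x => \sum_(i <oo) f (nat_to_int i) x)).
  by move=> x /set_mem Dx; rewrite zsumE// => j; exact: f0.
by apply: ge0_emeasurable_sum => // i x Dx _; exact: f0.
Qed.

Lemma ge0_integral_zsum (D : set T) (f : int -> T -> \bar R) :
  measurable D -> (forall k, measurable_fun D (f k)) ->
  (forall k x, D x -> 0 <= f k x) ->
  \int[mu]_(x in D) zsum (f ^~ x) = zsum (fun k => \int[mu]_(x in D) f k x).
Proof.
move=> mD mf f0; rewrite zsumE; last by move=> k; apply: integral_ge0 => x; exact: f0.
rewrite -integral_nneseries//; last by move=> i x; exact: f0.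
by apply: eq_integral => x /set_mem Dx; rewrite zsumE// => j; exact: f0.
Qed.

End zsum_integral.

Section power_integral.
Variables (R : realType) (q : R).
Hypothesis q1 : 1 <= q.
Local Open Scope ereal_scope.
Local Notation leb := (@lebesgue_measure R).

(** The density of the integral that defines the Lorentz quasi-norm. *)
Definition power_weight (a : R) : \bar R := (a `^ q * a^-1)%:E.
Definition below (c : \bar R) : set R := [set a | a%:E < c].

Let q0 : (0 < q)%R. Proof. exact: lt_le_trans q1. Qed.

Lemma measurable_below c : measurable (below c).
Proof.
apply: is_interval_measurable => s t _ tc u /andP[_ ut].
by apply: le_lt_trans tc; rewrite lee_fin.
Qed.

Lemma measurable_power_weight (D : set R) : measurable D ->
  D `<=` `]0%R, +oo[%classic -> measurable_fun D power_weight.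
Proof.
move=> mD D0; apply/measurable_EFinP/measurable_funM.
  by apply: measurable_funTS; exact: measurable_powR.
apply: (eq_measurable_fun (fun a => a `^ (-1))%R).
  move=> a /set_mem/D0/=; rewrite in_itv/= andbT => a0.
  by rewrite powR_inv1// ltW.
by apply: measurable_funTS; exact: measurable_powR.
Qed.

Lemma power_weight_ge0 a : (0 < a)%R -> 0 <= power_weight a.
Proof. by move=> a0; rewrite lee_fin mulr_ge0 ?powR_ge0 ?invr_ge0 ?ltW. Qed.

Lemma power_weightE a : (0 < a)%R -> power_weight a = (a `^ (q - 1))%:E.
Proof.
move=> a0; rewrite /power_weight -(mulr_powRB1 (ltW a0) q0) mulrAC mulfV ?mul1r//.
by rewrite gt_eqF.
Qed.

Definition power_integral c : \bar R :=
  \int[leb]_(a in `]0%R, +oo[) (power_weight a * (\1_(below c) a)%:E).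

Lemma measurable_power_integrand (D : set R) c : measurable D ->
  D `<=` `]0%R, +oo[%classic ->
  measurable_fun D (fun a => power_weight a * (\1_(below c) a)%:E).
Proof.
move=> mD D0; apply: emeasurable_funM; first exact: measurable_power_weight.
apply/measurable_EFinP; apply: measurable_indic; exact: measurable_below.
Qed.

Lemma power_integrand_ge0 c a : `]0%R, +oo[%classic a ->
  0 <= power_weight a * (\1_(below c) a)%:E.
Proof.
by rewrite /= in_itv/= andbT => a0; rewrite mule_ge0 ?power_weight_ge0// lee_fin.
Qed.

Lemma power_integral_le c : 0 <= c -> power_integral c <= c `^ q.
Proof.
case: c => [c| |//]; last by rewrite poweRyr ?leey// gt_eqF.
rewrite lee_fin => c0.
rewrite (@le_trans _ _ (\int[leb]_(a in `]0%R, c[) (c `^ (q - 1))%:E))//; last first.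
  rewrite integral_cst//= lebesgue_measure_itv/= lte_fin.
  move: c0; rewrite le_eqVlt => /predU1P[<-|c0]; first by rewrite ltxx mule0 lee_fin powR_ge0.
  by rewrite c0 -EFinD subr0 -EFinM lee_fin mulrC mulr_powRB1// ltW.
rewrite /power_integral [X in X <= _]integral_mkcond [X in _ <= X]integral_mkcond.
apply: ge0_le_integral => //=.
- by move=> x _; apply: erestrict_ge0 => a; exact: power_integrand_ge0.
- apply/(measurable_restrictT _ _).1 => //; exact: measurable_power_integrand.
- apply/(measurable_restrictT _ _).1 => //; exact: measurable_cst.
- move=> x _; rewrite !patchE !mem_setE !in_itv/= andbT.
  have [x0|x0] //= := ltP 0%R x.
  rewrite power_weightE// indicE; case: ifPn => xc; last first.
    by rewrite memNset ?mule0// /below/= lte_fin; exact/negP.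
  rewrite mem_set ?mule1; last by rewrite /below/= lte_fin.
  by rewrite lee_fin ge0_ler_powR// ?nnegrE ?subr_ge0// ltW.
Qed.

(** The part of the integral between [c / 2] and [c] suffices; hence the factor
    [2 ^ q]. *)
Lemma power_integral_ge c : 0 <= c -> c `^ q <= (2 `^ q)%:E * power_integral c.
Proof.
have I0 c' : 0 <= power_integral c' by apply: integral_ge0 => a; exact: power_integrand_ge0.
have real (r : R) c' : (0 < r)%R -> r%:E <= c' -> (r `^ q)%:E <= (2 `^ q)%:E * power_integral c'.
  move=> r0 rc.
  have h : ((r / 2) `^ q)%:E <= power_integral c'.
    have r20 : (0 < r / 2)%R by rewrite divr_gt0.
    have r2r : (r / 2 < r)%R by rewrite gtr_pMr// invf_lt1// ltr1n.
    have sub : `[(r / 2)%R, r[%classic `<=` `]0%R, +oo[%classic.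
      by move=> x /=; rewrite !in_itv/= andbT => /andP[+ _]; exact: lt_le_trans.
    apply: (@le_trans _ _ (\int[leb]_(a in `[(r/2)%R, r[) ((r / 2) `^ (q - 1))%:E)).
      rewrite integral_cst//= lebesgue_measure_itv/= lte_fin r2r -EFinD.
      have -> : (r - r / 2 = r / 2)%R by field.
      by rewrite -EFinM lee_fin [(_ * (r / 2))%R]mulrC mulr_powRB1// ltW.
    apply: (@le_trans _ _ (\int[leb]_(a in `[(r/2)%R, r[)
        (power_weight a * (\1_(below c') a)%:E))); last first.
      apply: ge0_subset_integral => //; first exact: measurable_power_integrand.
      by move=> x; exact: power_integrand_ge0.
    apply: ge0_le_integral => //=.
    - by move=> x _; rewrite lee_fin powR_ge0.
    - exact: measurable_power_integrand.
    - move=> x /=; rewrite in_itv/= => /andP[rx xr].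
      have x0 : (0 < x)%R by exact: lt_le_trans rx.
      rewrite power_weightE// indicE mem_set ?mule1; last first.
        by apply: lt_le_trans rc; rewrite lte_fin.
      by rewrite lee_fin ge0_ler_powR// ?nnegrE ?subr_ge0// ltW.
  have -> : (r `^ q)%:E = (2 `^ q)%:E * ((r / 2) `^ q)%:E.
    rewrite -EFinM -powRM//; last by rewrite divr_ge0// ltW.
    by congr (_ `^ _)%:E; field.
  by apply: lee_wpmul2l => //; rewrite lee_fin powR_ge0.
case: c => [c| |//].
  rewrite lee_fin le_eqVlt => /predU1P[<-|c0 /=]; last exact: real.
  by rewrite poweR0r ?gt_eqF// mule_ge0// lee_fin powR_ge0.
move=> _; rewrite poweRyr ?gt_eqF//.
suff /eqyP -> : forall A, (0 < A)%R -> A%:E <= (2 `^ q)%:E * power_integral +oo by [].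
move=> A A0; have A'0 : (0 < A `^ q^-1)%R by exact: powR_gt0.
have := real _ +oo A'0 (leey _).
by rewrite -powRrM mulVf ?gt_eqF// powRr1// ltW.
Qed.

End power_integral.

Section level_sum.
Variables (R : realType) (nu e : R).
Hypotheses (nu0 : 0 < nu) (e0 : 0 < e).
Local Open Scope ereal_scope.

(** A geometric sum, comparable to its last term: this makes it a discrete
    version of [m ^ e]. *)
Definition level_sum (m : \bar R) : \bar R :=
  zsum (fun k => (pow2 (k%:~R * nu * e))%:E * (\1_(below m) (pow2 (k%:~R * nu)))%:E).

Let term_ge0 (m : \bar R) (k : int) :
  0 <= (pow2 (k%:~R * nu * e))%:E * (\1_(below m) (pow2 (k%:~R * nu)))%:E.
Proof. by rewrite mule_ge0 ?lee_fin// ?pow2_ge0. Qed.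

Lemma level_sum_le : exists2 C : R, (0 < C)%R &
  forall m, 0 <= m -> level_sum m <= C%:E * m `^ e.
Proof.
have g0 : (0 < nu * e)%R by exact: mulr_gt0.
have [C C0 CP] := zsum_decay g0; exists (pow2 (nu * e) * C)%R.
  by rewrite mulr_gt0// pow2_gt0.
have C'0 : (0 < pow2 (nu * e) * C)%R by rewrite mulr_gt0// pow2_gt0.
case=> [m| |//]; last by rewrite poweRyr ?gt_eqF// gt0_muley ?leey.
rewrite lee_fin le_eqVlt => /predU1P[<-|m0].
  rewrite /level_sum (eq_zsum (G := fun=> 0)) ?zsum0.
    by rewrite mule_ge0 ?poweR_ge0// lee_fin ltW.
  move=> k; rewrite indicE memNset ?mule0//= /below/= lte_fin.
  by apply/negP; rewrite -leNgt pow2_ge0.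
have [z mE] := pow2_surj m0; rewrite mE poweR_EFin -pow2M.
pose K := Num.floor (z / nu).
have /andP[Kz zK] := floor_itv (z / nu); rewrite -/K intrD in Kz zK.
have e0' : (0 <= (pow2 (nu * e) * pow2 (z * e))%:E) by rewrite lee_fin mulr_ge0 ?pow2_ge0.
rewrite -EFinM mulrAC EFinM; apply: le_trans (lee_wpmul2l e0' (CP K)).
rewrite -zsumZ//; last by move=> k; rewrite lee_fin decay_ge0.
apply: le_zsum => k; rewrite indicE.
case: (boolP (_ \in _)) => [|_]; last by rewrite mule0 mule_ge0// lee_fin decay_ge0.
rewrite inE /below/= lte_fin ltr_pow2E mule1 -EFinM lee_fin -!pow2D ler_pow2E => kz.
have : (k%:~R < z / nu)%R by rewrite ltr_pdivlMr.
move=> kz'; have kK : (k <= K)%R by rewrite /K floor_ge_int ltW.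
rewrite ler0_norm ?subr_le0// opprB intrD intrN.
have -> : z = (z / nu * nu)%R by rewrite divfK// gt_eqF.
have := ler_wpM2l (ltW g0) (ltW zK); have := ler_wpM2l (ltW g0) (ltW kz').
have := ler_wpM2l (ltW g0) Kz; move: (z / nu)%R => y.
lra.
Qed.

Lemma level_sum_ge : exists2 C : R, (0 < C)%R &
  forall m, 0 <= m -> m `^ e <= C%:E * level_sum m.
Proof.
have g0 : (0 < nu * e)%R by exact: mulr_gt0.
have S0 m : 0 <= level_sum m by exact: zsum_ge0.
exists (pow2 (nu * e)); first exact: pow2_gt0.
(* [K] is the last index with [K nu < z]. *)
have big m z : (pow2 z)%:E <= m -> (pow2 (z * e))%:E <= (pow2 (nu * e))%:E * level_sum m.
  move=> zm; pose K := (Num.ceil (z / nu) - 1)%R.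
  have /andP[Kz zK] := ceil_itv (z / nu).
  apply: (@le_trans _ _ ((pow2 (nu * e))%:E * (pow2 (K%:~R * nu * e))%:E)).
    rewrite -EFinM lee_fin -pow2D ler_pow2E /K.
    have -> : z = (z / nu * nu)%R by rewrite divfK// gt_eqF.
    rewrite mulfK ?gt_eqF// intrD intrN.
    by have := ler_wpM2l (ltW g0) zK; lra.
  apply: lee_wpmul2l; first by rewrite lee_fin pow2_ge0.
  apply: le_trans (zsum_ge_term K (term_ge0 m)).
  rewrite indicE mem_set ?mule1//= /below/=.
  apply: lt_le_trans zm; rewrite lte_fin ltr_pow2E -ltr_pdivlMr//.
case=> [m| |//].
  rewrite lee_fin le_eqVlt => /predU1P[<-|/pow2_surj[z ->]].
    by rewrite poweR0r ?gt_eqF// mule_ge0// lee_fin pow2_ge0.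
  by rewrite poweR_EFin -pow2M; exact: big.
move=> _; rewrite poweRyr ?gt_eqF//.
suff /eqyP -> : forall A, (0 < A)%R -> A%:E <= (pow2 (nu * e))%:E * level_sum +oo by [].
move=> A /pow2_surj[z ->]; rewrite -[z](divfK (lt0r_neq0 e0)).
exact: big (leey _).
Qed.

End level_sum.

Section lorentz_levels.
Context d (T : measurableType d) (R : realType).
Variable mu : {measure set T -> \bar R}.
Variable nu : R.
Hypothesis nu0 : 0 < nu.
Local Open Scope ereal_scope.
Implicit Types (f : T -> \bar R) (a b : int -> \bar R).

(** [tail_le f a]: [a k] bounds the decreasing rearrangement of [f] at
    [2 ^ (k nu)]. *)
Definition tail_le f a := forall k : int,
  mu [set x | a k < f x] <= (pow2 (k%:~R * nu))%:E.

Definition lorentz_seq (p : R) a : int -> \bar R :=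
  fun k => (pow2 (k%:~R * nu / p))%:E * a k.

Section fixed_function.
Variable f : T -> \bar R.
Hypotheses (mf : measurable_fun setT f) (f0 : forall x, 0 <= f x).

Let level (t : R) : \bar R := distr_fun mu f t.

Let levelE t : level t = mu [set x | t%:E < f x].
Proof.
by rewrite /level /distr_fun; congr (mu _); apply/seteqP; split=> x /=; rewrite gee0_abs.
Qed.

Let msup (c : \bar R) : measurable [set x | c < f x].
Proof. by rewrite -[X in measurable X]setTI; exact: emeasurable_fun_o_infty. Qed.

Let level_ge0 t : 0 <= level t. Proof. exact: measure_ge0. Qed.

Let level_anti s t : (s <= t)%R -> level t <= level s.
Proof.
move=> st; rewrite !levelE; apply: le_measure; rewrite ?inE//.
by move=> x /=; apply: le_lt_trans; rewrite lee_fin.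
Qed.

Let measurable_level : measurable_fun setT level.
Proof.
apply: (measurability _ (ErealGenOInfty.measurableE R)) => // _ [_ [r ->] <-].
rewrite setTI; apply: is_interval_measurable => s t /=; rewrite !in_itv/= !andbT.
move=> _ rt u /andP[_ ut]; rewrite in_itv/= andbT; apply: lt_le_trans rt _.
exact: level_anti.
Qed.

Section finite_exponent.
Variables (p q : R).
Hypotheses (p0 : (0 < p)%R) (q1 : (1 <= q)%R).

Let q0 : (0 < q)%R. Proof. exact: lt_le_trans q1. Qed.
Let e0 : (0 < q / p)%R. Proof. exact: divr_gt0. Qed.

Let J : \bar R :=
  \int[lebesgue_measure]_(t in `]0%R, +oo[) (power_weight q t * level t `^ (q / p)).

Let J0 : 0 <= J.
Proof.
apply: integral_ge0 => t /=; rewrite in_itv/= andbT => t0.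
by rewrite mule_ge0 ?poweR_ge0 ?power_weight_ge0.
Qed.

Let lorentz_normJ : lorentz_norm mu p q%:E f = (p%:E * J) `^ q^-1.
Proof.
rewrite /lorentz_norm; congr ((_ * _) `^ _); apply: eq_integral => t.
rewrite inE/= in_itv/= andbT => t0.
rewrite -/(level t) poweRM ?poweR_ge0 ?lee_fin 1?ltW// -poweRrM.
by rewrite /power_weight EFinM muleAC mulrC.
Qed.

Let seq_sum a := zsum (fun k => (pow2 (k%:~R * nu * (q / p)))%:E * a k `^ q).

Let lqE a : (forall k, 0 <= a k) ->
  lq q%:E (lorentz_seq p a) = seq_sum a `^ q^-1.
Proof.
move=> a0; rewrite /lq; congr (_ `^ _); apply: eq_zsum => k.
rewrite /lorentz_seq poweRM ?lee_fin ?pow2_ge0// poweR_EFin -pow2M.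
by rewrite mulrAC -mulrA.
Qed.

(** The layer cake formula for all levels at once: the power of [a k] is an
    integral over the numbers below [a k], and the sum goes inside. *)
Let swapE a : (forall k, 0 <= a k) ->
  zsum (fun k => (pow2 (k%:~R * nu * (q / p)))%:E * power_integral q (a k)) =
  \int[lebesgue_measure]_(t in `]0%R, +oo[) (power_weight q t *
     zsum (fun k => (pow2 (k%:~R * nu * (q / p)))%:E * (\1_(below (a k)) t)%:E)).
Proof.
move=> a0; under eq_zsum => k.
  rewrite /power_integral -ge0_integralZl//; last 3 first.
  - exact: measurable_power_integrand.
  - by move=> t; exact: power_integrand_ge0.
  - by rewrite lee_fin pow2_ge0.
  over.
rewrite -ge0_integral_zsum//; last 2 first.
- by move=> k; apply: measurable_funeM; exact: measurable_power_integrand.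
- by move=> k t t0; rewrite mule_ge0 ?lee_fin ?pow2_ge0//; exact: power_integrand_ge0.
apply: eq_integral => t; rewrite inE/= in_itv/= andbT => t0.
rewrite -zsumZ ?power_weight_ge0//; last by move=> k; rewrite mule_ge0 ?lee_fin ?pow2_ge0.
by apply: eq_zsum => k; rewrite muleCA.
Qed.

Let mJ : measurable_fun (`]0%R, +oo[%classic : set R)
  (fun t => power_weight q t * level t `^ (q / p)).
Proof.
apply: emeasurable_funM; first exact: measurable_power_weight.
apply: measurable_funTS.
exact: (measurableT_comp (measurable_poweR (q / p)) measurable_level).
Qed.

Let mseq a : measurable_fun (`]0%R, +oo[%classic : set R) (fun t : R => power_weight q t *
     zsum (fun k => (pow2 (k%:~R * nu * (q / p)))%:E * (\1_(below (a k)) t)%:E)).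
Proof.
apply: emeasurable_funM; first exact: measurable_power_weight.
apply: measurable_zsum => //; last by move=> k t _; rewrite mule_ge0 ?lee_fin ?pow2_ge0.
move=> k; apply: measurable_funeM; apply/measurable_EFinP; apply: measurable_indic.
exact: measurable_below.
Qed.

Let poweRZ_inv (c : R) x : (0 < c)%R -> 0 <= x ->
  (c%:E * x) `^ q^-1 = ((c / p) `^ q^-1)%:E * (p%:E * x) `^ q^-1.
Proof.
move=> c0 x0; rewrite -poweR_EFin -poweRM; last 2 first.
- by rewrite lee_fin divr_ge0// ltW.
- by rewrite mule_ge0// lee_fin ltW.
by rewrite muleA -EFinM divfK// gt_eqF.
Qed.

(** The last hypothesis says that [a] does not exceed the rearrangement of [f].  It
    turns the sum under the integral of [swapE] into a part of the [level_sum] of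
    the distribution function. *)
Lemma lq_le_lorentz_norm (C : R) a : (0 < C)%R ->
  (forall m, 0 <= m -> level_sum nu (q / p) m <= C%:E * m `^ (q / p)) ->
  (forall k, 0 <= a k) ->
  (forall k t, (0 < t)%R -> t%:E < a k ->
    (pow2 (k%:~R * nu))%:E < mu [set x | t%:E < f x]) ->
  lq q%:E (lorentz_seq p a) <=
  ((2 `^ q * C / p) `^ q^-1)%:E * lorentz_norm mu p q%:E f.
Proof.
move=> C0 CP a0 aP; rewrite lqE// lorentz_normJ.
have D0 : (0 < 2 `^ q * C)%R by rewrite mulr_gt0// powR_gt0.
rewrite -poweRZ_inv//; apply: lee_poweR; [by rewrite invr_ge0 ltW| |].
  by apply: zsum_ge0 => k; rewrite mule_ge0 ?poweR_ge0// lee_fin pow2_ge0.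
have p2 : 0 <= (2 `^ q)%:E by rewrite lee_fin powR_ge0.
have I0 c : 0 <= power_integral q c by apply: integral_ge0 => t; exact: power_integrand_ge0.
apply: (@le_trans _ _ ((2 `^ q)%:E *
    zsum (fun k => (pow2 (k%:~R * nu * (q / p)))%:E * power_integral q (a k)))).
  rewrite -zsumZ//; last by move=> k; rewrite mule_ge0// lee_fin pow2_ge0.
  apply: le_zsum => k; rewrite muleCA; apply: lee_wpmul2l.
    by rewrite lee_fin pow2_ge0.
  exact: power_integral_ge.
rewrite EFinM -muleA; apply: lee_wpmul2l => //; rewrite swapE// -ge0_integralZl//; last 2 first.
- move=> t /=; rewrite in_itv/= andbT => t0.
  by rewrite mule_ge0 ?poweR_ge0 ?power_weight_ge0.
- by rewrite lee_fin ltW.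
apply: ge0_le_integral => //; [|exact: mseq|by apply: measurable_funeM|] => t /=; rewrite in_itv/= andbT => t0.
  rewrite mule_ge0 ?power_weight_ge0//; apply: zsum_ge0 => k.
  by rewrite mule_ge0// lee_fin ?pow2_ge0.
rewrite muleCA; apply: lee_wpmul2l; first exact: power_weight_ge0.
apply: le_trans (CP _ (level_ge0 t)); apply: le_zsum => k.
apply: lee_wpmul2l; first by rewrite lee_fin pow2_ge0.
rewrite lee_fin !indicE ler_nat; case: (boolP (t \in _)) => //.
by rewrite inE /below/= => /(aP k t t0) h; rewrite mem_set//= levelE.
Qed.

Lemma lorentz_norm_le_lq (C : R) b : (0 < C)%R ->
  (forall m, 0 <= m -> m `^ (q / p) <= C%:E * level_sum nu (q / p) m) ->
  (forall k, 0 <= b k) -> tail_le f b ->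
  lorentz_norm mu p q%:E f <= ((p * C) `^ q^-1)%:E * lq q%:E (lorentz_seq p b).
Proof.
move=> C0 CP b0 bP; rewrite lqE// lorentz_normJ.
have S0 : 0 <= seq_sum b.
  by apply: zsum_ge0 => k; rewrite mule_ge0 ?poweR_ge0// lee_fin pow2_ge0.
rewrite -poweR_EFin -poweRM//; last by rewrite lee_fin mulr_ge0// ltW.
apply: lee_poweR; [by rewrite invr_ge0 ltW|by rewrite mule_ge0// lee_fin ltW|].
rewrite EFinM -muleA; apply: lee_wpmul2l; first by rewrite lee_fin ltW.
apply: (@le_trans _ _ (C%:E *
    zsum (fun k => (pow2 (k%:~R * nu * (q / p)))%:E * power_integral q (b k)))); last first.
  apply: lee_wpmul2l; first by rewrite lee_fin ltW.
  apply: le_zsum => k; apply: lee_wpmul2l; first by rewrite lee_fin pow2_ge0.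
  exact: power_integral_le.
rewrite swapE// -ge0_integralZl//; last 3 first.
- exact: mseq.
- move=> t /=; rewrite in_itv/= andbT => t0.
  rewrite mule_ge0 ?power_weight_ge0//; apply: zsum_ge0 => k.
  by rewrite mule_ge0// lee_fin ?pow2_ge0.
- by rewrite lee_fin ltW.
apply: ge0_le_integral => //.
- move=> t /=; rewrite in_itv/= andbT => t0.
  by rewrite mule_ge0 ?poweR_ge0 ?power_weight_ge0.
- by apply: measurable_funeM; exact: mseq.
move=> t /=; rewrite in_itv/= andbT => t0.
rewrite muleCA; apply: lee_wpmul2l; first exact: power_weight_ge0.
apply: le_trans (CP _ (level_ge0 t)) _; apply: lee_wpmul2l; first by rewrite lee_fin ltW.
apply: le_zsum => k; apply: lee_wpmul2l; first by rewrite lee_fin pow2_ge0.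
rewrite lee_fin !indicE ler_nat; case: (boolP (pow2 _ \in _)) => //.
rewrite inE /below/= => h; rewrite mem_set//= ltNge; apply/negP => bt.
have : level t <= (pow2 (k%:~R * nu))%:E.
  apply: le_trans (bP k); rewrite levelE; apply: le_measure; rewrite ?inE//.
  by move=> x /=; exact: le_lt_trans.
by rewrite leNgt h.
Qed.

End finite_exponent.

(** The infimum of the numbers whose superlevel sets have measure at most
    [2 ^ (k nu)]; by continuity of the measure along increasing unions it is
    itself such a number. *)
Lemma exists_tail : exists a : int -> \bar R,
  [/\ forall k, 0 <= a k, tail_le f a &
      forall k t, (0 < t)%R -> t%:E < a k ->
        (pow2 (k%:~R * nu))%:E < mu [set x | t%:E < f x]].
Proof.
pose S k := [set t%:E | t in [set t | (0 <= t)%R /\ level t <= (pow2 (k%:~R * nu))%:E]].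
have a0 k : 0 <= ereal_inf (S k).
  by apply: le_ereal_inf_tmp => _ [t [t0 _] <-]; rewrite lee_fin.
exists (fun k => ereal_inf (S k)); split => //.
- move=> k; have := a0 k; case E : (ereal_inf (S k)) => [r| |//] r0; last first.
    rewrite (_ : [set _ | _] = set0) ?measure0 ?lee_fin ?pow2_ge0//.
    by apply/seteqP; split => x //=; rewrite ltNge leey.
  pose A (i : nat) := [set x | (r + i.+1%:R^-1)%:E < f x].
  have UA : [set x | r%:E < f x] = \bigcup_i A i.
    apply/seteqP; split=> [x /= rf|x [i _] /=]; last first.
      by apply: lt_trans; rewrite lte_fin ltrDl invr_gt0.
    case E' : (f x) rf => [y| |//] ry; last by exists 0%N => //=; rewrite /A/= E' ltey.
    have yr : (0 < y - r)%R by rewrite subr_gt0 -lte_fin.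
    have [i /= iy] := ltr_add_invr yr.
    exists i => //=; rewrite /A/= E' lte_fin.
    by move: iy; rewrite add0r ltrBrDl.
  rewrite UA; have mA i : measurable (A i) by exact: msup.
  have ndA : nondecreasing_seq A.
    move=> i j ij; apply/subsetPset => x; rewrite /A/=; apply: le_lt_trans.
    by rewrite lee_fin lerD2l lef_pV2 ?posrE// ler_nat.
  have cv := nondecreasing_cvg_mu (mu := mu) mA (bigcup_measurable (fun i _ => mA i)) ndA.
  rewrite -(cvg_lim _ cv)//; apply: lime_le; first exact: cvgP cv.
  apply: nearW => i /=.
  have : ereal_inf (S k) < (r + i.+1%:R^-1)%:E by rewrite E lte_fin ltrDl invr_gt0.
  move=> /ereal_inf_lt[_ [t [t0 tk] <-]]; rewrite lte_fin => ti.
  by apply: le_trans tk; rewrite -levelE; apply: level_anti; exact: ltW.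
- move=> k t t0 ta; rewrite ltNge -levelE; apply/negP => h.
  have : ereal_inf (S k) <= t%:E.
    by apply: ereal_inf_lbound; exists t => //; split => //; exact: ltW.
  by rewrite leNgt ta.
Qed.

End fixed_function.

Let between_ereal (x y : \bar R) : 0 <= x -> x < y ->
  exists2 t : R, (0 < t)%R & x < t%:E < y.
Proof.
case: x => [x| |//] x0; last by rewrite ltNge leey.
rewrite lee_fin in x0; case: y => [y| |//]; last first.
  by move=> _; exists (x + 1)%R; rewrite ?ltr_wpDl// lte_fin ltrDl ltr01/= ltey.
rewrite lte_fin => xy; exists ((x + y) / 2)%R; first by lra.
by rewrite !lte_fin midf_lt//= midf_lt.
Qed.

(** The sequence [a] is the rearrangement of [f] at the points [2 ^ (k nu)]; the
    weights of [lorentz_seq] are these points to the power [1 / p]. *)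
Lemma lorentz_norm_levels (p : R) (q : \bar R) : (0 < p)%R -> 1 <= q ->
  exists2 C : R, (0 < C)%R & forall f, measurable_fun setT f -> (forall x, 0 <= f x) ->
  exists a, [/\ forall k, 0 <= a k, tail_le f a &
    lq q (lorentz_seq p a) <= C%:E * lorentz_norm mu p q f].
Proof.
move=> p0; case: q => [q| |//]; rewrite ?lee_fin => q1.
  have q0 : (0 < q)%R by exact: lt_le_trans q1.
  have [C C0 CP] := level_sum_le nu0 (divr_gt0 q0 p0).
  exists ((2 `^ q * C / p) `^ q^-1)%R.
    by rewrite powR_gt0// divr_gt0// mulr_gt0// powR_gt0.
  move=> f mf f0; have [a [a0 af aP]] := exists_tail mf f0.
  by exists a; split => //; exact: lq_le_lorentz_norm.
exists 1%R => // f mf f0; have [a [a0 af aP]] := exists_tail mf f0.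
exists a; split => //; rewrite mul1e; apply: ge_ereal_sup => _ [k _ <-].
rewrite /lorentz_seq; set N := lorentz_norm _ _ _ _; set w := pow2 _.
have w0 : (0 < w)%R by exact: pow2_gt0.
have N_ge t : (0 < t)%R -> t%:E * mu [set x | t%:E < f x] `^ p^-1 <= N.
  move=> t0; apply: ereal_sup_ubound; exists t; first by rewrite /= in_itv/= andbT.
  congr (_ * mu _ `^ _); apply/seteqP; split=> x /=; by rewrite gee0_abs.
have N0 : 0 <= N.
  by apply: le_trans (N_ge 1%R ltr01); rewrite mule_ge0 ?poweR_ge0.
rewrite leNgt; apply/negP => Nw.
have : N * (w^-1)%:E < a k by rewrite lte_pdivrMr// muleC.
move=> /between_ereal -/(_ _)[|t t0 /andP[Nt ta]].
  by rewrite mule_ge0// lee_fin invr_ge0 ltW.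
have := N_ge t t0; rewrite leNgt => /negP; apply.
apply: lt_le_trans (_ : t%:E * w%:E <= _).
  by rewrite -lte_pdivrMr.
apply: lee_wpmul2l; first by rewrite lee_fin ltW.
rewrite /w pow2M -poweR_EFin; apply: lee_poweR; first by rewrite invr_ge0 ltW.
  by rewrite lee_fin pow2_ge0.
by apply: ltW; exact: aP.
Qed.

(** Any bounds on the tails may replace the rearrangement here, which is how the
    levels built in the proofs of interpolation inequalities are used. *)
Lemma lorentz_norm_le_levels (p : R) (q : \bar R) : (0 < p)%R -> 1 <= q ->
  exists2 C : R, (0 < C)%R & forall f b, measurable_fun setT f -> (forall x, 0 <= f x) ->
    (forall k, 0 <= b k) -> tail_le f b ->
    lorentz_norm mu p q f <= C%:E * lq q (lorentz_seq p b).
Proof.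
move=> p0; case: q => [q| |//]; rewrite ?lee_fin => q1.
  have q0 : (0 < q)%R by exact: lt_le_trans q1.
  have [C C0 CP] := level_sum_ge nu0 (divr_gt0 q0 p0).
  exists ((p * C) `^ q^-1)%R; first by rewrite powR_gt0// mulr_gt0.
  by move=> f b mf f0 b0 fb; exact: lorentz_norm_le_lq.
exists (pow2 (nu / p)) => [|f b mf f0 b0 fb]; first exact: pow2_gt0.
rewrite /lorentz_norm; apply: ge_ereal_sup => y [t + <-].
rewrite /= in_itv/= andbT => t0.
set N := ereal_sup _.
have N_ge k : (pow2 (k%:~R * nu / p))%:E * b k <= N by apply: ereal_sup_ubound; exists k.
set m := distr_fun mu f t; have m0 : 0 <= m by exact: measure_ge0.
have mE : m = mu [set x | t%:E < f x].
  by rewrite /m /distr_fun; congr (mu _); apply/seteqP; split=> x /=; rewrite gee0_abs.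
have tb k : (pow2 (k%:~R * nu))%:E < m -> t%:E < b k.
  move=> h; rewrite ltNge; apply/negP => bt; move: h; rewrite ltNge => /negP; apply.
  apply: le_trans (fb k); rewrite mE; apply: le_measure; rewrite ?inE//.
  - by rewrite -[X in measurable X]setTI; exact: emeasurable_fun_o_infty.
  - by rewrite -[X in measurable X]setTI; exact: emeasurable_fun_o_infty.
  - by move=> x /=; exact: le_lt_trans.
(* the largest level below z, up to a factor *)
have key z : (pow2 z)%:E <= m -> t%:E * (pow2 (z / p))%:E <= (pow2 (nu / p))%:E * N.
  move=> zm; pose K := (Num.ceil (z / nu) - 1)%R.
  have /andP[Kz zK] := ceil_itv (z / nu).
  have zz : (z = z / nu * nu)%R by rewrite divfK// gt_eqF.
  have tK : t%:E < b K.
    apply: tb; apply: lt_le_trans zm; rewrite lte_fin ltr_pow2E.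
    by rewrite [ltRHS]zz ltr_pM2r.
  apply: (@le_trans _ _ ((pow2 (nu / p))%:E * ((pow2 (K%:~R * nu / p))%:E * b K))); last first.
    by apply: lee_wpmul2l; rewrite // lee_fin pow2_ge0.
  rewrite [leRHS]muleA -[X in _ <= X * _]EFinM -pow2D [leLHS]muleC; apply: lee_pmul; rewrite ?lee_fin ?pow2_ge0 ?(ltW t0) ?(ltW tK)//.
  rewrite ler_pow2E -mulrDl ler_pM2r ?invr_gt0//.
  by have := ler_wpM2r (ltW nu0) zK; rewrite -zz /K intrD intrN; lra.
case: (m) m0 key => [c| |//].
  move=> c0 key; have [->|cn0] := eqVneq c 0%R.
    rewrite poweR0r ?mule0 ?mule_ge0 ?lee_fin ?pow2_ge0//.
      by apply: le_trans (N_ge 0%R); rewrite mule_ge0// lee_fin pow2_ge0.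
    by rewrite gt_eqF// invr_gt0.
  have [z cE] : exists z, c = pow2 z.
    by apply: pow2_surj; rewrite lt_neqAle eq_sym cn0 -lee_fin.
  by rewrite cE poweR_EFin -pow2M; apply: key; rewrite cE.
move=> _ key; rewrite poweRyr ?gt_eqF ?invr_gt0// gt0_muley//.
suff /eqyP -> : forall A, (0 < A)%R -> A%:E <= (pow2 (nu / p))%:E * N by [].
move=> A A0; have [z zE] := pow2_surj (divr_gt0 A0 t0).
have := key (z * p)%R (leey _); rewrite mulfK ?gt_eqF// -zE -EFinM.
by rewrite mulrC divfK// gt_eqF.
Qed.

End lorentz_levels.

(** * Cosine and sine transforms of smooth functions of compact support *)

Section jets.
Variable R : realType.
Implicit Types (d : nat -> R -> R).

Lemma is_derive_ex (f : R -> R) (x l : R) : is_derive x 1 f l -> derivable f x 1.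
Proof. by case. Qed.

Lemma is_derive_val (f : R -> R) (x l : R) : is_derive x 1 f l -> 'D_1 f x = l.
Proof. by case. Qed.

Lemma is_derive_mull (c x : R) : is_derive x 1 (fun y : R => c * y) c.
Proof.
have := is_deriveZ c (is_derive_id x (1 : R)).
by move=> h; apply: is_derive_eq h _; rewrite /GRing.scale/= mulr1.
Qed.

Lemma is_derive_mulr (c x : R) : is_derive x 1 (fun y : R => y * c) c.
Proof.
rewrite (_ : (fun _ => _) = (fun y : R => c * y)); first exact: is_derive_mull.
by apply/funext => y; rewrite mulrC.
Qed.

(** A smooth function is handled as the sequence of its derivatives. *)
Definition is_jet d := forall k (x : R), is_derive x 1 (d k) (d k.+1 x).

Lemma jet_continuous d (k : nat) (jd : is_jet d) : continuous (d k).
Proof.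
move=> x; apply: differentiable_continuous; apply/derivable1_diffP.
exact: is_derive_ex (jd k x).
Qed.

Definition jet_shift d : nat -> R -> R := fun k => d k.+1.

Lemma is_jet_shift d : is_jet d -> is_jet (jet_shift d).
Proof. by move=> jd k x; exact: jd. Qed.

(** The derivatives of the product with the variable, by Leibniz's rule. *)
Definition jet_mulX d : nat -> R -> R := fun k x => x * d k x + k%:R * d k.-1 x.

Lemma is_jet_mulX d : is_jet d -> is_jet (jet_mulX d).
Proof.
move=> jd k x; rewrite /jet_mulX.
have dk := jd k x.
have dk1 : is_derive x 1 (fun y : R => k%:R * d k.-1 y) (k%:R * d k x).
  case: k dk => [|k] dk /=.
    by rewrite (_ : (fun _ => _) = cst 0) ?mul0r; [exact: is_derive_cst|apply/funext => y; rewrite mul0r].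
  have := jd k x => dk'.
  exact: (is_deriveZ k.+1%:R dk').
have := is_deriveD (is_deriveM (is_derive_id x 1) dk) dk1.
move=> h; apply: is_derive_eq h _ => /=.
by rewrite -[in RHS]natr1 /GRing.scale/=; ring.
Qed.

End jets.

Section trig_transform.
Variables (R : realType) (A : R).
Hypothesis A0 : 0 < A.
Implicit Types (f : R -> R) (d : nat -> R -> R).
Local Notation leb := (@lebesgue_measure R).
Local Notation D := (`[- A, A]%classic : set R).

Definition cosT f x := \int[leb]_(t in D) (f t * cos (x * t)).
Definition sinT f x := \int[leb]_(t in D) (f t * sin (x * t)).

Lemma integrable_segment (g : R -> R) : continuous g -> leb.-integrable D (EFin \o g).
Proof.
move=> cg; apply: continuous_compact_integrable; first exact: segment_compact.
exact: continuous_subspaceT.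
Qed.

Lemma continuous_mul_cos f x : continuous f -> continuous (fun t => f t * cos (x * t)).
Proof.
move=> cf t; apply: cvgM; first exact: cf.
by apply: continuous_comp; [exact: mulrl_continuous|exact: continuous_cos].
Qed.

Lemma continuous_mul_sin f x : continuous f -> continuous (fun t => f t * sin (x * t)).
Proof.
move=> cf t; apply: cvgM; first exact: cf.
by apply: continuous_comp; [exact: mulrl_continuous|exact: continuous_sin].
Qed.

Let continuous_normr (g : R -> R) : continuous g -> continuous (fun t => `|g t|).
Proof. by move=> cg t; apply: cvg_norm; exact: cg. Qed.

Lemma trigT_bounded f : continuous f -> exists C, forall x,
  `|cosT f x| <= C /\ `|sinT f x| <= C.
Proof.
move=> cf; have cnf := continuous_normr cf.
exists (\int[leb]_(t in D) `|f t|) => x; split.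
- apply: le_trans (le_normr_Rintegral _ _) _ => //.
    exact/integrable_segment/continuous_mul_cos.
  apply: le_Rintegral => //.
  + exact/integrable_segment/continuous_normr/continuous_mul_cos.
  + exact: integrable_segment.
  + by move=> t _; rewrite normrM ler_piMr// cos_max.
- apply: le_trans (le_normr_Rintegral _ _) _ => //.
    exact/integrable_segment/continuous_mul_sin.
  apply: le_Rintegral => //.
  + exact/integrable_segment/continuous_normr/continuous_mul_sin.
  + exact: integrable_segment.
  + by move=> t _; rewrite normrM ler_piMr// sin_max.
Qed.

Let derive_param (F : R -> R) (F' : R -> R) f (x t : R) :
  (forall y : R, is_derive y 1 F (F' y)) ->
  is_derive x 1 (fun y : R => f t * F (y * t)) (t * f t * F' (x * t)).
Proof.
move=> dF; have dlin : is_derive x 1 (fun y : R => y * t) t.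
  exact: is_derive_mulr.
have := is_derive1_comp (f := F) (g := fun y : R => y * t) (x := x) (dF _) dlin.
move=> h; have := is_deriveZ (f t) h.
move=> h2; apply: is_derive_eq h2 _; rewrite /GRing.scale/=; ring.
Qed.

Let is_derive_trig (F F' : R -> R) f (x : R) :
  (forall y : R, is_derive y 1 F (F' y)) -> (forall y, `|F' y| <= 1) ->
  continuous F -> continuous f ->
  is_derive x 1 (fun y : R => \int[leb]_(t in D) (f t * F (y * t)))
    (\int[leb]_(t in D) (t * f t * F' (x * t))).
Proof.
move=> dF bF cF cf.
have cfF y : continuous (fun t => f t * F (y * t)).
  move=> t; apply: cvgM; first exact: cf.
  by apply: continuous_comp; [exact: mulrl_continuous|exact: cF].
have xI : `]x - 1, x + 1[%classic x by rewrite /= in_itv/= ltrDl gtrBl !ltr01.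
have intf y : `]x - 1, x + 1[%classic y -> leb.-integrable D (EFin \o (fun t => f t * F (y * t))).
  by move=> _; exact: integrable_segment.
have der y t : `]x - 1, x + 1[%classic y -> D t -> derivable (fun y : R => f t * F (y * t)) y 1.
  by move=> _ _; exact: is_derive_ex (derive_param f y t dF).
have G0 t : 0 <= `|t * f t| by [].
have intG : leb.-integrable D (EFin \o (fun t => `|t * f t|)).
  apply/integrable_segment/continuous_normr => t.
  by apply: cvgM; [exact: cvg_id|exact: cf].
have pE y t : partial1of2 (fun y t => f t * F (y * t)) y t = t * f t * F' (y * t).
  by rewrite /partial1of2 derive1E; exact: is_derive_val (derive_param f y t dF).
have ub y t : `]x - 1, x + 1[%classic y -> D t ->
    `|partial1of2 (fun y t => f t * F (y * t)) y t| <= `|t * f t|.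
  by move=> _ _; rewrite pE normrM ler_piMr.
have mD : measurable (D : set (measurableTypeR R)) by exact: measurable_itv.
apply: DeriveDef.
  exact: (derivable_under_integral mD xI intf der G0 intG ub).
rewrite -derive1E (differentiation_under_integral mD xI intf der G0 intG ub).
by apply: eq_Rintegral => t _; rewrite pE.
Qed.

Lemma is_derive_cosT f (x : R) : continuous f ->
  is_derive x 1 (cosT f) (- sinT (fun t => t * f t) x).
Proof.
move=> cf; have := @is_derive_trig cos (fun y => - sin y) f x (@is_derive_cos R).
have -> : \int[leb]_(t in D) (t * f t * - sin (x * t)) = - sinT (fun t => t * f t) x.
  rewrite /sinT -[RHS]mulN1r -RintegralZl//.
    by apply: eq_Rintegral => t _; rewrite mulrN mulN1r.
  apply/integrable_segment/continuous_mul_sin => t.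
  by apply: cvgM; [exact: cvg_id|exact: cf].
apply => //; first by move=> y; rewrite normrN sin_max.
exact: continuous_cos.
Qed.

Lemma is_derive_sinT f (x : R) : continuous f ->
  is_derive x 1 (sinT f) (cosT (fun t => t * f t) x).
Proof.
move=> cf; apply: (@is_derive_trig sin cos f x (@is_derive_sin R)) => //.
  exact: cos_max.
exact: continuous_sin.
Qed.

(** No boundary terms appear when such functions are integrated by parts. *)
Definition flat d := forall k, d k A = 0 /\ d k (- A) = 0.

Let parts (d : nat -> R -> R) (G g : R -> R) : is_jet d -> flat d ->
  (forall t : R, is_derive t 1 G (g t)) -> continuous g ->
  \int[leb]_(t in D) (d 0%N t * g t) = - \int[leb]_(t in D) (d 1%N t * G t).
Proof.
move=> jd fd dG cg; have AA : - A < A by rewrite gtrN.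
have LR (F f : R -> R) : (forall t : R, is_derive t 1 F (f t)) ->
    derivable_oo_LRcontinuous F (- A) A.
  move=> dF; have cF : continuous F.
    move=> t; apply: differentiable_continuous; apply/derivable1_diffP.
    exact: is_derive_ex (dF t).
  split; first by move=> t _; exact: is_derive_ex (dF t).
    exact/cvg_at_right_filter/cF.
  exact/cvg_at_left_filter/cF.
have E (F f : R -> R) : (forall t : R, is_derive t 1 F (f t)) ->
    {in `]- A, A[, derive1 F =1 f}.
  by move=> dF t _; rewrite derive1E; exact: is_derive_val (dF t).
have := @Rintegration_by_parts R (d 0%N) G (d 1%N) g (- A) A AA.
move=> /(_ (continuous_subspaceT (jet_continuous (k := 1%N) jd)) (LR _ _ (jd 0%N)) (E _ _ (jd 0%N))
  (continuous_subspaceT cg) (LR _ _ dG) (E _ _ dG)) ->.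
by rewrite (fd 0%N).1 (fd 0%N).2 !mul0r subrr sub0r.
Qed.

Let is_derive_scaled (F F' : R -> R) (x t : R) : (forall y : R, is_derive y 1 F (F' y)) ->
  is_derive t 1 (fun s : R => F (x * s)) (x * F' (x * t)).
Proof.
move=> dF; have dlin : is_derive t 1 (fun y : R => x * y) x.
  exact: is_derive_mull.
have := is_derive1_comp (f := F) (g := fun y : R => x * y) (x := t) (dF _) dlin.
by move=> h; apply: is_derive_eq h _; rewrite mulrC.
Qed.

Lemma mulX_cosT d x : is_jet d -> flat d -> x * cosT (d 0%N) x = - sinT (d 1%N) x.
Proof.
move=> jd fd; rewrite /cosT -RintegralZl//; last first.
  exact/integrable_segment/continuous_mul_cos/jet_continuous.
have c : continuous (fun t => x * cos (x * t)).
  by apply: continuous_mul_cos => t; exact: cst_continuous.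
rewrite /sinT -(parts jd fd (fun t => is_derive_scaled x t (@is_derive_sin R)) c).
by apply: eq_Rintegral => t _; rewrite mulrCA.
Qed.

Lemma mulX_sinT d x : is_jet d -> flat d -> x * sinT (d 0%N) x = cosT (d 1%N) x.
Proof.
move=> jd fd; rewrite /sinT -RintegralZl//; last first.
  exact/integrable_segment/continuous_mul_sin/jet_continuous.
have c : continuous (fun t => x * - sin (x * t)).
  move=> t; apply: cvgM; first exact: cst_continuous.
  apply: cvgN; apply: continuous_comp; [exact: mulrl_continuous|exact: continuous_sin].
have := parts jd fd (fun t => is_derive_scaled x t (@is_derive_cos R)) c.
rewrite /cosT => /eqP; rewrite -eqr_oppLR => /eqP <-.
rewrite -[RHS]mulN1r -RintegralZl//; first by apply: eq_Rintegral => t _; ring.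
apply: integrable_segment => t; apply: cvgM; [exact: jet_continuous|exact: c].
Qed.

(** The transforms of flat jets form a class of bounded functions that is stable
    under differentiation and under multiplication by the variable. *)
Definition trig_class (f : R -> R) : Prop := exists (s : R) (d : nat -> R -> R),
  [/\ is_jet d, flat d & f = (fun x => s * cosT (d 0%N) x) \/
                         f = (fun x => s * sinT (d 0%N) x)].

Let flat_mulX d : flat d -> flat (jet_mulX d).
Proof. by move=> fd k; rewrite /jet_mulX !(fd _).1 !(fd _).2 !mulr0 addr0. Qed.

Let flat_shift d : flat d -> flat (jet_shift d).
Proof. by move=> fd k; exact: fd. Qed.

Let mulX0 d : jet_mulX d 0%N = (fun t => t * d 0%N t).
Proof. by apply/funext => t; rewrite /jet_mulX mul0r addr0. Qed.

Lemma trig_class_derive f : trig_class f -> exists2 g, trig_class g &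
  forall x : R, is_derive x 1 f (g x).
Proof.
move=> [s [d [jd fd []]]] ->.
- exists (fun x => - s * sinT (jet_mulX d 0%N) x).
    by exists (- s), (jet_mulX d); split; [exact: is_jet_mulX|exact: flat_mulX|right].
  move=> x; rewrite mulX0; have h := is_derive_cosT x (jet_continuous (k := 0%N) jd).
  by have := is_deriveZ s h; move=> h2; apply: is_derive_eq h2 _; rewrite scalerN mulNr.
- exists (fun x => s * cosT (jet_mulX d 0%N) x).
    by exists s, (jet_mulX d); split; [exact: is_jet_mulX|exact: flat_mulX|left].
  move=> x; rewrite mulX0; have h := is_derive_sinT x (jet_continuous (k := 0%N) jd).
  by have := is_deriveZ s h; move=> h2; apply: is_derive_eq h2 _.
Qed.

Lemma trig_class_mulX f : trig_class f -> trig_class (fun x => x * f x).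
Proof.
move=> [s [d [jd fd []]]] ->.
- exists (- s), (jet_shift d); split; [exact: is_jet_shift|exact: flat_shift|right].
  by apply/funext => x; rewrite mulrCA mulX_cosT// mulrN mulNr.
- exists s, (jet_shift d); split; [exact: is_jet_shift|exact: flat_shift|left].
  by apply/funext => x; rewrite mulrCA mulX_sinT.
Qed.

Lemma trig_class_bounded f : trig_class f -> exists C, forall x, `|f x| <= C.
Proof.
move=> [s [d [jd fd []]]] ->; have [C CP] := trigT_bounded (jet_continuous (k := 0%N) jd);
  by exists (`|s| * C) => x; rewrite normrM ler_wpM2l//; case: (CP x).
Qed.

(** The Schwartz class of the line, with the iterated derivatives of functions of
    one variable in place of partial derivatives. *)
Definition schwartz1 (f : R -> R) : Prop := forall n : nat,
  (forall x : R, derivable (derive1n n f) x 1) /\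
  forall a : nat, exists C, forall x, `|x| ^+ a * `|derive1n n f x| <= C.

Lemma schwartz1_trig f : trig_class f -> schwartz1 f.
Proof.
move=> Tf; have Tn n : trig_class (derive1n n f).
  elim: n => [|n IHn] //; rewrite derive1nS.
  have [g Tg dg] := trig_class_derive IHn.
  suff -> : derive1 (derive1n n f) = g by [].
  by apply/funext => x; rewrite derive1E; exact: is_derive_val (dg x).
move=> n; split.
  by move=> x; have [g _ dg] := trig_class_derive (Tn n); exact: is_derive_ex (dg x).
move=> a; have Ta : trig_class (fun x => x ^+ a * derive1n n f x).
  elim: a => [|a IHa].
    by rewrite (_ : (fun _ => _) = derive1n n f)//; apply/funext => x; rewrite expr0 mul1r.
  have := trig_class_mulX IHa; congr trig_class.
  by apply/funext => x; rewrite exprS mulrA.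
have [C CP] := trig_class_bounded Ta.
by exists C => x; rewrite -normrX -normrM.
Qed.

End trig_transform.

(** * Affine changes of variables on the line *)

Section rescaling.
Variable R : realType.
Local Notation leb := (@lebesgue_measure R).
Variables (phi : measurableTypeR R -> measurableTypeR R) (c : R).
Hypotheses (c0 : 0 < c) (mphi : measurable_fun setT phi).
Hypothesis lebE : forall A, measurable A ->
  leb A = mscale (NngNum (ltW c0)) (pushforward_measure leb mphi) A.
Local Open Scope ereal_scope.

(** The hypothesis on [phi] holds for the affine maps of positive slope and for
    the reflection at the origin. *)
Lemma ge0_integral_rescaling (f : R -> \bar R) : measurable_fun setT f ->
  (forall x, 0 <= f x) ->
  \int[leb]_x f (phi x) = (c^-1)%:E * \int[leb]_x f x.
Proof.
move=> mf f0.
rewrite [in RHS](eq_measure_integral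
  (mscale (NngNum (ltW c0)) (pushforward_measure leb mphi))); last first.
  by move=> A mA _; exact: lebE.
rewrite ge0_integral_mscale//= ge0_integral_pushforward//.
by rewrite muleA -EFinM mulVf ?gt_eqF// mul1e preimage_setT.
Qed.

Lemma integrable_rescaling (f : R -> R) : measurable_fun setT f ->
  leb.-integrable setT (EFin \o f) ->
  leb.-integrable setT (EFin \o (fun x => f (phi x))).
Proof.
move=> mf /integrableP[_ intf]; apply/integrableP; split.
  by apply/measurable_EFinP; exact: (measurableT_comp mf mphi).
rewrite (ge0_integral_rescaling (f := fun x => `|(f x)%:E|))//; last first.
  by apply/measurable_EFinP; exact: measurableT_comp.
by apply: lte_mul_pinfty; rewrite ?lee_fin ?invr_ge0// ltW.
Qed.

Lemma Rintegral_rescaling (f : R -> R) : measurable_fun setT f ->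
  leb.-integrable setT (EFin \o f) ->
  (\int[leb]_x f (phi x) = c^-1 * \int[leb]_x f x)%R.
Proof.
move=> mf intf; rewrite /Rintegral.
have intf' := integrable_rescaling mf intf.
have mp : measurable_fun setT (fun x => (f x)%:E) by exact/measurable_EFinP.
rewrite integralE [in RHS]integralE.
have E1 : \int[leb]_x (fun x => (f (phi x))%:E)^\+ x =
    (c^-1)%:E * \int[leb]_x (fun x => (f x)%:E)^\+ x.
  rewrite -(ge0_integral_rescaling (measurable_funepos mp) (fun x => funepos_ge0 _ x)).
  by apply: eq_integral => x _; rewrite -[LHS]/((((EFin \o f) \o phi)^\+) x) funepos_comp.
have E2 : \int[leb]_x (fun x => (f (phi x))%:E)^\- x =
    (c^-1)%:E * \int[leb]_x (fun x => (f x)%:E)^\- x.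
  rewrite -(ge0_integral_rescaling (measurable_funeneg mp) (fun x => funeneg_ge0 _ x)).
  by apply: eq_integral => x _; rewrite -[LHS]/((((EFin \o f) \o phi)^\-) x) funeneg_comp.
have P1 : \int[leb]_x (fun x => (f x)%:E)^\+ x \is a fin_num.
  exact: integrable_fin_num (integrable_funepos measurableT intf).
have P2 : \int[leb]_x (fun x => (f x)%:E)^\- x \is a fin_num.
  exact: integrable_fin_num (integrable_funeneg measurableT intf).
by rewrite E1 E2 -(fineK P1) -(fineK P2) -!EFinM -!EFinB /= mulrBr.
Qed.

End rescaling.

Section affine.
Variable R : realType.
Local Notation leb := (@lebesgue_measure R).

Section positive_slope.
Variables (a b : R).
Hypothesis a0 : 0 < a.

Let phi (x : measurableTypeR R) : measurableTypeR R := a * x + b.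

Let mphi : measurable_fun setT phi.
Proof. by apply: measurable_funD => //; apply: measurable_funM. Qed.

Let lebE (A : set (measurableTypeR R)) : measurable A ->
  leb A = mscale (NngNum (ltW a0)) (pushforward_measure leb mphi) A.
Proof.
apply: lebesgue_measure_unique => _ [[c d]] _ <-.
have phiE : phi @^-1` `]c, d]%classic = `]((c - b) / a), ((d - b) / a)]%classic.
  apply/seteqP; split=> x /=; rewrite !in_itv/= /phi ltr_pdivrMr// ler_pdivlMr//;
    by rewrite ltrBlDr lerBrDr mulrC.
rewrite [RHS](_ : _ = a%:E * leb (phi @^-1` `]c, d]%classic))%E//.
rewrite phiE !lebesgue_measure_itv/= !lte_fin ltr_pM2r ?invr_gt0// ltrD2r.
case: ifPn => cd; last by rewrite mule0.
by rewrite -!EFinB -EFinM; congr EFin; field; rewrite gt_eqF.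
Qed.

Lemma integrable_affine (f : R -> R) : measurable_fun setT f ->
  leb.-integrable setT (EFin \o f) ->
  leb.-integrable setT (EFin \o (fun x => f (a * x + b))).
Proof. exact: (integrable_rescaling lebE). Qed.

Lemma Rintegral_affine (f : R -> R) : measurable_fun setT f ->
  leb.-integrable setT (EFin \o f) ->
  \int[leb]_x f (a * x + b) = a^-1 * \int[leb]_x f x.
Proof. exact: (Rintegral_rescaling lebE). Qed.

End positive_slope.

Lemma Rintegral_odd (f : R -> R) : measurable_fun setT f ->
  leb.-integrable setT (EFin \o f) -> (forall x, f (- x) = - f x) ->
  \int[leb]_x f x = 0.
Proof.
move=> mf intf fN.
have mN : measurable_fun setT (-%R : measurableTypeR R -> measurableTypeR R).
  exact: oppr_measurable.
have lebE A : measurable A ->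
    leb A = mscale (NngNum (ltW (@ltr01 R))) (pushforward_measure leb mN) A.
  by move=> mA; rewrite -(lebesgue_measureN mA); rewrite /mscale/= mul1e.
have := Rintegral_rescaling lebE mf intf.
under eq_Rintegral do rewrite fN -mulN1r.
rewrite RintegralZl// invr1 mul1r mulN1r => /eqP.
by rewrite eq_sym -addr_eq0 -mulr2n mulrn_eq0/= => /eqP.
Qed.

End affine.

(** * The integral of a versine over the square *)

Section versine.
Variable R : realType.
Local Notation leb := (@lebesgue_measure R).

(** Bounded and decreasing like [x ^- 2], hence absolutely integrable; scaling
    shows that the integral is a multiple of the absolute value of [a]. *)
Definition versine (a x : R) : R := (1 - cos (a * x)) / x ^+ 2.

Lemma versine_ge0 a x : 0 <= versine a x.
Proof. by rewrite divr_ge0 ?sqr_ge0// subr_ge0 cos_le1. Qed.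

Lemma versineN a x : versine (- a) x = versine a x.
Proof. by rewrite /versine mulNr cosN. Qed.

Lemma versineNx a x : versine a (- x) = versine a x.
Proof. by rewrite /versine mulrN cosN sqrrN. Qed.

Lemma versine0 x : versine 0 x = 0.
Proof. by rewrite /versine mul0r cos0 subrr mul0r. Qed.

Lemma versine_scale a x : versine a x = a ^+ 2 * versine 1 (a * x).
Proof.
have [->|a0] := eqVneq a 0; first by rewrite versine0 expr0n mul0r.
rewrite /versine mul1r exprMn (invfM (a ^+ 2)) [RHS]mulrCA; congr (_ * _).
by rewrite mulrA mulfV ?mul1r// expf_neq0.
Qed.

Lemma one_sub_cos_le (x : R) : 1 - cos x <= x ^+ 2.
Proof.
wlog x0 : x / 0 <= x.
  move=> h; have [/h//|x0] := leP 0 x.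
  by have := h (- x); rewrite cosN sqrrN; apply; rewrite oppr_ge0 ltW.
have sin_le (y : R) : 0 <= y -> sin y <= y.
  rewrite le_eqVlt => /predU1P[<-|y0]; first by rewrite sin0.
  have [c _] := @MVT _ sin cos _ _ y0 (fun z _ => is_derive_sin z)
    (continuous_subspaceT (@continuous_sin R)).
  by rewrite sin0 !subr0 => ->; rewrite ler_piMl ?cos_le1// ltW.
move: x0; rewrite le_eqVlt => /predU1P[<-|x0]; first by rewrite cos0 subrr sqr_ge0.
have [c cx] := @MVT _ cos (fun z => - sin z) _ _ x0 (fun z _ => is_derive_cos z)
    (continuous_subspaceT (@continuous_cos R)).
move: cx; rewrite in_itv/= => /andP[c0 cx].
rewrite cos0 subr0 => /eqP; rewrite subr_eq => /eqP ->.
have := sin_le c (ltW c0); nra.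
Qed.

Lemma versine_le a x : versine a x <= (a ^+ 2 + 4) / (1 + x ^+ 2).
Proof.
have x2 : 0 < 1 + x ^+ 2 by rewrite ltr_wpDr// sqr_ge0.
have a2 := sqr_ge0 a.
rewrite ler_pdivlMr// /versine.
have [->|x0] := eqVneq x 0; first by rewrite expr0n/= invr0 mulr0 mul0r addr_ge0.
have x20 : 0 < x ^+ 2 by rewrite exprn_even_gt0.
rewrite mulrAC ler_pdivrMr//.
have := one_sub_cos_le (a * x); have := cos_geN1 (a * x).
have := cos_le1 (a * x); rewrite exprMn.
move: (cos _) (x ^+ 2) (a ^+ 2) x20 a2 => c y b; nra.
Qed.

Lemma measurable_cosM (a : R) : measurable_fun setT (fun x : R => cos (a * x)).
Proof.
apply: continuous_measurable_fun => x.
by apply: continuous_comp; [exact: mulrl_continuous|exact: continuous_cos].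
Qed.

Lemma measurable_invsqr : measurable_fun setT (fun x : R => (x ^+ 2)^-1).
Proof.
apply: (eq_measurable_fun (fun x : R => (`|x| `^ (- 2))%R)).
  move=> x _; rewrite powRN -[2]/(2%:R) powR_mulrn//.
  by rewrite -normrX ger0_norm// sqr_ge0.
apply: (measurableT_comp (measurable_powR _)); exact: normr_measurable.
Qed.

Lemma measurable_versine a : measurable_fun setT (versine a).
Proof.
apply: measurable_funM; last exact: measurable_invsqr.
by apply: measurable_funB => //; exact: measurable_cosM.
Qed.

Lemma integrable_oneDsqr : leb.-integrable setT (fun x : R => ((1 + x ^+ 2)^-1)%:E).
Proof.
have m : measurable_fun setT (fun x : R => (oneDsqr x)^-1).
  by apply: continuous_measurable_fun; exact: continuous_oneDsqrV.
have pos x : 0 <= (oneDsqr x)^-1 :> R.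
  by rewrite invr_ge0 (le_trans ler01)// oneDsqr_ge1.
apply/integrableP; split; first exact/measurable_EFinP.
rewrite (_ : (fun x => _) = (fun x : R => ((oneDsqr x)^-1)%:E)); last first.
  by apply/funext => x; rewrite gee0_abs// lee_fin pos.
rewrite (ge0_symfun_integralT (f := fun x => (oneDsqr x)^-1))//.
- rewrite -set_itvcy integral0y_oneDsqr -EFinM; exact: ltry.
- exact: continuous_oneDsqrV.
- by move=> x; rewrite /= /oneDsqr sqrrN.
Qed.

Lemma integrable_versine a : leb.-integrable setT (EFin \o versine a).
Proof.
apply: (le_integrable _ _ _ (integrableZl _ (a ^+ 2 + 4) integrable_oneDsqr)) => //.
  by apply/measurable_EFinP; exact: measurable_versine.
move=> x _; rewrite -EFinM lee_fin !ger0_norm ?versine_ge0 ?versine_le//.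
by rewrite mulr_ge0 ?invr_ge0// addr_ge0 ?sqr_ge0.
Qed.

(** Equal to [pi]; as a normalizing constant it has to be positive. *)
Definition versine_mass : R := \int[leb]_x versine 1 x.

Lemma versine_mass_gt0 : 0 < versine_mass.
Proof.
have c1 : cos 1 < 1 :> R.
  rewrite -[ltRHS]cos0 ltr_cos ?in_itv/= ?lexx ?ler01 ?pi_ge0//.
  by rewrite (le_trans _ (pi_ge2 R))// ler1n.
(* The contribution of the interval from 1 to 2. *)
have low : (1 - cos 1) / 4 <= versine_mass.
  have -> : (1 - cos 1) / 4 = \int[leb]_(x in `[1, 2]) ((1 - cos 1) / 4) :> R.
    rewrite Rintegral_cst//= lebesgue_measure_itv/= lte_fin ltr1n/=.
    by rewrite -[2]natr1 addrK mulr1.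
  rewrite /versine_mass -(setUv `[(1:R), 2]%classic) Rintegral_setU//; last 3 first.
  - exact: measurableC.
  - by rewrite setUv; exact: integrable_versine.
  - by apply/disj_setPS; rewrite setICr.
  rewrite -[leLHS]addr0; apply: lerD; last first.
    by apply: Rintegral_ge0 => x _; exact: versine_ge0.
  apply: le_Rintegral => //.
  - apply: continuous_compact_integrable; first exact: segment_compact.
    by apply: continuous_subspaceT => x; exact: cst_continuous.
  - exact: integrableS (integrable_versine 1).
  move=> x /=; rewrite in_itv/= => /andP[x1 x2].
  have x0 : 0 < x by exact: lt_le_trans x1.
  rewrite /versine mul1r; apply: ler_pM; rewrite ?subr_ge0 ?cos_le1 ?invr_ge0//.
    rewrite lerD2l lerN2 leNgt; apply/negP; rewrite ltr_cos; first by rewrite ltNge x1.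
      by rewrite in_itv/= (ltW x0) (le_trans x2) ?pi_ge2.
    by rewrite in_itv/= ler01 (le_trans _ (pi_ge2 R))// ler1n.
  rewrite lef_pV2 ?posrE ?exprn_gt0//; nra.
by apply: lt_le_trans low; rewrite divr_gt0// subr_gt0.
Qed.

Lemma integral_versine a : \int[leb]_x versine a x = `|a| * versine_mass.
Proof.
wlog a0 : a / 0 <= a.
  move=> h; have [/h//|a0] := leP 0 a.
  have := h (- a); rewrite normrN => <-; last by rewrite oppr_ge0 ltW.
  by apply: eq_Rintegral => x _; rewrite versineN.
rewrite ger0_norm//; move: a0; rewrite le_eqVlt => /predU1P[<-|a0].
  rewrite mul0r; under eq_Rintegral do rewrite versine0.
  by rewrite Rintegral_cst// mul0r.
under eq_Rintegral do rewrite versine_scale -[a * _]addr0.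
rewrite RintegralZl//; last first.
  exact: (integrable_affine 0 a0 (measurable_versine 1) (integrable_versine 1)).
rewrite (Rintegral_affine 0 a0 (measurable_versine 1) (integrable_versine 1)).
by rewrite mulrA expr2 mulfK ?gt_eqF.
Qed.

End versine.

(** * A kernel whose Fourier transform has a plateau *)

Section integrable_prod.
Context d1 d2 (T1 : measurableType d1) (T2 : measurableType d2) (R : realType).
Variables (m1 : {sigma_finite_measure set T1 -> \bar R})
  (m2 : {sigma_finite_measure set T2 -> \bar R}).

Lemma integrable_prodM (f : T1 -> R) (g : T2 -> R) :
  m1.-integrable setT (EFin \o f) -> m2.-integrable setT (EFin \o g) ->
  (m1 \x m2)%E.-integrable setT (EFin \o (fun z => f z.1 * g z.2)).
Proof.
move=> /integrableP[mf intf] /integrableP[mg intg].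
have mf' : measurable_fun setT f by apply/measurable_EFinP.
have mg' : measurable_fun setT g by apply/measurable_EFinP.
have mfg : measurable_fun setT (EFin \o (fun z : T1 * T2 => f z.1 * g z.2)).
  apply/measurable_EFinP; apply: measurable_funM.
    exact: (measurableT_comp mf' measurable_fst).
  exact: (measurableT_comp mg' measurable_snd).
apply: (proj2 (@integrable12ltyP _ _ _ _ _ m1 m2 _ mfg)).
under eq_integral => x _.
  under eq_integral => y _ do rewrite /= normrM EFinM.
  rewrite ge0_integralZl//; last by apply/measurable_EFinP; exact: measurableT_comp.
  over.
rewrite ge0_integralZr//; last 2 first.
- by apply/measurable_EFinP; exact: measurableT_comp.
- by apply: integral_ge0 => y _; rewrite lee_fin.
have If : (\int[m1]_x `|f x|%:E \is a fin_num)%E by rewrite ge0_fin_numE ?integral_ge0.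
have Ig : (\int[m2]_x `|g x|%:E \is a fin_num)%E by rewrite ge0_fin_numE ?integral_ge0.
by rewrite -(fineK If) -(fineK Ig) -EFinM ltry.
Qed.

Lemma Rintegral_Fubini (F : T1 * T2 -> R) :
  (m1 \x m2)%E.-integrable setT (EFin \o F) ->
  (forall x, m2.-integrable setT (fun y => (F (x, y))%:E)) ->
  (forall y, m1.-integrable setT (fun x => (F (x, y))%:E)) ->
  \int[m1]_x (\int[m2]_y F (x, y)) = \int[m2]_y (\int[m1]_x F (x, y)).
Proof.
move=> intF i2 i1; have := Fubini intF.
have E1 x : (\int[m2]_y (EFin \o F) (x, y) = (\int[m2]_y F (x, y))%:E)%E.
  by rewrite fineK// ; exact: integrable_fin_num (i2 x).
have E2 y : (\int[m1]_x (EFin \o F) (x, y) = (\int[m1]_x F (x, y))%:E)%E.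
  by rewrite fineK// ; exact: integrable_fin_num (i1 y).
under eq_integral do rewrite E1.
under [in RHS]eq_integral do rewrite E2.
by rewrite /Rintegral => ->.
Qed.

End integrable_prod.

Section schwartz1_integrable.
Variable R : realType.
Local Notation leb := (@lebesgue_measure R).

Lemma schwartz1_continuous (f : R -> R) : schwartz1 f -> continuous f.
Proof.
move=> Sf x; apply: differentiable_continuous; apply/derivable1_diffP.
exact: (Sf 0%N).1.
Qed.

Lemma schwartz1_integrable (f : R -> R) : schwartz1 f ->
  leb.-integrable setT (EFin \o f).
Proof.
move=> Sf; have [C0 CP0] := (Sf 0%N).2 0%N; have [C2 CP2] := (Sf 0%N).2 2%N.
apply: (le_integrable _ _ _ (integrableZl _ (C0 + C2) (integrable_oneDsqr R))) => //.
  apply/measurable_EFinP; apply: continuous_measurable_fun.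
  exact: schwartz1_continuous.
move=> x _; rewrite -EFinM !abse_EFin lee_fin.
have x2 : 0 < 1 + x ^+ 2 by rewrite ltr_wpDr// sqr_ge0.
have := CP0 x; have := CP2 x; rewrite expr0 mul1r real_normK ?num_real// => h2 h0.
apply: le_trans (ler_norm _); rewrite ler_pdivlMr//.
by rewrite mulrDr mulr1 mulrC; apply: lerD.
Qed.

Lemma integrable_mul_cos (f : R -> R) (xi al : R) : measurable_fun setT f ->
  leb.-integrable setT (EFin \o f) ->
  leb.-integrable setT (EFin \o (fun x => f x * cos (x * xi + al))).
Proof.
move=> mf intf; apply: (le_integrable _ _ _ intf) => //.
  apply/measurable_EFinP; apply: measurable_funM => //.
  apply: continuous_measurable_fun => x; apply: continuous_comp; last exact: continuous_cos.
  by apply: cvgD; [exact: mulrr_continuous|exact: cst_continuous].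
by move=> x _; rewrite !abse_EFin lee_fin normrM ler_piMr// cos_max.
Qed.

End schwartz1_integrable.

Section plateau.
Variables (R : realType) (A a0 : R) (d : nat -> R -> R).
Hypotheses (A0 : 0 < A) (jd : is_jet d) (fd : flat A d).
Hypotheses (d00 : d 0%N 0 = 1) (d10 : d 1%N 0 = 0).
Hypothesis d2 : forall t, `|t| < a0 -> d 2%N t = 0.
Local Notation leb := (@lebesgue_measure R).
Local Notation D := (`[- A, A]%classic : set R).

(** The function [d 0] should be thought of as a bump, constant equal to one near
    the origin. *)
Definition kernel1 : R -> R := cosT A (d 0%N).

Lemma kernel1_trig : trig_class A kernel1.
Proof.
by exists 1, d; split => //; left; apply/funext => x; rewrite mul1r.
Qed.

Let kernel_sqr x : x ^+ 2 * kernel1 x = - cosT A (d 2%N) x.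
Proof.
rewrite expr2 -mulrA (mulX_cosT A0 x jd fd) mulrN.
by have -> := mulX_sinT A0 x (is_jet_shift jd) (fun k => fd k.+1).
Qed.

Let c2 : continuous (d 2%N). Proof. exact: jet_continuous jd. Qed.

Let int_d2 : \int[leb]_(t in D) d 2%N t = 0.
Proof.
have := kernel_sqr 0; rewrite expr0n mul0r => /eqP.
rewrite eq_sym oppr_eq0 => /eqP <-; apply: eq_Rintegral => t _.
by rewrite mul0r cos0 mulr1.
Qed.

(** Two integrations by parts turn the kernel into an average of versines,
    which are absolutely integrable. *)
Let kernel_versine x : x != 0 -> kernel1 x = \int[leb]_(t in D) (d 2%N t * versine t x).
Proof.
move=> x0; have x2 : x ^+ 2 != 0 by rewrite expf_neq0.
apply: (mulfI x2); rewrite kernel_sqr -RintegralZl//; last first.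
  apply: integrable_segment => t; apply: cvgM; first exact: c2.
  apply: cvgM; last exact: cst_continuous.
  apply: cvgB; first exact: cst_continuous.
  by apply: continuous_comp; [exact: mulrr_continuous|exact: continuous_cos].
rewrite -[LHS]add0r -int_d2 /cosT -RintegralB//.
- by apply: eq_Rintegral => t _; rewrite /versine [t * x]mulrC; field.
- exact: integrable_segment.
- exact/integrable_segment/continuous_mul_cos.
Qed.

Let w t := d 2%N t * \1_D t.

Let mw : measurable_fun setT w.
Proof.
apply: measurable_funM; first exact: continuous_measurable_fun.
by apply: measurable_indic; exact: measurable_itv.
Qed.

Let int_w (g : R -> R) : \int[leb]_(t in D) (d 2%N t * g t) = \int[leb]_t (w t * g t).
Proof.
rewrite Rintegral_mkcond; apply: eq_Rintegral => t _.
by rewrite patchE /w indicE; case: ifPn => _; rewrite ?mulr1// mulr0 mul0r.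
Qed.

Let integrable_w : leb.-integrable setT (EFin \o w).
Proof.
have mD : measurable (D : set (measurableTypeR R)) by exact: measurable_itv.
have := (@integrable_mkcond _ _ _ leb D (EFin \o d 2%N) mD).1 (integrable_segment A c2).
congr (integrable _ _ _); apply/funext => t; rewrite /= patchE /w indicE.
by case: ifPn => _; rewrite ?mulr1// mulr0.
Qed.

Let bounded_w : exists2 B, 0 <= B & forall t, `|w t| <= B * \1_D t.
Proof.
have [B [Br BP]] : bounded_set (d 2%N @` D).
  apply: compact_bounded; apply: continuous_compact; last exact: segment_compact.
  exact: continuous_subspaceT.
exists (`|B| + 1); first by rewrite addr_ge0.
move=> t; rewrite /w indicE; case: (boolP (t \in D)) => tD; last by rewrite !mulr0 normr0.
rewrite !mulr1; apply: BP; first by rewrite (le_lt_trans (ler_norm B))// ltrDl.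
by exists t => //; exact/set_mem.
Qed.

(** By the product formulas for cosines, the part of the integrand that is even in
    [x] is a combination of versines; the odd part integrates to zero. *)
Lemma integral_versine_cos (t xi al : R) :
  \int[leb]_x (versine t x * cos (x * xi + al)) =
  versine_mass R * (`|t + xi| / 2 + `|t - xi| / 2 - `|xi|) * cos al.
Proof.
have iv := integrable_versine (R := R); have mv := measurable_versine (R := R).
have iZ c (f : R -> R) : leb.-integrable setT (EFin \o f) ->
    leb.-integrable setT (EFin \o (fun x => c * f x)).
  by move=> h; exact: (integrableZl measurableT c h).
have iD (f g : R -> R) : leb.-integrable setT (EFin \o f) ->
    leb.-integrable setT (EFin \o g) -> leb.-integrable setT (EFin \o (fun x => f x + g x)).
  by move=> h1 h2; exact: (integrableD measurableT h1 h2).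
have iB (f g : R -> R) : leb.-integrable setT (EFin \o f) ->
    leb.-integrable setT (EFin \o g) -> leb.-integrable setT (EFin \o (fun x => f x - g x)).
  by move=> h1 h2; exact: (integrableB measurableT h1 h2).
pose o x := versine t x * cos (x * xi - pi / 2).
have io : leb.-integrable setT (EFin \o o) by exact: integrable_mul_cos.
have mo : measurable_fun setT o by apply/measurable_EFinP; exact: measurable_int io.
have o0 : \int[leb]_x o x = 0.
  apply: Rintegral_odd => // x.
  by rewrite /o versineNx mulNr !cosBpihalf sinN mulrN.
pose e x := 2^-1 * versine (t + xi) x + 2^-1 * versine (t - xi) x - versine xi x.
have ie : leb.-integrable setT (EFin \o e).
  by apply: iB => //; apply: iD; exact: iZ.
have -> : \int[leb]_x (versine t x * cos (x * xi + al)) =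
    \int[leb]_x (cos al * e x - sin al * o x).
  apply: eq_Rintegral => x _; rewrite /e /o cosBpihalf /versine !cosD.
  rewrite [(t + xi) * x]mulrDl [(t - xi) * x]mulrBl cosD cosB [xi * x]mulrC.
  by move: (x ^+ 2)^-1 => v; field.
rewrite RintegralB//; [|exact: iZ..].
rewrite !RintegralZl// o0 mulr0 subr0 /e RintegralB//; last by apply: iD; exact: iZ.
rewrite RintegralD//; [|exact: iZ..].
rewrite !RintegralZl// !integral_versine; ring.
Qed.

(** [t * d 1 t - d 0 t] is a primitive of [t * d 2 t] on each half of the
    segment. *)
Let integral_abs_d2 : \int[leb]_(t in D) (d 2%N t * `|t|) = 2.
Proof.
have cont (g : R -> R) (X : set R) : continuous g -> {within X, continuous g}.
  exact: continuous_subspaceT.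
pose P t := t * d 1%N t - d 0%N t.
have dP (t : R) : is_derive t 1 P (t * d 2%N t).
  have h1 := is_deriveM (is_derive_id t (1 : R)) (jd 1%N t).
  have h := is_deriveB h1 (jd 0%N t).
  by apply: is_derive_eq h _; rewrite /GRing.scale/=; ring.
have cP : continuous P.
  move=> t; apply: differentiable_continuous; apply/derivable1_diffP.
  exact: is_derive_ex (dP t).
have cg : continuous (fun t : R => t * d 2%N t).
  by move=> t; apply: cvgM; [exact: cvg_id|exact: c2].
have LR a b : derivable_oo_LRcontinuous P a b.
  split; first by move=> t _; exact: is_derive_ex (dP t).
    exact/cvg_at_right_filter/cP.
  exact/cvg_at_left_filter/cP.
have F a b : a < b -> \int[leb]_(t in `[a, b]) (t * d 2%N t) = P b - P a.
  move=> ab; rewrite /Rintegral (continuous_FTC2 ab (cont _ _ cg) (LR a b))//.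
  by move=> t _; rewrite derive1E; exact: is_derive_val (dP t).
have ci : continuous (fun t : R => d 2%N t * `|t|).
  by move=> t; apply: cvgM; [exact: c2|exact: norm_continuous].
have Dsplit : D = `[- A, 0]%classic `|` `]0, A]%classic.
  by rewrite (@itv_bndbnd_setU _ _ (BLeft (- A)) (BRight (0 : R)) (BRight A)) ?bnd_simp ?oppr_le0 ?ltW.
rewrite Dsplit Rintegral_setU//; last 2 first.
- by rewrite -Dsplit; exact: integrable_segment.
- by apply/disj_setPS => t [] /=; rewrite !in_itv/= => /andP[_ t0] /andP[]; rewrite ltNge t0.
have -> : \int[leb]_(t in `]0, A]) (d 2%N t * `|t|) = \int[leb]_(t in `[0, A]) (t * d 2%N t).
  rewrite Rintegral_itv_obnd_cbnd//; last first.
    apply: (@integrableS _ _ _ leb D) => //; last exact: integrable_segment.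
    by move=> t /=; rewrite !in_itv/= => /andP[t0 ->]; rewrite andbT (le_trans _ (ltW t0))// oppr_le0 ltW.
  by apply: eq_Rintegral => t; rewrite inE/= in_itv/= => /andP[t0 _]; rewrite ger0_norm// mulrC.
have -> : \int[leb]_(t in `[- A, 0]) (d 2%N t * `|t|) = - \int[leb]_(t in `[- A, 0]) (t * d 2%N t).
  rewrite -[RHS]mulN1r -RintegralZl//; last first.
    apply: (@integrableS _ _ _ leb D) => //; last exact: (integrable_segment A cg).
    by move=> t /=; rewrite !in_itv/= => /andP[-> t0]; rewrite (le_trans t0)// ltW.
  apply: eq_Rintegral => t; rewrite inE/= in_itv/= => /andP[_ t0]; rewrite ler0_norm//; ring.
rewrite !F ?oppr_lt0// /P d00 d10 (fd 0%N).1 (fd 0%N).2 (fd 1%N).1 (fd 1%N).2.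
by ring.
Qed.

Lemma kernel1_schwartz : schwartz1 kernel1.
Proof. exact: schwartz1_trig kernel1_trig. Qed.

(** The kernel is an average of the versines of parameter [t] with density
    [d 2 t].  By Fubini's theorem the integral becomes that of [d 2 t] against
    the value given by [integral_versine_cos], which is proportional to
    [`|t| - `|xi|] where [`|xi| <= `|t|], that is wherever [d 2 t] may be
    nonzero.  The integral of [d 2 t] vanishes, so that the term in [xi]
    disappears, and that of [d 2 t * `|t|] is twice the value of the bump at
    the origin. *)
Lemma kernel1_integral (xi al : R) : `|xi| <= a0 ->
  \int[leb]_x (kernel1 x * cos (x * xi + al)) = 2 * versine_mass R * cos al.
Proof.
move=> xia.
have mC : measurable_fun setT (fun x : R => cos (x * xi + al)).
  apply: continuous_measurable_fun => x; apply: continuous_comp; last exact: continuous_cos.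
  by apply: cvgD; [exact: mulrr_continuous|exact: cst_continuous].
pose F (z : R * R) := w z.2 * (versine z.2 z.1 * cos (z.1 * xi + al)).
have mF : measurable_fun setT F.
  apply: measurable_funM; first exact: (measurableT_comp mw measurable_snd).
  apply: measurable_funM; last exact: (measurableT_comp mC measurable_fst).
  apply: (@measurable_funM _ _ _ _ (fun z : R * R => 1 - cos (z.2 * z.1)) (fun z => (z.1 ^+ 2)^-1)); last first.
    exact: (measurableT_comp (@measurable_invsqr R) measurable_fst).
  apply: measurable_funB => //; apply: measurableT_comp.
    by apply: continuous_measurable_fun; exact: continuous_cos.
  exact: measurable_funM.
have [B B0 wB] := bounded_w.
have mD : measurable (D : set (measurableTypeR R)) by exact: measurable_itv.
have x2 (x : R) : 0 < 1 + x ^+ 2 by rewrite ltr_wpDr// sqr_ge0.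
(* The integrand has an integrable majorant of product form. *)
have hF z : `|F z| <= (1 + z.1 ^+ 2)^-1 * (B * (A ^+ 2 + 4) * \1_D z.2).
  rewrite /F normrM (le_trans (ler_wpM2r _ (wB _)))// !indicE.
  case: (boolP (z.2 \in D)) => [/set_mem zD|_]; last by rewrite !mulr0 mul0r.
  rewrite !mulr1 mulrCA ler_wpM2l// normrM.
  rewrite (@le_trans _ _ `|versine z.2 z.1|)// ?ler_piMr ?cos_max//.
  rewrite ger0_norm ?versine_ge0// (le_trans (versine_le _ _))// mulrC ler_wpM2l//.
    by rewrite invr_ge0 ltW.
  rewrite lerD2r -[leLHS]real_normK ?num_real// lerXn2r ?nnegrE ?(ltW A0)//.
  by move: zD; rewrite /= in_itv/= ler_norml.
have intF : (leb \x leb)%E.-integrable setT (EFin \o F).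
  have iD : leb.-integrable setT (EFin \o (fun t => B * (A ^+ 2 + 4) * \1_D t)).
    have i1 : leb.-integrable setT (EFin \o (\1_D : R -> R)).
      exact: integrable_indic_itv.
    exact: (integrableZl measurableT _ i1).
  apply: (le_integrable _ _ _ (integrable_prodM (integrable_oneDsqr R) iD)) => //.
    exact/measurable_EFinP.
  by move=> z _; rewrite !abse_EFin lee_fin (le_trans (hF z))// ler_norm.
have Fw x : leb.-integrable setT (EFin \o (fun t => w t * versine t x)).
  have mV : measurable_fun setT (fun t : R => versine t x).
    apply: measurable_funM => //; apply: measurable_funB => //.
    apply: measurableT_comp; last exact: measurable_funM.
    by apply: continuous_measurable_fun; exact: continuous_cos.
  apply: (le_integrable _ _ _ (integrableZl measurableT ((x ^+ 2)^-1 * 2) integrable_w)) => //.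
    by apply/measurable_EFinP; exact: measurable_funM.
  move=> t _; rewrite -EFinM !abse_EFin lee_fin [leLHS]normrM [leRHS]normrM mulrC ler_wpM2r//.
  rewrite /versine [leLHS]normrM mulrC [leRHS]normrM ler_wpM2l// ger0_norm ?subr_ge0 ?cos_le1//.
  by rewrite ger0_norm// lerBlDr -lerBlDl; have := cos_geN1 (t * x); lra.
have Fx x : leb.-integrable setT (fun t => (F (x, t))%:E).
  have := integrableZl measurableT (cos (x * xi + al)) (Fw x).
  by congr (integrable _ _ _); apply/funext => t; rewrite /F/= -EFinM mulrC mulrA.
have Ft t : leb.-integrable setT (fun x => (F (x, t))%:E).
  have iv : leb.-integrable setT (EFin \o (fun x => versine t x * cos (x * xi + al))).
    by apply: integrable_mul_cos; [exact: measurable_versine|exact: integrable_versine].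
  exact: (integrableZl measurableT (w t) iv).
(* The versines take the value 0 at the origin, where the kernel need not; this
   is a null set. *)
have step1 : \int[leb]_x (kernel1 x * cos (x * xi + al)) = \int[leb]_x (\int[leb]_t F (x, t)).
  have E x : \int[leb]_t F (x, t) = kernel1 x * cos (x * xi + al) * \1_(~` [set 0]) x.
    rewrite indicE; case: (eqVneq x 0) => [->|x0].
      rewrite memNset ?mulr0; last by move=> /(_ erefl).
      rewrite /Rintegral integral0_eq// => t _.
      by rewrite /F /versine/= expr0n/= invr0 mulr0 mul0r mulr0.
    rewrite mem_set ?mulr1; last by move=> /= xx; rewrite xx eqxx in x0.
    rewrite kernel_versine// int_w mulrC -RintegralZl//.
    by apply: eq_Rintegral => t _; rewrite /F/= mulrA mulrC.
  under [RHS]eq_Rintegral do rewrite E.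
  rewrite /Rintegral; congr fine.
  have mk : measurable_fun setT kernel1.
    apply: continuous_measurable_fun; apply: schwartz1_continuous; exact: kernel1_schwartz.
  apply: ae_eq_integral => //.
  - by apply/measurable_EFinP; exact: measurable_funM.
  - apply/measurable_EFinP; apply: measurable_funM; first exact: measurable_funM.
    by apply: measurable_indic; exact: measurableC.
  - exists [set 0]; split; [by []|exact: lebesgue_measure_set1|].
    move=> x /= /not_implyP[_]; apply: contra_notP => x0.
    by rewrite indicE mem_set// mulr1.
have Finner t : \int[leb]_x F (x, t) = w t * (versine_mass R * (`|t| - `|xi|) * cos al).
  transitivity (w t * \int[leb]_x (versine t x * cos (x * xi + al))).
    rewrite -RintegralZl//.
    by apply: integrable_mul_cos; [exact: measurable_versine|exact: integrable_versine].
  rewrite integral_versine_cos; have [ta|ta] := ltP `|t| a0.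
    by rewrite /w d2// !mul0r.
  congr (_ * (_ * _ * _)).
  have : `|xi| <= `|t| by exact: le_trans ta.
  have [t0|t0] := leP 0 t.
    rewrite (ger0_norm t0) ler_norml => /andP[? ?].
    by rewrite (@ger0_norm _ (t + xi)) ?(@ger0_norm _ (t - xi)); lra.
  rewrite (ltr0_norm t0) ler_norml => /andP[? ?].
  by rewrite (@ler0_norm _ (t + xi)) ?(@ler0_norm _ (t - xi)); lra.
rewrite step1 Rintegral_Fubini//.
under eq_Rintegral do rewrite Finner.
rewrite -int_w.
have ci : continuous (fun t : R => d 2%N t * `|t|).
  by move=> t; apply: cvgM; [exact: c2|exact: norm_continuous].
transitivity (\int[leb]_(t in D) (versine_mass R * cos al * (d 2%N t * `|t|) -
    versine_mass R * cos al * `|xi| * d 2%N t)).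
  by apply: eq_Rintegral => t _; ring.
have iZ c (f : R -> R) : continuous f -> leb.-integrable D (EFin \o (fun t => c * f t)).
  by move=> cf; apply: (integrableZl mD c (f := EFin \o f)); exact: integrable_segment.
rewrite RintegralB//; [|exact: iZ..].
rewrite !RintegralZl//; [|exact: integrable_segment..].
rewrite int_d2 integral_abs_d2; ring.
Qed.

End plateau.

(** * A bump built from the dyadic partition of unity *)

Section line_restriction.
Variables (R : realType) (n : nat).

(** Directional derivatives are derivatives of the restrictions to lines; the
    difference quotients are literally the same. *)
Lemma is_derive_line (f : 'rV[R]_n -> R) (x v : 'rV[R]_n) (t : R) :
  derivable f (t *: v + x) v ->
  is_derive t 1 (fun s : R => f (s *: v + x)) ('D_v f (t *: v + x)).
Proof.
have E : (fun h : R => h^-1 *: (f ((h *: 1 + t) *: v + x) - f (t *: v + x))) =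
         (fun h : R => h^-1 *: (f (h *: v + (t *: v + x)) - f (t *: v + x))).
  by apply/funext => h; rewrite [h%:A]mulr1 scalerDl addrA.
by move=> df; split; rewrite /derivable /derive E.
Qed.

End line_restriction.

Section bump.
Variables (R : realType).

Lemma jet_locally_cst (d : nat -> R -> R) (a b c : R) : is_jet d ->
  (forall t, a < t < b -> d 0%N t = c) -> forall k t, a < t < b -> d k.+1 t = 0.
Proof.
move=> jd d0; have step k e : (forall t, a < t < b -> d k t = e) ->
    forall t, a < t < b -> d k.+1 t = 0.
  move=> dk t tab; have := is_derive_val (jd k t); have := is_derive_val (is_derive_cst e t (1 : R)).
  move=> <- <-; apply: near_eq_derive => //.
  near=> s; rewrite dk//=; near: s.
  have tI : t \in `]a, b[ by rewrite in_itv.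
  by apply: filterS (near_in_itvoo tI) => s; rewrite in_itv.
elim=> [|k IH]; first exact: (step 0%N c).
exact: (step k.+1 0).
Unshelve. all: by end_near. Qed.

Variables (n : nat) (n_gt0 : (0 < n)%N) (phi : int -> 'rV[R]_n -> R[i]).
Hypothesis hphi : dyadic_partition phi.

Lemma dyadic_support (j : int) (xi : 'rV[R]_n) :
  ~~ (2 ^ (j - 1) <= enorm xi <= 2 ^ (j + 1)) -> phi j xi = 0.
Proof.
case: hphi => _ supp _ _; apply: contraNeq => pj.
by apply: supp; apply: subset_closure.
Qed.

Let i0 : 'I_n := Ordinal n_gt0.
Let e0 : 'rV[R]_n := delta_mx ord0 i0.

Let enorm_line (t : R) : enorm (t *: e0) = `|t|.
Proof.
rewrite /enorm /dot (bigD1 i0)//= big1 ?addr0; last first.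
  by move=> i ii0; rewrite !mxE eqxx/= (negPf ii0) !mulr0.
by rewrite !mxE !eqxx mulr1 -expr2 sqrtr_sqr.
Qed.

Let line_derivs j (k : nat) (t : R) := partials (nseq k i0) (cRe (phi j)) (t *: e0).

Let line_jet j : is_jet (line_derivs j).
Proof.
move=> k t; case: hphi => /(_ j)[[sm _] _] _ _ _.
have := (sm (nseq k i0)).2 (t *: e0) i0.
rewrite -[X in derivable _ X _]addr0 => /is_derive_line.
by rewrite addr0; under [X in is_derive _ _ X _]eq_fun do rewrite addr0.
Qed.

Let bump_derivs k t := (k == 0%N)%:R - (line_derivs 5 k t + line_derivs 6 k t + line_derivs 7 k t).

(** One minus the terms of index 5, 6 and 7 of the partition of unity, on a
    coordinate axis.  These terms vanish inside the radius 16 and add up to one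
    between the radii 64 and 128, so that the bump can be cut at 96, where it
    vanishes together with its derivatives. *)
Lemma exists_bump : exists d : nat -> R -> R,
  [/\ is_jet d, flat 96 d, d 0%N 0 = 1, d 1%N 0 = 0 &
      forall t, `|t| < 16 -> d 2%N t = 0].
Proof.
have jd : is_jet bump_derivs.
  move=> k t; have h := is_deriveD (is_deriveD (line_jet 5 k t) (line_jet 6 k t)) (line_jet 7 k t).
  have h' := is_deriveB (is_derive_cst ((k == 0%N)%:R : R) t (1 : R)) h.
  exact: h'.
have near0 t : - 16 < t < 16 -> bump_derivs 0 t = 1.
  rewrite -ltr_norml => t16.
  have z (j : int) : (5 <= j)%R -> line_derivs j 0 t = 0.
    move=> j5; rewrite /line_derivs/= /cRe dyadic_support// enorm_line negb_and -ltNge.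
    apply/orP; left; apply: (lt_le_trans t16).
    rewrite (_ : 16 = 2 ^ (4 : int)); last by rewrite -exprnP -natrX.
    by rewrite ler_weXz2l ?ler1n//; lia.
  by rewrite /bump_derivs !z// !addr0 subr0.
(* Between the radii 64 and 128 these three terms are the whole partition of unity. *)
have far t : 64 < `|t| < 128 -> bump_derivs 0 t = 0.
  move=> /andP[t64 t128]; have te0 : t *: e0 != 0.
    apply: contraTneq t64 => /(congr1 (@enorm R n)); rewrite enorm_line => ->.
    by rewrite -[0 : 'rV_n](scale0r e0) enorm_line normr0; lra.
  case: hphi => _ _ _ /(_ _ te0).
  rewrite (fsbigE [:: 5; 6; 7])//; last first.
    move=> j _ j567; rewrite dyadic_support// enorm_line negb_and -!ltNge.
    have [j4|j5] := leP j 4; apply/orP; [right|left].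
      apply: le_lt_trans t64; rewrite (_ : 64 = 2 ^ (6 : int)); last by rewrite -exprnP -natrX.
      by rewrite ler_weXz2l ?ler1n//; lia.
    apply: (lt_le_trans t128); rewrite (_ : 128 = 2 ^ (7 : int)); last by rewrite -exprnP -natrX.
    by rewrite ler_weXz2l ?ler1n//; move: j567 j5; rewrite !inE; lia.
  rewrite big_mkcond/= !big_cons big_nil !in_setT addr0 => /(congr1 (@complex.Re R)).
  rewrite !raddfD/= /bump_derivs /line_derivs/= /cRe => <-.
  by rewrite addrA subrr.
have far' (b : bool) k : bump_derivs k ((-1) ^+ b * 96) = 0.
  case: k => [|k]; first by rewrite far// normrM normrX normrN1 expr1n mul1r normr_nat !ltr_nat.
  case: b; rewrite ?expr0 ?expr1 ?mul1r ?mulN1r.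
    apply: (@jet_locally_cst _ (- 128) (- 64) 0 jd); last by lra.
    by move=> t ?; rewrite far// ltr0_norm; lra.
  apply: (@jet_locally_cst _ 64 128 0 jd); last by lra.
  by move=> t ?; rewrite far// gtr0_norm; lra.
exists bump_derivs; split => //.
- by move=> k; rewrite -[X in bump_derivs _ X = _ /\ _]mul1r (far' false) -[in X in _ /\ X]mulN1r (far' true).
- by rewrite near0//; lra.
- by apply: (jet_locally_cst jd near0); lra.
- by move=> t; rewrite ltr_norml; exact: (jet_locally_cst jd near0).
Qed.

End bump.

(** * Lebesgue measure on R^n *)

Section lebesgue_Rn.
Variable R : realType.
Local Notation leb := (@lebesgue_measure R).
Local Notation lebn n := (lebesgue_rV R n).

Definition cube n (y : 'rV[R]_n) (rho : R) : set 'rV[R]_n :=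
  [set x | forall i, `|x ord0 i - y ord0 i| <= rho].

Lemma measurable_cube n (y : 'rV[R]_n) rho : measurable (cube y rho).
Proof.
rewrite (_ : cube y rho = \bigcap_(i in [set: 'I_n])
    ((fun x : 'rV[R]_n => x ord0 i) @^-1` `[y ord0 i - rho, y ord0 i + rho])).
  apply: fin_bigcap_measurable; first exact: finite_finset.
  move=> i _; rewrite -[X in measurable X]setTI.
  by apply: measurable_coord => //; exact: measurable_itv.
apply/seteqP; split => x /=.
  by move=> xy i _; rewrite /= in_itv/= -ler_distl.
by move=> xy i; move: (xy i I); rewrite /= in_itv/= -ler_distl.
Qed.

Lemma unlift_ord_max_cases n (P : 'I_n.+1 -> Prop) :
  P ord_max -> (forall j, P (lift ord_max j)) -> forall i, P i.
Proof. by move=> Pm Pl i; case: (unliftP ord_max i) => [j ->|->]. Qed.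

Lemma rV_snocL n (z : 'rV[R]_n * measurableTypeR R) j :
  rV_snoc z ord0 (lift ord_max j) = z.1 ord0 j.
Proof. by rewrite mxE liftK. Qed.

Lemma rV_snocR n (z : 'rV[R]_n * measurableTypeR R) :
  rV_snoc z ord0 ord_max = z.2.
Proof. by rewrite mxE unlift_none. Qed.

Lemma lebesgue_interval (a rho : R) : 0 <= rho ->
  leb `[a - rho, a + rho]%classic = (rho *+ 2)%:E.
Proof.
rewrite lebesgue_measure_itv/= lte_fin le_eqVlt => /predU1P[<-|rho0].
  by rewrite subr0 addr0 ltxx mul0rn.
by rewrite ltrBlDr ifT ?ltr_pwDr ?ltr_wpDr// -?EFinD; [congr _%:E; ring|lra].
Qed.

Lemma lebesgue_cube n (y : 'rV[R]_n) rho : 0 <= rho ->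
  lebn n (cube y rho) = ((rho *+ 2) ^+ n)%:E.
Proof.
move=> rho0; elim: n y => [|n IH] y.
  by rewrite /= diracE mem_set ?expr0// => -[].
rewrite /= /pushforward.
have -> : @rV_snoc R n @^-1` cube y rho =
    cube (\row_j y ord0 (lift ord_max j)) rho `*`
    `[y ord0 ord_max - rho, y ord0 ord_max + rho]%classic.
  apply/seteqP; split => -[x t]/=.
    move=> h; split => [j|]; last by have := h ord_max; rewrite rV_snocR/= in_itv/= -ler_distl.
    by have := h (lift ord_max j); rewrite rV_snocL mxE.
  move=> [h]; rewrite /= in_itv/= -ler_distl => ht.
  apply: unlift_ord_max_cases; first by rewrite rV_snocR.
  by move=> j; have := h j; rewrite rV_snocL mxE.
rewrite product_measure1E//; last exact: measurable_cube.
rewrite [X in (X * _)%E]IH [X in (_ * X)%E](_ : _ = (rho *+ 2)%:E) -?EFinM ?exprSr//.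
exact: lebesgue_interval.
Qed.

Lemma lebesgue_rV_sigma_finite n : sigma_finite setT (lebn n).
Proof.
exists (fun k => cube 0 k%:R).
  apply/seteqP; split => // x _; exists (Num.trunc (\sum_i `|x ord0 i|)).+1 => // i.
  rewrite mxE subr0 (le_trans _ (ltW (truncnS_gt _)))//.
  by rewrite (bigD1 i)//= lerDl sumr_ge0.
move=> k; split; first exact: measurable_cube.
by rewrite lebesgue_cube// ltry.
Qed.

(** Lebesgue measure under a name to which sigma-finiteness can be attached, as
    Fubini's theorem demands. *)
Definition lebesgue_sf n : set 'rV[R]_n -> \bar R := lebn n.

HB.instance Definition _ n := Measure.copy (@lebesgue_sf n) (Measure.sort (lebn n)).
HB.instance Definition _ n := Measure_isSigmaFinite.Build _ _ _ (@lebesgue_sf n)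
  (lebesgue_rV_sigma_finite n).

Lemma integrable_snoc n (f : 'rV[R]_n.+1 -> \bar R) :
  measurable_fun setT f ->
  (@lebesgue_sf n \x leb)%E.-integrable setT (f \o @rV_snoc R n) ->
  (lebn n.+1).-integrable setT f.
Proof.
move=> mf intf.
exact: (integrable_pushforward (measurable_rV_snoc (n := n)) mf intf measurableT).
Qed.

Lemma integral_snoc n (f : 'rV[R]_n.+1 -> \bar R) :
  measurable_fun setT f ->
  (@lebesgue_sf n \x leb)%E.-integrable setT (f \o @rV_snoc R n) ->
  (\int[lebn n.+1]_x f x = \int[lebn n]_x \int[leb]_t f (rV_snoc (x, t)))%E.
Proof.
move=> mf intf.
have := integral_pushforward (measurable_rV_snoc (n := n)) mf intf measurableT.
rewrite preimage_setT => ->.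
by rewrite -(integral12_prod_meas1 intf).
Qed.

End lebesgue_Rn.

(** * Integrals of tensor products *)

Section tensor.
Variable R : realType.
Local Notation leb := (@lebesgue_measure R).
Local Notation lebn n := (lebesgue_rV R n).

Definition tensor n (k : 'I_n -> R -> R) (x : 'rV[R]_n) : R := \prod_i k i (x ord0 i).

Lemma tensor_snoc n (k : 'I_n.+1 -> R -> R) (x : 'rV[R]_n) (t : R) :
  tensor k (rV_snoc (x, t)) = tensor (fun j => k (lift ord_max j)) x * k ord_max t.
Proof.
rewrite /tensor (bigD1_ord ord_max)//= rV_snocR mulrC; congr (_ * _).
by apply: eq_bigr => j _; rewrite rV_snocL.
Qed.

Lemma dot_snoc n (xi : 'rV[R]_n.+1) (x : 'rV[R]_n) (t : R) :
  dot (rV_snoc (x, t)) xi =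
  dot x (\row_j xi ord0 (lift ord_max j)) + t * xi ord0 ord_max.
Proof.
rewrite /dot (bigD1_ord ord_max)//= rV_snocR addrC; congr (_ + _).
by apply: eq_bigr => j _; rewrite rV_snocL mxE.
Qed.

Lemma measurable_tensor n (k : 'I_n -> R -> R) :
  (forall i, measurable_fun setT (k i)) -> measurable_fun setT (tensor k).
Proof.
move=> mk; apply: measurable_prod => i _.
exact: (measurableT_comp (mk i) (measurable_coord i)).
Qed.

Lemma measurable_dot n (xi : 'rV[R]_n) : measurable_fun setT (fun x => dot x xi).
Proof.
apply: measurable_sum => i; apply: measurable_funM => //; exact: measurable_coord.
Qed.

Lemma integrable_tensor n (k : 'I_n -> R -> R) :
  (forall i, measurable_fun setT (k i)) ->
  (forall i, leb.-integrable setT (EFin \o k i)) ->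
  (lebn n).-integrable setT (EFin \o tensor k).
Proof.
elim: n k => [|n IH] k mk ik.
  apply/integrableP; split; first by apply/measurable_EFinP; exact: measurable_tensor.
  rewrite integral_dirac//= ?diracE ?mem_set// ?mul1e ?ltry//.
  by apply/measurable_EFinP; apply: measurableT_comp => //; exact: measurable_tensor.
apply: integrable_snoc; first by apply/measurable_EFinP; exact: measurable_tensor.
have I' : (@lebesgue_sf R n).-integrable setT (EFin \o tensor (fun j => k (lift ord_max j))).
  by apply: IH => i; [exact: mk|exact: ik].
have := integrable_prodM I' (ik ord_max).
by congr (integrable _ _ _); apply/funext => -[x t]; rewrite /= tensor_snoc.
Qed.

Lemma integrable_tensor_cos n (k : 'I_n -> R -> R) (xi : 'rV[R]_n) (al : R) :
  (forall i, measurable_fun setT (k i)) ->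
  (forall i, leb.-integrable setT (EFin \o k i)) ->
  (lebn n).-integrable setT (EFin \o (fun x => tensor k x * cos (dot x xi + al))).
Proof.
move=> mk ik; apply: (le_integrable _ _ _ (integrable_tensor mk ik)) => //.
  apply/measurable_EFinP; apply: measurable_funM; first exact: measurable_tensor.
  apply: measurableT_comp; first by apply: continuous_measurable_fun; exact: continuous_cos.
  by apply: measurable_funD => //; exact: measurable_dot.
by move=> x _; rewrite !abse_EFin lee_fin normrM ler_piMr// cos_max.
Qed.

(** The angle stays free in the one-dimensional hypothesis, so that Fubini's
    theorem can integrate one variable after the other. *)
Lemma integral_tensor_cos n (k : 'I_n -> R -> R) (xi : 'rV[R]_n) (c th : 'I_n -> R) :
  (forall i, measurable_fun setT (k i)) ->
  (forall i, leb.-integrable setT (EFin \o k i)) ->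
  (forall i al, \int[leb]_t (k i t * cos (t * xi ord0 i + al)) = c i * cos (th i + al)) ->
  forall al, \int[lebn n]_x (tensor k x * cos (dot x xi + al)) =
             (\prod_i c i) * cos (\sum_i th i + al).
Proof.
elim: n k xi c th => [|n IH] k xi c th mk ik kc al.
  rewrite /Rintegral integral_dirac//=; last first.
    by have /integrableP[] := integrable_tensor_cos xi al mk ik.
  by rewrite indicT mul1r /tensor /dot !big_ord0.
pose k' j := k (lift ord_max j); pose xi' := \row_j xi ord0 (lift ord_max j).
have I' : (@lebesgue_sf R n).-integrable setT (EFin \o tensor k').
  by apply: integrable_tensor => i; [exact: mk|exact: ik].
rewrite /Rintegral integral_snoc; last 2 first.
- by have /integrableP[] := integrable_tensor_cos xi al mk ik.
- apply: (le_integrable _ _ _ (integrable_prodM I' (ik ord_max))) => //.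
    apply: measurableT_comp; last exact: measurable_rV_snoc.
    by have /integrableP[] := integrable_tensor_cos xi al mk ik.
  move=> -[x t] _; rewrite /= tensor_snoc lee_fin.
  by rewrite normrM ler_piMr// cos_max.
rewrite -/(Rintegral _ _ _).
transitivity (\int[lebn n]_x (tensor k' x * (c ord_max * cos (dot x xi' + (th ord_max + al))))).
  rewrite /Rintegral; congr fine; apply: eq_integral => x _.
  transitivity ((tensor k' x * \int[leb]_t (k ord_max t * cos (t * xi ord0 ord_max + (dot x xi' + al))))%:E)%E.
    rewrite EFinM /Rintegral fineK; last first.
      by apply: integrable_fin_num => //; exact: integrable_mul_cos.
    rewrite -integralZl//; last exact: integrable_mul_cos.
    by apply: eq_integral => t _; rewrite tensor_snoc dot_snoc -EFinM -mulrA addrCA addrA.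
  by rewrite kc; congr (_ * (_ * cos _))%:E; rewrite addrCA.
have Ic := integrable_tensor_cos xi' (th ord_max + al) (fun i => mk (lift ord_max i)) (fun i => ik (lift ord_max i)).
transitivity (c ord_max * \int[lebn n]_x (tensor k' x * cos (dot x xi' + (th ord_max + al)))).
  by rewrite -RintegralZl//; apply: eq_Rintegral => x _; rewrite mulrCA.
rewrite (IH k' xi' (c \o lift ord_max) (th \o lift ord_max))//; last first.
- by move=> i al'; rewrite mxE; exact: kc.
- by move=> i; exact: ik.
- by move=> i; exact: mk.
rewrite [in RHS](bigD1_ord ord_max)//= [in RHS](bigD1_ord (F := th) ord_max)//= mulrA.
by congr (_ * cos _); rewrite addrCA addrA.
Qed.

End tensor.

(** * Continuous functions on R^n and cubes *)

Section cubes.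
Variables (R : realType) (n : nat).
Local Notation E := 'rV[R]_n.
Implicit Types (x y : E) (rho : R).

Lemma cube_norm y rho : 0 <= rho -> cube y rho = [set x | `|x - y| <= rho].
Proof.
move=> rho0; apply/seteqP; split => x /=.
  move=> h; rewrite [leLHS]mx_normrE; apply/bigmax_leP; split => // -[i j] _ /=.
  by rewrite ord1 !mxE; exact: h.
rewrite [X in X <= _]mx_normrE => /bigmax_leP[_ h] i.
by have := h (ord0, i) isT; rewrite /= !mxE.
Qed.

Lemma nbhs_cube x (U : set E) : nbhs x U -> exists2 e : R, 0 < e & cube x e `<=` U.
Proof.
move=> /nbhs_ballP[e /= e0 eU]; exists (e / 2); first by rewrite divr_gt0.
rewrite cube_norm ?divr_ge0// ?ltW// => z /= zx; apply: eU.
rewrite -ball_normE/= distrC (le_lt_trans zx)//; lra.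
Qed.

(** An open set is the union of the countably many cubes with rational centre and
    size [1 / m] that it contains. *)
Lemma open_measurable_rV (U : set E) : open U -> measurable U.
Proof.
move=> oU.
pose c (z : 'rV[rat]_n * nat) := cube (map_mx (@ratr R) z.1) (z.2.+1%:R^-1).
rewrite (_ : U = \bigcup_z (if `[< c z `<=` U >] then c z else set0)).
  apply: countable_bigcupT_measurable => //.
  by move=> z; case: asboolP => // _; exact: measurable_cube.
apply/seteqP; split => [x Ux|x [z _]]; last by case: asboolP => // zU /zU.
have /nbhs_cube[e e0 eU] : nbhs x U by move: oU => /(_ x Ux).
have [m mP] : exists m : nat, m.+1%:R^-1 < e / 2 :> R.
  exists (Num.trunc (2 / e)); rewrite invf_plt ?posrE ?divr_gt0//.
  by rewrite invf_div; exact: truncnS_gt.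
have m0 : 0 < m.+1%:R^-1 :> R by rewrite invr_gt0.
have qP i : exists q : rat, `|x ord0 i - ratr q| < m.+1%:R^-1.
  have /rat_in_itvoo[q] : x ord0 i - m.+1%:R^-1 < x ord0 i + m.+1%:R^-1.
    by rewrite ltrBlDr -addrA ltrDl addr_gt0.
  by rewrite in_itv/= -ltr_distl distrC => ?; exists q.
have [q qx] := choice qP.
exists (\row_i q i, m) => //; case: asboolP => [_|].
  by move=> i; rewrite !mxE; exact: ltW.
case=> z zc; apply: eU => i; have := zc i; rewrite !mxE/= => h.
have -> : z ord0 i - x ord0 i = (z ord0 i - ratr (q i)) - (x ord0 i - ratr (q i)) by ring.
rewrite (le_trans (ler_normB _ _))//.
by rewrite [e]splitr; apply: lerD; apply/ltW; [apply: le_lt_trans mP|apply: lt_trans (qx i) mP].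
Qed.

Lemma continuous_measurable_rV (f : E -> R) : continuous f -> measurable_fun setT f.
Proof.
move=> cf; apply: (measurability _ (RGenOInfty.measurableE R)) => //.
move=> _ [_ [a ->] <-]; rewrite setTI; apply: open_measurable_rV.
by move/continuousP: cf; apply; exact: interval_open.
Qed.

End cubes.

(** * Tensor products of Schwartz functions *)

Section tensor_schwartz.
Variables (R : realType) (n : nat).
Implicit Types (k : 'I_n -> R -> R) (x : 'rV[R]_n).

Lemma continuous_tensor k : (forall i, continuous (k i)) -> continuous (tensor k).
Proof.
move=> ck; rewrite /tensor; elim: (index_enum _) => [|i r IH] x.
  rewrite (_ : (fun _ => _) = fun=> 1 : R); first exact: cst_continuous.
  by apply/funext => y; rewrite big_nil.
rewrite (_ : (fun _ => _) = fun y : 'rV[R]_n => k i (y ord0 i) * \prod_(j <- r) k j (y ord0 j)); last first.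
  by apply/funext => y; rewrite big_cons.
have c1 : continuous (fun y : 'rV[R]_n => k i (y ord0 i)).
  move=> y; apply: (@continuous_comp _ _ _ (fun y : 'rV[R]_n => y ord0 i) (k i)).
    exact: coord_continuous.
  exact: ck.
exact: (cvgM (c1 x) (IH x)).
Qed.

(** In the direction of a coordinate only one factor varies, so that the
    difference quotients are those of this factor, up to a constant. *)
Lemma is_derive_tensor k i x : derivable (k i) (x ord0 i) 1 ->
  is_derive x (delta_mx ord0 i) (tensor k)
    (tensor (fun j => if j == i then derive1 (k j) else k j) x).
Proof.
move=> dk; pose P := \prod_(j | j != i) k j (x ord0 j).
have E : (fun h : R => h^-1 *: (tensor k (h *: delta_mx ord0 i + x) - tensor k x)) =
         (fun h : R => h^-1 *: (P * k i (h *: 1 + x ord0 i) - P * k i (x ord0 i))).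
  apply/funext => h; rewrite /tensor (bigD1 i)//= [in X in _ - X](bigD1 i)//=.
  rewrite !mxE !eqxx/= mulrC [in X in _ - X]mulrC; congr (_ *: (_ * _ - _)).
  by apply: eq_bigr => j ji; rewrite !mxE eqxx/= (negPf ji) mulr0 add0r.
have [d e] : is_derive (x ord0 i) 1 (fun s : R => P * k i s) (P * derive1 (k i) (x ord0 i)).
  rewrite derive1E; have := is_deriveZ P (derivableP dk).
  by move=> h; apply: is_derive_eq h _.
split; rewrite /derivable /derive E; first exact: d.
rewrite [LHS]e /tensor [RHS](bigD1 i)//= eqxx mulrC; congr (_ * _).
by apply: eq_bigr => j ji; rewrite (negPf ji).
Qed.

Lemma partials_tensor k (s : seq 'I_n) :
  (forall i m (t : R), derivable (derive1n m (k i)) t 1) ->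
  partials s (tensor k) = tensor (fun j => derive1n (count_mem j s) (k j)).
Proof.
move=> dk; elim: s => [//|i s IH].
rewrite /= -/(partials s _) IH; apply/funext => x; rewrite /partial.
have [_ ->] := @is_derive_tensor (fun j => derive1n (count_mem j s) (k j)) i x (dk _ _ _).
by apply: eq_bigr => j _; rewrite [i == j]eq_sym; case: (j == i).
Qed.

Lemma schwartz_tensor k : (forall i, schwartz1 (k i)) ->
  schwartz (fun x => (tensor k x)%:C%C).
Proof.
move=> Sk; have dk i m (t : R) : derivable (derive1n m (k i)) t 1 := (Sk i m).1 t.
have ck i m : continuous (derive1n m (k i)).
  by move=> t; apply: differentiable_continuous; apply/derivable1_diffP; exact: dk.
have p0 s : partials s (fun _ : 'rV[R]_n => 0 : R) = fun=> 0.
  by elim: s => [//|i s IH]; rewrite /= -/(partials s _) IH; apply/funext => x; exact: derive_cst.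
split.
  split => s; split.
  - by rewrite partials_tensor//; exact: continuous_tensor.
  - by move=> x i; rewrite partials_tensor//; case: (@is_derive_tensor (fun j => derive1n (count_mem j s) (k j)) i x (dk _ _ _)).
  - by rewrite p0; exact: cst_continuous.
  - by move=> x i; rewrite p0; exact: derivable_cst.
move=> a b; rewrite /schwartz_seminorm.
have [C CP] := choice (fun i => (Sk i (count_mem i (flatten [seq nseq (b j) j | j <- enum 'I_n]))).2 (a i)).
rewrite (@le_lt_trans _ _ (\prod_i C i)%:E) ?ltry//.
apply: ub_ereal_sup => _ [x _ <-]; rewrite lee_fin.
rewrite /cDmulti /Dmulti /cmod/= p0 partials_tensor//= expr0n/= addr0 sqrtr_sqr.
rewrite /monomial /tensor !normr_prod -big_split/= ler_prod// => i _.
by rewrite normrX CP mulr_ge0 ?exprn_ge0.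
Qed.

End tensor_schwartz.

(** * Approximate identities reproducing band-limited waves *)

Section schwartz1_affine.
Variable R : realType.

Lemma expr_max1_le (u : R) (m : nat) : 0 <= u -> Num.max 1 u ^+ m <= 1 + u ^+ m.
Proof.
move=> u0; rewrite /Num.max; case: ifP => _; first by rewrite lerDr.
by rewrite expr1n lerDl exprn_ge0.
Qed.

Lemma schwartz1_bound (f : R -> R) (m : nat) : schwartz1 f ->
  exists2 C, 0 < C & forall s, `|f s| <= C / (1 + `|s|) ^+ m.
Proof.
move=> Sf; have [C0 h0] := (Sf 0%N).2 0%N; have [C1 h1] := (Sf 0%N).2 m.
have C0p : 0 <= C0 by apply: le_trans (h0 0); rewrite mulr_ge0.
have C1p : 0 <= C1 by apply: le_trans (h1 0); rewrite mulr_ge0.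
exists (2 ^+ m * (C0 + C1) + 1); first by rewrite ltr_wpDl// mulr_ge0// ?addr_ge0.
move=> s; rewrite ler_pdivlMr; last by rewrite exprn_gt0// ltr_wpDr.
have hm : (1 + `|s|) ^+ m <= 2 ^+ m * (1 + `|s| ^+ m).
  rewrite (@le_trans _ _ ((2 * Num.max 1 `|s|) ^+ m))//.
    rewrite lerXn2r ?nnegrE ?addr_ge0 ?mulr_ge0// ?le_max ?ler01//.
    by rewrite mulrDl mul1r lerD// le_max lexx ?orbT.
  by rewrite exprMn ler_wpM2l ?exprn_ge0// expr_max1_le.
rewrite (le_trans (ler_wpM2l _ hm))// (@le_trans _ _ (2 ^+ m * (C0 + C1)))//; last by rewrite lerDl.
rewrite mulrCA ler_wpM2l ?exprn_ge0// mulrDr mulr1; apply: lerD.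
  by have := h0 s; rewrite expr0 mul1r.
by rewrite mulrC; exact: h1.
Qed.

Lemma schwartz1_affine (f : R -> R) (c a b : R) : 0 < a -> schwartz1 f ->
  schwartz1 (fun t => c * f (a * t + b)).
Proof.
move=> a0 Sf; pose g m (t : R) := c * a ^+ m * derive1n m f (a * t + b).
have dg m (t : R) : is_derive t 1 (g m) (g m.+1 t).
  have h1 : is_derive t 1 (fun s : R => a * s + b) a.
    have := is_deriveD (is_derive_mull a t) (is_derive_cst b t (1 : R)).
    by rewrite addr0.
  have h2 : is_derive (a * t + b) 1 (derive1n m f) (derive1n m.+1 f (a * t + b)).
    by rewrite derive1nS derive1E; apply: derivableP; exact: (Sf m).1.
  have := is_deriveZ (c * a ^+ m) (@is_derive1_comp _ _ (fun s : R => a * s + b) t _ _ h2 h1).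
  by move=> h; apply: is_derive_eq h _; rewrite /g exprS /GRing.scale/=; ring.
have eg m : derive1n m (fun t => c * f (a * t + b)) = g m.
  elim: m => [|m IH]; first by apply/funext => t; rewrite /g expr0 mulr1.
  rewrite derive1nS IH; apply/funext => t; rewrite derive1E.
  exact: is_derive_val (dg m t).
move=> m; split => [t|k]; first by rewrite eg; exact: is_derive_ex (dg m t).
have [C0 h0] := (Sf m).2 0%N; have [C1 h1] := (Sf m).2 k.
pose K := (1 + `|b|) / a.
have K0 : 0 <= K by rewrite divr_ge0 ?addr_ge0// ltW.
exists (K ^+ k * (C0 + C1) * `|c * a ^+ m|) => t; rewrite eg /g normrM.
set s := a * t + b.
have ht : `|t| ^+ k <= K ^+ k * (1 + `|s| ^+ k).
  rewrite (@le_trans _ _ ((K * Num.max 1 `|s|) ^+ k))//; last first.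
    by rewrite exprMn ler_wpM2l ?exprn_ge0// expr_max1_le.
  apply: lerXn2r; rewrite ?nnegrE ?(mulr_ge0 K0) ?le_max ?ler01//.
  have -> : t = (s - b) / a by rewrite /s addrK mulrC mulKf// gt_eqF.
  rewrite normrM [`|a^-1|]gtr0_norm ?invr_gt0// /K mulrAC ler_wpM2r ?invr_ge0 ?(ltW a0)//.
  rewrite (le_trans (ler_normB _ _))// mulrDl mul1r lerD ?le_max ?lexx ?orbT//.
  by rewrite ler_peMr// le_max lexx.
rewrite mulrCA mulrC ler_wpM2r// (le_trans (ler_wpM2r _ ht))// -mulrA ler_wpM2l ?exprn_ge0//.
rewrite mulrDl mul1r; apply: lerD; last exact: h1.
by have := h0 s; rewrite expr0 mul1r.
Qed.

End schwartz1_affine.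

Section approximate_identity.
Variables (R : realType) (n : nat) (kap : R -> R) (c a0 : R).
Hypotheses (n_gt0 : (0 < n)%N) (c0 : 0 < c) (Sk : schwartz1 kap).
Hypothesis plateau : forall xi al, `|xi| <= a0 ->
  \int[@lebesgue_measure R]_x (kap x * cos (x * xi + al)) = c * cos al.
Local Notation leb := (@lebesgue_measure R).
Local Notation lebn := (lebesgue_rV R n).
Implicit Types (x y xi : 'rV[R]_n) (e : R).

Definition approx_id1 e (v t : R) : R := (e * c)^-1 * kap (e^-1 * t + - (v / e)).

Definition approx_id e y : 'rV[R]_n -> R := tensor (fun i => approx_id1 e (y ord0 i)).

Lemma approx_id1_schwartz e v : 0 < e -> schwartz1 (approx_id1 e v).
Proof. by move=> e0; apply: schwartz1_affine => //; rewrite invr_gt0. Qed.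

Let mk e v : 0 < e -> measurable_fun setT (approx_id1 e v).
Proof.
move=> e0; apply: continuous_measurable_fun.
by apply: schwartz1_continuous; exact: approx_id1_schwartz.
Qed.

Let ik e v : 0 < e -> leb.-integrable setT (EFin \o approx_id1 e v).
Proof. by move=> e0; apply: schwartz1_integrable; exact: approx_id1_schwartz. Qed.

Lemma approx_id_schwartz e y : 0 < e -> schwartz (fun x => (approx_id e y x)%:C%C).
Proof. by move=> e0; apply: schwartz_tensor => i; exact: approx_id1_schwartz. Qed.

Lemma integrable_approx_id e y : 0 < e -> lebn.-integrable setT (EFin \o approx_id e y).
Proof. by move=> e0; apply: integrable_tensor => i; [exact: mk|exact: ik]. Qed.

Lemma integral_approx_id1 e (v w al : R) : 0 < e -> `|e * w| <= a0 ->
  \int[leb]_t (approx_id1 e v t * cos (t * w + al)) = cos (v * w + al).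
Proof.
move=> e0 wa; pose f s := (e * c)^-1 * (kap s * cos (s * (e * w) + (v * w + al))).
have iK := integrable_mul_cos (e * w) (v * w + al)
  (continuous_measurable_fun (schwartz1_continuous Sk)) (schwartz1_integrable Sk).
have iF : leb.-integrable setT (EFin \o f) := integrableZl measurableT _ iK.
have -> : \int[leb]_t (approx_id1 e v t * cos (t * w + al)) =
    \int[leb]_t f (e^-1 * t + - (v / e)).
  apply: eq_Rintegral => t _; rewrite /f /approx_id1 -mulrA; congr (_ * (_ * cos _)).
  by field; rewrite gt_eqF.
rewrite Rintegral_affine ?invr_gt0//; last first.
  by apply/measurable_EFinP; exact: measurable_int iF.
by rewrite RintegralZl// plateau// invrK; field; rewrite !gt_eqF.
Qed.

(** Rescaling to the width [e] stretches the plateau of the transform to the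
    frequencies of size [a0 / e]. *)
Lemma integral_approx_id_cos e y xi al : 0 < e -> (forall i, `|e * xi ord0 i| <= a0) ->
  \int[lebn]_x (approx_id e y x * cos (dot x xi + al)) = cos (dot y xi + al).
Proof.
move=> e0 xia.
rewrite (@integral_tensor_cos _ _ _ _ (fun=> 1) (fun i => y ord0 i * xi ord0 i))//.
- by rewrite big1 ?mul1r.
- by move=> i; exact: mk.
- by move=> i; exact: ik.
- by move=> i al'; rewrite mul1r integral_approx_id1.
Qed.

(** A pure wave on any given bounded set as soon as [e] is small: on that set the
    inverse transform does not see [e]. *)
Lemma invfourier_approx_id e y x : 0 < e ->
  (forall i, `|e * (2 * pi * x ord0 i)| <= a0) ->
  invfourier (fun z => (approx_id e y z)%:C%C) x = cis (2 * pi * dot x y).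
Proof.
move=> e0 xa; pose xi : 'rV[R]_n := \row_i (2 * pi * x ord0 i).
have dE z : 2 * pi * dot x z = dot z xi.
  by rewrite /dot mulr_sumr; apply: eq_bigr => i _; rewrite mxE; ring.
have xia i : `|e * xi ord0 i| <= a0 by rewrite mxE.
rewrite /invfourier /cintegral /cis; congr Complex.
  have := integral_approx_id_cos y 0 e0 xia; rewrite dE addr0 => <-.
  by apply: eq_Rintegral => z _; rewrite /cRe/= mul0r subr0 dE addr0.
rewrite -[in RHS](cosBpihalf (2 * pi * dot x y)) dE -(integral_approx_id_cos y (- (pi / 2)) e0 xia).
by apply: eq_Rintegral => z _; rewrite /cIm/= mul0r addr0 dE cosBpihalf.
Qed.

(** Of the size of the inverse volume of a cube of side [e] near [y], with
    integrable decay; the distance is that of the sup norm. *)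
Definition decay_weight e y x : R := e / (e + `|x - y|) ^+ n.+1.

(** In a product of decaying factors, the one of the coordinate where [x - y] is
    largest provides all the decay, and the others are bounded. *)
Lemma approx_id_decay : exists2 C, 0 < C & forall e y x, 0 < e ->
  `|approx_id e y x| <= C * decay_weight e y x.
Proof.
have [C C0 CP] := schwartz1_bound n.+1 Sk.
exists ((C / c) ^+ n); first by rewrite exprn_gt0// divr_gt0.
move=> e y x e0; pose v i := (1 + `|x ord0 i - y ord0 i| / e) ^- n.+1.
have ec0 : 0 < e * c by rewrite mulr_gt0.
have w0 i : 1 <= (1 + `|x ord0 i - y ord0 i| / e) ^+ n.+1.
  by rewrite exprn_ege1// lerDl divr_ge0// ltW.
have v1 i : 0 <= v i <= 1.
  by rewrite invr_ge0 (le_trans ler01 (w0 i))/= invf_le1// (lt_le_trans ltr01).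
have h1 i : `|approx_id1 e (y ord0 i) (x ord0 i)| <= (e * c)^-1 * C * v i.
  rewrite /approx_id1 normrM gtr0_norm ?invr_gt0// -mulrA ler_wpM2l ?invr_ge0 ?(ltW ec0)//.
  rewrite (le_trans (CP _))// le_eqVlt; apply/orP; left; apply/eqP; congr (_ / _ ^+ _).
  rewrite [e^-1 * _]mulrC -mulrBl normrM [`|e^-1|]gtr0_norm ?invr_gt0//.
have [i vi] : exists i, v i = (1 + `|x - y| / e) ^- n.+1.
  have [xy|/mx_norm_neq0[[i j] /= ij]] := eqVneq (mx_norm (x - y)) 0.
    exists (Ordinal n_gt0); rewrite /v [`|x - y|]xy.
    by move/mx_norm_eq0/eqP: xy; rewrite subr_eq0 => /eqP ->; rewrite subrr normr0.
  by exists j; rewrite /v [`|x - y|]ij (ord1 i) !mxE.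
rewrite /approx_id /tensor normr_prod.
rewrite (@le_trans _ _ (\prod_i ((e * c)^-1 * C * v i)))//.
  by apply: ler_prod => j _; rewrite normr_ge0/= h1.
rewrite big_split/= prodr_const card_ord (@le_trans _ _ (((e * c)^-1 * C) ^+ n * v i))//.
  have B0 : 0 <= (e * c)^-1 * C by rewrite mulr_ge0 ?invr_ge0 ?ltW.
  rewrite ler_wpM2l ?exprn_ge0//.
  rewrite (bigD1 i)//= ler_piMr//; first by have /andP[] := v1 i.
  by apply: prodr_ile1 => j _; exact: v1.
rewrite vi /decay_weight le_eqVlt; apply/orP; left; apply/eqP.
have E : 1 + `|x - y| / e = (e + `|x - y|) / e by field; rewrite gt_eqF.
have D0 : e + `|x - y| != 0 by rewrite gt_eqF// ltr_pwDl.
rewrite E !(exprMn, exprVn, exprS).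
move: (expf_neq0 n D0) (expf_neq0 n (lt0r_neq0 e0)) (expf_neq0 n (lt0r_neq0 c0)).
move: (_ ^+ n) (e ^+ n) (c ^+ n) (C ^+ n) => X1 X2 X3 X4 h1' h2' h3'.
by field; rewrite D0 h1' h2' h3' gt_eqF.
Qed.

End approximate_identity.

(** * Averages against the decaying weight *)

Section weighted_average.
Variables (R : realType) (n : nat).
Hypothesis n_gt0 : (0 < n)%N.
Local Notation E := 'rV[R]_n.
Local Notation lebn := (lebesgue_rV R n).
Implicit Types (x y : E) (i k m : int).

Lemma pow2_lt_ex (nu c : R) : 0 < nu -> 0 < c -> exists k : int, pow2 (k%:~R * nu) < c.
Proof.
move=> nu0 c0; have [z ->] := pow2_surj c0.
exists (Num.floor (z / nu) - 1); rewrite ltr_pow2E -ltr_pdivlMr//.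
by rewrite intrD (lt_le_trans _ (floor_le_tmp _))// ltrBlDr ltrDl.
Qed.

(** The contribution of level [i] to an average at scale [m], as a function of
    [d = i - m].  At the distance [2 ^ i], beyond the scale, the weight
    [2 ^ m * 2 ^ (- i (n + 1))] meets a volume [2 ^ (i n)].  Inside the scale, the
    weight [2 ^ (- m n)] meets a set of measure [2 ^ (i n)] on which the level is
    exceeded. *)
Definition majorant (d : int) : R :=
  if 0 <= d then pow2 (- d%:~R) else pow2 (n%:R * d%:~R).

Lemma majorant_ge0 d : 0 <= majorant d.
Proof. by rewrite /majorant; case: ifP => _; exact: pow2_ge0. Qed.

Lemma decay_weight_ge0 (e : R) y x : 0 < e -> 0 <= decay_weight e y x.
Proof. by move=> e0; rewrite divr_ge0 ?ltW// exprn_gt0// ltr_pwDl. Qed.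

Lemma continuous_decay_weight (e : R) y : 0 < e -> continuous (decay_weight e y).
Proof.
move=> e0 x; have D0 : (e + `|x - y|) ^+ n.+1 != 0.
  by rewrite expf_neq0// gt_eqF// ltr_pwDl.
have c0 : `|z - y| @[z --> x] --> `|x - y|.
  apply: (@continuous_comp _ _ _ (fun z : E => z - y) (fun z : E => `|z|) x); last exact: norm_continuous.
  apply: (@continuousB _ _ _ (fun z : E => z) (fun=> y) x); first exact: cvg_id.
  exact: cst_continuous.
have c1 := @continuousD _ _ _ (fun=> e) (fun z : E => `|z - y|) x (@cst_continuous _ _ e x) c0.
have c2 := @continuous_comp _ _ _ (fun z : E => e + `|z - y|) (fun t => t ^+ n.+1) x c1
  (@exprn_continuous _ _ _).
apply: (@continuousM _ _ (fun=> e) (fun z : E => ((e + `|z - y|) ^+ n.+1)^-1) x).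
  exact: cst_continuous.
exact: continuousV.
Qed.

Let w m y := decay_weight (pow2 m%:~R) y.
(* A bound for the weight outside the cube of size [2 ^ (i - 1)] if [m < i], and on
   all of space if [i <= m]. *)
Let W m i : R := if m <= i then pow2 (m%:~R - (i%:~R - 1) * n.+1%:R)
                 else pow2 (- (m%:~R * n%:R)).

Let w_le m y x : w m y x <= pow2 (- (m%:~R * n%:R)).
Proof.
have e0 := pow2_gt0 (m%:~R : R); rewrite /w /decay_weight.
rewrite (@le_trans _ _ (pow2 m%:~R / pow2 m%:~R ^+ n.+1))//.
  rewrite ler_wpM2l ?(ltW e0)// lef_pV2 ?posrE ?exprn_gt0 ?ltr_pwDl//.
  by apply: lerXn2r; rewrite ?nnegrE ?addr_ge0 ?(ltW e0)// lerDl.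
rewrite exprS invfM mulrA divff ?gt_eqF// mul1r pow2N pow2M.
by rewrite powR_mulrn ?pow2_ge0.
Qed.

Let w_le_far m i y x : m <= i -> i = m \/ pow2 (i%:~R - 1) < `|x - y| -> w m y x <= W m i.
Proof.
move=> mi h; rewrite /W mi; case: h => [->|h].
  by apply: le_trans (w_le _ _ _) _; have := ler0n R n; rewrite ler_pow2E -natr1; nra.
have e0 := pow2_gt0 (m%:~R : R); have f0 := pow2_gt0 (i%:~R - 1 : R).
rewrite pow2D pow2N pow2M powR_mulrn ?pow2_ge0// /w /decay_weight.
rewrite ler_wpM2l ?(ltW e0)// lef_pV2 ?posrE ?exprn_gt0 ?ltr_pwDl//.
by apply: lerXn2r; rewrite ?nnegrE ?addr_ge0 ?(ltW e0) ?(ltW f0)// (le_trans (ltW h))// lerDr ltW.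
Qed.

Variables (G : E -> \bar R) (a : int -> \bar R).
Hypotheses (mG : measurable_fun setT G) (G0 : forall x, (0 <= G x)%E).
Hypotheses (a_ge0 : forall k, (0 <= a k)%E) (tG : tail_le lebn n%:R G a).

Let Om i := [set x | (a i < G x)%E].

Let mOm i : measurable (Om i).
Proof.
rewrite (_ : Om i = [set: E] `&` [set x | (a i < G x)%E]); last by rewrite setTI.
exact: emeasurable_fun_lt.
Qed.

(* The points at which [G] exceeds all levels. *)
Let null := \bigcup_(j : nat) [set x | forall i, i <= - j%:Z -> Om i x].

Let null_negligible : lebn.-negligible null.
Proof.
apply: negligible_bigcup => j.
pose N := \bigcap_(l : nat) Om (- j%:Z - l%:Z).
have mN : measurable N by apply: bigcapT_measurable.
exists N; split => //; last first.
  by move=> x /= h l _; apply: h; rewrite lerBlDr lerDl.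
apply/eqP; rewrite eq_le measure_ge0 andbT leNgt; apply/negP => N0.
have [c c0 cN] : exists2 c : R, 0 < c & (c%:E <= lebn N)%E.
  move: N0; case: (lebn N) => [r|_|//]; last by exists 1 => //; rewrite leey.
  by rewrite lte_fin => r0; exists r.
have n0 : 0 < n%:R :> R by rewrite ltr0n.
have [k kc] := pow2_lt_ex n0 c0.
suff : (c%:E <= (pow2 (k%:~R * n%:R))%:E)%E by rewrite lee_fin leNgt kc.
apply: (le_trans cN); have [kj|kj] := leP k (- j%:Z).
  apply: le_trans (tG k); apply: le_measure; rewrite ?inE//; first exact: mOm.
  move=> x /(_ `|- j%:Z - k|%N I) /=; congr (a _ < _)%E; lia.
apply: (@le_trans _ _ (lebn (Om (- j%:Z)))).
  apply: le_measure; rewrite ?inE//.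
  by move=> x /(_ 0%N I) /=; rewrite subr0.
apply: le_trans (tG _) _; rewrite lee_fin ler_pow2E ler_wpM2r ?(ltW n0)//.
by rewrite ler_int ltW.
Qed.

(* What is charged to level [i], namely the points of the i-th shell with
   [G x <= a i], and those with [a (i + 1) < G x <= a i]. *)
Let v m y i x : R := W m i * ((m <= i)%R%:R * \1_(cube y (pow2 i%:~R)) x + \1_(Om (i + 1)%R) x).

Let W_ge0 m i : 0 <= W m i.
Proof. by rewrite /W; case: ifP => _; exact: pow2_ge0. Qed.

Let v_ge0 m y i x : 0 <= v m y i x.
Proof. by rewrite mulr_ge0 ?addr_ge0 ?mulr_ge0. Qed.

Let mv m y i : measurable_fun setT (v m y i).
Proof.
apply: measurable_funM => //; apply: measurable_funD.
  by apply: measurable_funM => //; apply: measurable_indic; exact: measurable_cube.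
by apply: measurable_indic; exact: mOm.
Qed.

(** Let [k] be the index of the shell of [x].  If [G x] is at most [a k], the point
    is charged to the shell.  Otherwise it is charged to the level of [G x], whose
    index is smaller than [k], at the larger weight of that index. *)
Let pointwise m y x : ~ null x ->
  (G x * (w m y x)%:E <= zsum (fun i => a i * (v m y i x)%:E))%E.
Proof.
move=> xN; have w0 : 0 <= w m y x by apply: decay_weight_ge0; exact: pow2_gt0.
suff [i [Ga wv]] : exists i, (G x <= a i)%E /\ w m y x <= v m y i x.
  have h : (G x * (w m y x)%:E <= a i * (v m y i x)%:E)%E by apply: lee_pmul; rewrite ?lee_fin.
  apply: le_trans h _; apply: (@zsum_ge_term _ (fun i => a i * (v m y i x)%:E)%E) => j.
  by rewrite mule_ge0 ?lee_fin.
have exl : exists l : nat, `|x - y| <= pow2 (m + l%:Z)%:~R.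
  have [z xz] : exists z, `|x - y| + 1 = pow2 z by apply: pow2_surj; rewrite ltr_wpDl.
  exists `|Num.ceil z - m|%N; rewrite (@le_trans _ _ (pow2 z))//; first by rewrite -xz lerDl.
  rewrite ler_pow2E (le_trans (ceil_ge z))// ler_int.
  by move: (Num.ceil z) => c; lia.
case: (ex_minnP exl) => l lP lmin; set k := m + l%:Z in lP.
have mk : m <= k by rewrite lerDl.
have kfar i : i < k -> m <= i -> pow2 i%:~R < `|x - y|.
  move=> ik mi; rewrite ltNge; apply/negP => h.
  have := lmin `|i - m|%N; rewrite (_ : m + _ = i); last by lia.
  by move=> /(_ h); lia.
have [Gak|aGk] := leP (G x) (a k).
  exists k; split => //; have xk : \1_(cube y (pow2 k%:~R)) x = 1 :> R.
    by rewrite indicE mem_set// cube_norm ?pow2_ge0.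
  rewrite /v mk xk mul1r (le_trans (w_le_far mk _))//; last first.
    by rewrite ler_peMr// lerDl.
  have [->|km] := eqVneq k m; [by left|right].
  have := kfar (k - 1); rewrite intrD => -> //; lia.
have exi : exists j : nat, (G x <= a (k - j%:Z))%E.
  apply: contrapT => /forallNP h; apply: xN; exists `|k|%N => // i ik /=.
  rewrite /Om/= ltNge; apply/negP => hi; apply: (h `|k - i|%N).
  by rewrite (_ : k - _ = i)//; lia.
case: (ex_minnP exi) => j jP jmin; set i := k - j%:Z in jP.
have j0 : (0 < j)%N.
  by rewrite lt0n; apply/eqP => j0; move: aGk; rewrite ltNge -[k]subr0 -[0]/(0%N%:Z) -j0 jP.
have ik : i < k by rewrite /i; lia.
have xO : \1_(Om (i + 1)) x = 1 :> R.
  rewrite indicE mem_set// /Om/= ltNge; apply/negP => h.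
  have := jmin j.-1; rewrite (_ : k - _ = i + 1); last by rewrite /i; lia.
  by move=> /(_ h); lia.
exists i; split => //; rewrite /v xO.
have [mi|im] := leP m i.
  rewrite (le_trans (w_le_far mi _))//; last by rewrite ler_peMr// lerDr mulr_ge0.
  right; apply: le_lt_trans (kfar i ik mi); rewrite ler_pow2E; lra.
by rewrite mul0r add0r mulr1 /W [m <= i]leNgt im/= w_le.
Qed.

Let int_v m y i : (\int[lebn]_x (v m y i x)%:E <= (pow2 (2 * n.+1%:R) * majorant (i - m))%:E)%E.
Proof.
have int_1 (A : set E) : measurable A -> (\int[lebn]_x (\1_A x)%:E = lebn A)%E.
  by move=> mA; rewrite integral_indic// setIT.
have mc := measurable_cube y (pow2 i%:~R).
have m1 (A : set E) : measurable A -> measurable_fun setT (fun x : E => (\1_A x : R)%:E).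
  by move=> mA; apply/measurable_EFinP; exact: measurable_indic.
pose b : R := (m <= i)%R%:R; have b0 : 0 <= b by rewrite ler0n.
have -> : (\int[lebn]_x (v m y i x)%:E =
    (W m i)%:E * (b%:E * lebn (cube y (pow2 i%:~R)) + lebn (Om (i + 1))))%E.
  transitivity (\int[lebn]_x ((W m i)%:E * (b%:E * (\1_(cube y (pow2 i%:~R)) x)%:E + (\1_(Om (i + 1)%R) x)%:E)))%E.
    by apply: eq_integral => x _; rewrite /v EFinM EFinD EFinM.
  have g1 x : (0 <= b%:E * (\1_(cube y (pow2 i%:~R)) x)%:E)%E by rewrite mule_ge0 ?lee_fin.
  have g2 x : (0 <= (\1_(Om (i + 1)%R) x : R)%:E)%E by rewrite lee_fin.
  have f1 : measurable_fun setT (fun x : E => b%:E * (\1_(cube y (pow2 i%:~R)) x)%:E)%E.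
    by apply: measurable_funeM; exact: m1.
  have f2 := m1 _ (mOm (i + 1)).
  rewrite (@ge0_integralZl _ _ _ lebn setT measurableT _ (emeasurable_funD f1 f2))//; last 2 first.
  - by move=> x _; rewrite adde_ge0.
  - by rewrite lee_fin.
  rewrite (@ge0_integralD _ _ _ lebn setT measurableT _ _ (fun x _ => g1 x) f1 (fun x _ => g2 x) f2).
  rewrite (@ge0_integralZl _ _ _ lebn setT measurableT _ (m1 _ mc))//.
  by rewrite !int_1.
rewrite lebesgue_cube ?pow2_ge0//.
apply: (@le_trans _ _ ((W m i)%:E * (b%:E * ((pow2 i%:~R *+ 2) ^+ n)%:E + (pow2 ((i + 1)%:~R * n%:R))%:E))%E).
  by apply: lee_wpmul2l; [rewrite lee_fin|apply: leeD2l; exact: tG].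
have cE : (pow2 i%:~R *+ 2) ^+ n = pow2 ((i + 1)%:~R * n%:R) :> R.
  by rewrite pow2M powR_mulrn ?pow2_ge0// intrD pow2D -mulr_natr -[pow2 1%:~R]/(2 `^ 1) powRr1.
set P := pow2 ((i + 1)%:~R * n%:R) in cE *; rewrite cE.
rewrite (_ : (b%:E * P%:E + P%:E = (b * P + P)%:E)%E)// -EFinM lee_fin /b /W /majorant subr_ge0.
have n0 : 0 <= n%:R :> R by [].
case: ifPn => mi; last first.
  rewrite mul0r add0r /P -!pow2D ler_pow2E -natr1 !intrD rmorphN/=.
  lra.
rewrite mul1r.
rewrite (_ : P + P = pow2 ((i + 1)%:~R * n%:R + 1)).
  rewrite -!pow2D ler_pow2E -natr1 !intrD rmorphN/=; lra.
by rewrite pow2D -[pow2 1]/(2 `^ 1) powRr1// -/P; ring.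
Qed.

(** The average of a function is controlled by its rearrangement: at each scale
    the cubes around the centre compete with the sets where the function is
    large. *)
Lemma integral_decay_weight_le m y :
  (\int[lebn]_x (G x * (decay_weight (pow2 m%:~R) y x)%:E) <=
   (pow2 (2 * n.+1%:R))%:E * zsum (fun i => (majorant (i - m))%:E * a i))%E.
Proof.
have mw : measurable_fun setT (w m y).
  by apply: continuous_measurable_rV; apply: continuous_decay_weight; exact: pow2_gt0.
have mav i : measurable_fun setT (fun x => a i * (v m y i x)%:E)%E.
  by apply: measurable_funeM; apply/measurable_EFinP; exact: mv.
apply: (@le_trans _ _ (\int[lebn]_x zsum (fun i => a i * (v m y i x)%:E)))%E.
  apply: ae_ge0_le_integral => //.
  - by move=> x _; rewrite mule_ge0// lee_fin decay_weight_ge0// pow2_gt0.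
  - by apply: emeasurable_funM => //; apply/measurable_EFinP.
  - by move=> x _; apply: zsum_ge0 => i; rewrite mule_ge0 ?lee_fin.
  - by apply: measurable_zsum => // i x _; rewrite mule_ge0 ?lee_fin.
  - apply: negligibleS null_negligible => x /= /not_implyP[_]; apply: contra_notP.
    exact: pointwise.
rewrite ge0_integral_zsum//; last by move=> i x _; rewrite mule_ge0 ?lee_fin.
rewrite -zsumZ//; last 2 first.
- by rewrite lee_fin pow2_ge0.
- by move=> i; rewrite mule_ge0 ?lee_fin ?majorant_ge0.
apply: le_zsum => i.
have mvE : measurable_fun setT (fun x : E => (v m y i x)%:E) by apply/measurable_EFinP; exact: mv.
rewrite (@ge0_integralZl _ _ _ lebn setT measurableT _ mvE)//; last by move=> x _; rewrite lee_fin.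
rewrite muleA -EFinM muleC; apply: lee_wpmul2r => //; exact: int_v.
Qed.

End weighted_average.

(** * Band-limited functions are averages of themselves *)

Section majorant.
Variables (R : realType) (n : nat).
Hypothesis n_gt0 : (0 < n)%N.
Local Notation lebn := (lebesgue_rV R n).

(** The factor [2 ^ (- d t)] eats up the growth of the majorant at negative [d] as
    long as [t] is below the dimension. *)
Lemma majorant_decay (t : R) (d : int) : 0 <= t ->
  pow2 (- (d%:~R * t)) * majorant R n d <= decay (Num.min 1 (n%:R - t)) d.
Proof.
move=> t0; rewrite /majorant /decay; case: ifPn => d0; rewrite -pow2D ler_pow2E.
  have d0' : 0 <= d%:~R :> R by rewrite ler0z.
  rewrite ger0_norm// (@le_trans _ _ (- d%:~R))//.
    by rewrite gerDr oppr_le0 mulr_ge0.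
  by rewrite lerN2 ler_piMl// ge_min lexx.
rewrite -ltNge in d0; have d0' : d%:~R < 0 :> R by rewrite ltrz0.
rewrite ltr0_norm// rmorphN/= mulrN opprK.
rewrite (_ : _ + _ = (n%:R - t) * d%:~R); last by ring.
by rewrite ler_wnM2r ?ge_min ?lexx ?orbT// ltW.
Qed.

Lemma zsum_majorant : exists2 C : R, 0 < C &
  forall m, (zsum (fun i => (majorant R n (i - m))%:E) <= C%:E)%E.
Proof.
have [C C0 CP] := @zsum_decay R 1 ltr01; exists C => // m.
apply: le_trans (CP m); apply: le_zsum => i.
rewrite lee_fin; have := majorant_decay (i - m) (lexx 0).
rewrite mulr0 oppr0 pow20 mul1r addr0 => /le_trans; apply.
rewrite /decay ler_pow2E lerN2 ler_wpM2r ?ler0z//.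
by rewrite le_min lexx ler1n.
Qed.

Lemma integral_decay_weight_bounded : exists2 C : R, 0 < C &
  forall m (y : 'rV[R]_n), (\int[lebn]_x (decay_weight (pow2 m%:~R) y x)%:E <= C%:E)%E.
Proof.
have [C C0 CP] := zsum_majorant.
exists (pow2 (2 * n.+1%:R) * C); first by rewrite mulr_gt0// pow2_gt0.
move=> m y.
have t1 : tail_le lebn n%:R (cst 1%E) (cst 1%E).
  move=> k; rewrite (_ : [set _ | _] = set0) ?measure0 ?lee_fin ?pow2_ge0//.
  by apply/seteqP; split => x //=; rewrite ltxx.
have := @integral_decay_weight_le R n n_gt0 (cst 1%E) (cst 1%E) (measurable_cst _)
  (fun=> lee01) (fun=> lee01) t1 m y.
under eq_integral do rewrite mul1e.
move=> /le_trans; apply; rewrite EFinM; apply: lee_wpmul2l; first by rewrite lee_fin pow2_ge0.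
by apply: le_trans (CP m); apply: le_zsum => i; rewrite mule1.
Qed.

End majorant.

Section reproducing.
Variables (R : realType) (n : nat) (kap : R -> R) (c a0 : R).
Hypotheses (n_gt0 : (0 < n)%N) (c0 : 0 < c) (a00 : 0 <= a0) (Sk : schwartz1 kap).
Hypothesis plateau : forall xi al, `|xi| <= a0 ->
  \int[@lebesgue_measure R]_x (kap x * cos (x * xi + al)) = c * cos al.
Local Notation E := 'rV[R]_n.
Local Notation lebn := (lebesgue_rV R n).
Local Notation psi k y := (@approx_id R n kap c (pow2 k%:~R) y).

Let w (m : int) (y x : E) := decay_weight (pow2 m%:~R) y x.

Let w0 m y x : 0 <= w m y x. Proof. by apply: decay_weight_ge0; exact: pow2_gt0. Qed.

Let mw m y : measurable_fun setT (w m y).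
Proof.
by apply: continuous_measurable_rV; apply: continuous_decay_weight; exact: pow2_gt0.
Qed.

Lemma integral_approx_id k y : \int[lebn]_x psi k y x = 1.
Proof.
have := @integral_approx_id_cos R n kap c a0 c0 Sk plateau (pow2 k%:~R) y 0 0 (pow2_gt0 _).
rewrite addr0; have d0 (x : E) : dot x 0 = 0 by rewrite /dot big1// => i _; rewrite mxE mulr0.
rewrite d0 cos0 => h; transitivity (\int[lebn]_x (psi k y x * cos (dot x 0 + 0))).
  by apply: eq_Rintegral => x _; rewrite d0 addr0 cos0 mulr1.
by apply: h => i; rewrite mxE mulr0 normr0.
Qed.

(** Away from the centre a narrow weight is a small multiple of a wide one. *)
Lemma decay_weight_far (e e0 rho : R) (y x : E) : 0 < e -> 0 < e0 -> 0 < rho ->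
  rho <= `|x - y| ->
  decay_weight e y x <= e / e0 * ((e0 + rho) / rho) ^+ n.+1 * decay_weight e0 y x.
Proof.
move=> ep e0p rp; rewrite /decay_weight; set d := `|x - y| => rd.
have dp : 0 < d by exact: lt_le_trans rd.
rewrite (@le_trans _ _ (e / d ^+ n.+1))//.
  rewrite ler_wpM2l ?(ltW ep)// lef_pV2 ?posrE ?exprn_gt0 ?addr_gt0//.
  by apply: lerXn2r; rewrite ?nnegrE ?addr_ge0 ?(ltW ep) ?(ltW dp)// lerDr ltW.
have -> : e / e0 * ((e0 + rho) / rho) ^+ n.+1 * (e0 / (e0 + d) ^+ n.+1) =
    e * (((e0 + rho) / rho) / (e0 + d)) ^+ n.+1.
  rewrite [in RHS]exprMn exprVn; have h : (e0 + d) ^+ n.+1 != 0.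
    by rewrite expf_neq0// gt_eqF// addr_gt0.
  by move: (_ ^+ n.+1) ((e0 + d) ^+ n.+1) h => X Y Y0; field; rewrite Y0 gt_eqF.
rewrite ler_wpM2l ?(ltW ep)// -exprVn; apply: lerXn2r; rewrite ?nnegrE ?invr_ge0 ?(ltW dp)//.
  by rewrite !divr_ge0 ?addr_ge0 ?(ltW rp) ?(ltW e0p) ?(ltW dp).
rewrite ler_pdivlMr ?addr_gt0// mulrC ler_pdivrMr// mulrAC ler_pdivlMr//.
by rewrite !mulrDl [rho * d]mulrC lerD2r ler_wpM2l// ltW.
Qed.

(** The averages [I] over all scales up to [m] agree, and converge to [g y] as the
    scale tends to zero, so that [g y = I]; and at scale [m] the average is bounded
    by the weighted integral of [g].  The function may grow: far from [y] the
    narrow weights are dominated by the one at scale [m], against which [g] may be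
    assumed to be integrable. *)
Lemma average_reproduces : exists2 C : R, 0 < C & forall (g : E -> R) (y : E) (m : int) (I : R),
  continuous g ->
  (forall k : int, k <= m ->
    lebn.-integrable setT (EFin \o (fun x => g x * psi k y x)) /\
    \int[lebn]_x (g x * psi k y x) = I) ->
  (`|g y|%:E <= C%:E * \int[lebn]_x (`|g x|%:E * (w m y x)%:E))%E.
Proof.
have [C C0 CP] := @approx_id_decay R n kap c n_gt0 c0 Sk.
have [C2 C20 C2P] := integral_decay_weight_bounded R n_gt0.
exists C => // g y m I cg gI.
have mg : measurable_fun setT g := continuous_measurable_rV cg.
have mgw k : measurable_fun setT (fun x => `|g x|%:E * (w k y x)%:E)%E.
  by apply: emeasurable_funM; apply/measurable_EFinP => //; exact: measurableT_comp.
have gw0 k x : (0 <= `|g x|%:E * (w k y x)%:E)%E by rewrite mule_ge0 ?lee_fin.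
set S := (\int[lebn]_x _)%E.
have S0 : (0 <= S)%E by exact: integral_ge0.
have : (S = +oo \/ S \is a fin_num)%E by move: S0; case: (S) => [r|//|//] _; [right|left].
move=> [->|Sfin]; first by rewrite gt0_muley ?lte_fin// leey.
rewrite -(fineK Sfin) -EFinM lee_fin; set s := fine S.
have s0 : 0 <= s by rewrite fine_ge0.
have psiw k x : `|psi k y x| <= C * w k y x by apply: CP; exact: pow2_gt0.
have Is : `|I| <= C * s.
  have [i1 <-] := gI m (lexx m).
  rewrite (le_trans (le_normr_Rintegral _ i1))// -lee_fin /Rintegral fineK; last first.
    exact: (integrable_fin_num measurableT (integrable_norm i1)).
  rewrite EFinM fineK// -ge0_integralZl// ?lee_fin ?(ltW C0)//.
  apply: ge0_le_integral => //.
  - by apply/measurable_EFinP; apply: measurableT_comp => //; apply/measurable_EFinP; exact: measurable_int i1.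
  - exact: measurable_funeM.
  - by move=> x _; rewrite -!EFinM lee_fin normrM mulrCA ler_wpM2l.
suff -> : g y = I by [].
apply/eqP; rewrite -subr_eq0 -normr_le0; apply/ler_addgt0Pl => d d0; rewrite addr0.
pose delta := d / (C * C2 + 1).
have CC : 0 < C * C2 + 1 by rewrite ltr_wpDl// mulr_ge0// ltW.
have delta0 : 0 < delta by rewrite divr_gt0.
have [rho rho0 rhoP] : exists2 rho, 0 < rho & cube y rho `<=` [set x | `|g x - g y| < delta].
  apply: nbhs_cube; have /cvgrPdist_lt/(_ _ delta0) := cg y.
  by apply: filterS => x; rewrite distrC.
have e0 := pow2_gt0 (m%:~R : R).
pose K := C * ((pow2 m%:~R + rho) / rho) ^+ n.+1.
have K0 : 0 <= K by rewrite mulr_ge0 ?(ltW C0)// exprn_ge0// divr_ge0 ?addr_ge0 ?ltW.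
pose X := K * (s + `|g y| * C2).
have X0 : 0 <= X by apply: (mulr_ge0 K0); rewrite addr_ge0 ?mulr_ge0 ?(ltW C20).
have [k km kX] : exists2 k : int, k <= m & pow2 k%:~R / pow2 m%:~R * X <= delta.
  have X1 : 0 < delta / (X + delta) by rewrite divr_gt0// ltr_wpDl.
  have [k kP] := pow2_lt_ex (@ltr01 R) X1.
  exists (Num.min m (m + k)); first by rewrite ge_min lexx.
  rewrite -pow2N -pow2D -rmorphB/= (@le_trans _ _ (delta / (X + delta) * X))//.
    rewrite ler_wpM2r// (le_trans _ (ltW kP))// ler_pow2E mulr1 ler_int.
    by rewrite lerBlDr addrC ge_min lexx orbT.
  by rewrite mulrAC ler_pdivrMr ?ltr_wpDl// ler_wpM2l ?(ltW delta0)// lerDl ltW.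
have [ik <-] := gI k km.
have ip : lebn.-integrable setT (EFin \o psi k y).
  by apply: integrable_approx_id => //; exact: pow2_gt0.
have ipZ : lebn.-integrable setT (EFin \o (fun x => g y * psi k y x)).
  exact: (integrableZl measurableT (g y) ip).
have -> : g y - \int[lebn]_x (g x * psi k y x) =
    - \int[lebn]_x (g x * psi k y x - g y * psi k y x).
  by rewrite RintegralB// RintegralZl// integral_approx_id mulr1 opprB.
have iB : lebn.-integrable setT (EFin \o (fun x => g x * psi k y x - g y * psi k y x)).
  exact: (integrableB measurableT ik ipZ).
rewrite normrN (le_trans (le_normr_Rintegral _ iB))// -lee_fin /Rintegral fineK; last first.
  exact: (integrable_fin_num measurableT (integrable_norm iB)).
(* Near [y] the oscillation of [g] is at most [delta]; elsewhere the first factor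
   of the second term makes the contribution small. *)
pose B x := ((delta * C)%:E * (w k y x)%:E + (pow2 k%:~R / pow2 m%:~R * K)%:E *
  (`|g x|%:E * (w m y x)%:E + `|g y|%:E * (w m y x)%:E))%E.
have mwE j : measurable_fun setT (fun x => (w j y x)%:E) by apply/measurable_EFinP; exact: mw.
have wE0 j x : (0 <= (w j y x)%:E)%E by rewrite lee_fin.
have kmK : 0 <= pow2 k%:~R / pow2 m%:~R * K by rewrite mulr_ge0// divr_ge0 ?pow2_ge0.
have dC : 0 <= delta * C by rewrite mulr_ge0 ?ltW.
have b1 x : (0 <= (delta * C)%:E * (w k y x)%:E)%E by rewrite mule_ge0 ?lee_fin.
have mb1 : measurable_fun setT (fun x => (delta * C)%:E * (w k y x)%:E)%E by exact: measurable_funeM.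
have b3 x : (0 <= `|g y|%:E * (w m y x)%:E)%E by rewrite mule_ge0 ?lee_fin.
have mb3 : measurable_fun setT (fun x => `|g y|%:E * (w m y x)%:E)%E by exact: measurable_funeM.
have b2 x : (0 <= `|g x|%:E * (w m y x)%:E + `|g y|%:E * (w m y x)%:E)%E by exact: adde_ge0.
have mb2 := emeasurable_funD (mgw m) mb3.
have b4 x : (0 <= (pow2 k%:~R / pow2 m%:~R * K)%:E *
    (`|g x|%:E * (w m y x)%:E + `|g y|%:E * (w m y x)%:E))%E.
  by apply: mule_ge0; [rewrite lee_fin|exact: b2].
have mb4 : measurable_fun setT (fun x => (pow2 k%:~R / pow2 m%:~R * K)%:E *
    (`|g x|%:E * (w m y x)%:E + `|g y|%:E * (w m y x)%:E))%E by exact: measurable_funeM.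
apply: (@le_trans _ _ (\int[lebn]_x B x)%E).
  apply: ge0_le_integral => //.
  - by apply/measurable_EFinP; apply: measurableT_comp => //; apply/measurable_EFinP; exact: measurable_int iB.
  - exact: emeasurable_funD.
  move=> x _; have -> : B x = (delta * C * w k y x + pow2 k%:~R / pow2 m%:~R * K *
      (`|g x| * w m y x + `|g y| * w m y x))%:E by [].
  rewrite lee_fin -mulrBl normrM.
  rewrite (le_trans (ler_wpM2l _ (psiw k x)))//.
  have [xy|xy] := leP `|x - y| rho.
    have /rhoP/= h : cube y rho x by rewrite cube_norm// ltW.
    rewrite mulrA; apply: ler_wpDr.
      by apply: (mulr_ge0 kmK); rewrite addr_ge0// mulr_ge0.
    by rewrite ler_wpM2r// ler_wpM2r ?(ltW C0)// ltW.
  apply: ler_wpDl; first exact: (mulr_ge0 dC).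
  rewrite (@le_trans _ _ ((`|g x| + `|g y|) * (C *
      (pow2 k%:~R / pow2 m%:~R * ((pow2 m%:~R + rho) / rho) ^+ n.+1 * w m y x))))//.
    apply: (ler_pM (normr_ge0 _) (mulr_ge0 (ltW C0) (w0 _ _ _)) (ler_normB _ _)).
    rewrite ler_wpM2l ?(ltW C0)//; apply: decay_weight_far => //; [exact: pow2_gt0|exact: ltW].
  rewrite /K -mulrDl; move: (_ ^+ n.+1) (_ / pow2 m%:~R) => u v.
  by rewrite le_eqVlt; apply/orP; left; apply/eqP; ring.
have -> : (\int[lebn]_x B x = (delta * C)%:E * \int[lebn]_x (w k y x)%:E +
    (pow2 k%:~R / pow2 m%:~R * K)%:E * (S + `|g y|%:E * \int[lebn]_x (w m y x)%:E))%E.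
  rewrite (@ge0_integralD _ _ _ lebn setT measurableT _ _ (fun x _ => b1 x) mb1 (fun x _ => b4 x) mb4).
  rewrite (@ge0_integralZl _ _ _ lebn setT measurableT _ (mwE k))// ?lee_fin//.
  rewrite (@ge0_integralZl _ _ _ lebn setT measurableT _ mb2)// ?lee_fin//.
  rewrite (@ge0_integralD _ _ _ lebn setT measurableT _ _ (fun x _ => gw0 m x) (mgw m) (fun x _ => b3 x) mb3).
  by rewrite (@ge0_integralZl _ _ _ lebn setT measurableT _ (mwE m)).
apply: (@le_trans _ _ ((delta * C)%:E * C2%:E +
    (pow2 k%:~R / pow2 m%:~R * K)%:E * (s%:E + `|g y|%:E * C2%:E))%E).
  apply: leeD; apply: lee_wpmul2l; rewrite ?lee_fin//; first exact: C2P.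
  by rewrite /s fineK//; apply: leeD2l; apply: lee_wpmul2l; rewrite ?lee_fin//; exact: C2P.
have -> : ((delta * C)%:E * C2%:E + (pow2 k%:~R / pow2 m%:~R * K)%:E *
    (s%:E + `|g y|%:E * C2%:E) = (delta * C * C2 + pow2 k%:~R / pow2 m%:~R * K * (s + `|g y| * C2))%:E)%E by [].
rewrite lee_fin -[delta * C * C2]mulrA -[X in _ + X]mulrA -/X.
rewrite (@le_trans _ _ (delta * (C * C2) + delta))// ?lerD2l//.
by rewrite -[X in _ + X]mulr1 -mulrDr /delta divfK// gt_eqF.
Qed.

End reproducing.

(** * Pointwise bounds on the dyadic blocks *)

Section complex_modulus.
Variable R : realType.
Implicit Types z : R[i].

Lemma cmod_ge0 z : 0 <= cmod z.
Proof. by case: z => x y; exact: sqrtr_ge0. Qed.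

Lemma cmod0 : cmod (0 : R[i]) = 0.
Proof. by rewrite /cmod/= expr0n/= addr0 sqrtr0. Qed.

Lemma Re_le_cmod z : `|complex.Re z| <= cmod z.
Proof. by case: z => x y; rewrite /cmod/= -sqrtr_sqr ler_wsqrtr// lerDl sqr_ge0. Qed.

Lemma Im_le_cmod z : `|complex.Im z| <= cmod z.
Proof. by case: z => x y; rewrite /cmod/= -sqrtr_sqr ler_wsqrtr// lerDr sqr_ge0. Qed.

Lemma cmod_le_ReIm z : cmod z <= `|complex.Re z| + `|complex.Im z|.
Proof.
case: z => x y; rewrite /cmod/= -(ler_pXn2r (n := 2)) ?nnegrE ?sqrtr_ge0 ?addr_ge0//.
rewrite sqr_sqrtr ?addr_ge0 ?sqr_ge0// sqrrD -(real_normK (num_real x)) -(real_normK (num_real y)).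
by rewrite -addrA lerD2l lerDr mulrn_wge0// mulr_ge0.
Qed.

End complex_modulus.

Section dyadic_bound.
Variables (R : realType) (n : nat).
Hypothesis n_gt0 : (0 < n)%N.
Variable phi : int -> 'rV[R]_n -> R[i].
Hypothesis hphi : dyadic_partition phi.
Local Notation E := 'rV[R]_n.
Local Notation lebn := (lebesgue_rV R n).

Lemma exists_plateau_kernel : exists (kap : R -> R) (c : R),
  [/\ 0 < c, schwartz1 kap & forall xi al, `|xi| <= 16 ->
    \int[@lebesgue_measure R]_x (kap x * cos (x * xi + al)) = c * cos al].
Proof.
have [d [jd fd d00 d10 d2]] := exists_bump n_gt0 hphi.
have A0 : 0 < 96 :> R by rewrite ltr0n.
exists (kernel1 96 d), (2 * versine_mass R); split.
- by rewrite mulr_gt0// versine_mass_gt0.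
- exact: kernel1_schwartz.
- by move=> xi al; exact: kernel1_integral.
Qed.

Lemma coord_le_enorm (x : E) i : `|x ord0 i| <= enorm x.
Proof.
rewrite -sqrtr_sqr ler_wsqrtr// /dot (bigD1 i)//= -expr2 lerDl.
by apply: sumr_ge0 => j _; rewrite -expr2 sqr_ge0.
Qed.

Lemma continuous_dist_function (u : (E -> R[i]) -> R[i]) : ccontinuous (dist_function u).
Proof.
rewrite /dist_function; case: xgetP => [g _ [cg _]//|_].
by split => x; exact: cst_continuous.
Qed.

Lemma measurable_cmod_block j f :
  measurable_fun setT (fun x => cmod (dyadic_block phi j f x)).
Proof.
have [cR cI] := continuous_dist_function
  (dist_invfourier (dist_mul (phi j) (dist_fourier (extension f)))).
rewrite -/(dyadic_block phi j f) in cR cI.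
have -> : (fun x => cmod (dyadic_block phi j f x)) = (fun x =>
    Num.sqrt (cRe (dyadic_block phi j f) x ^+ 2 + cIm (dyadic_block phi j f) x ^+ 2)).
  by apply/funext => x; rewrite /cRe /cIm; case: (dyadic_block _ _ _ _).
apply: measurableT_comp; first by apply: continuous_measurable_fun; exact: sqrt_continuous.
by apply: measurable_funD; apply: measurable_funX; exact: continuous_measurable_rV.
Qed.

(** The values of a dyadic block are weighted averages of its modulus: tested
    against the approximate identities of scale at most the inverse frequency,
    the block always gives the same number. *)
Lemma block_le_average : exists2 C : R, 0 < C & forall f j y,
  ((cmod (dyadic_block phi j f y))%:E <= C%:E * \int[lebn]_x
    ((cmod (dyadic_block phi j f x))%:E * (decay_weight (pow2 (- j)%:~R) y x)%:E))%E.
Proof.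
have [kap [c [c0 Sk plateau]]] := exists_plateau_kernel.
have [C C0 CP] := average_reproduces n_gt0 c0 (ler0n R 16) Sk plateau.
exists (C *+ 2); first by rewrite mulrn_wgt0.
move=> f j y; set u := dist_invfourier (dist_mul (phi j) (dist_fourier (extension f))).
set w := decay_weight (pow2 (- j)%:~R) y.
have w0 x : 0 <= w x by apply: decay_weight_ge0; exact: pow2_gt0.
have mw : measurable_fun setT w.
  by apply: continuous_measurable_rV; apply: continuous_decay_weight; exact: pow2_gt0.
have mg : measurable_fun setT (fun x => cmod (dyadic_block phi j f x)) by exact: measurable_cmod_block.
move: mg; rewrite /dyadic_block -/u /dist_function.
(* A distribution that is not given by a continuous function counts as zero. *)
case: xgetP => [g _ [[cR cI] rep] mg|_ _]; last first.
  by rewrite cmod0 integral0_eq ?mule0// => x _; rewrite mul0e.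
(* The value of the block paired with a kernel centred at [z]; it will not depend
   on the width. *)
pose v (z : E) := extension f (fourier (fun x => phi j x * cis (2 * pi * dot x z))).
have test k : k <= - j -> let psi := approx_id kap c (pow2 k%:~R) y in
    cintegrable (fun x => g x * (psi x)%:C%C) /\ cintegral (fun x => g x * (psi x)%:C%C) = v y.
  move=> kj psi; have [ig <-] := rep _ (@approx_id_schwartz R n kap c Sk (pow2 k%:~R) y (pow2_gt0 _)).
  split => //; rewrite /u /dist_invfourier /dist_mul /dist_fourier /v.
  congr (extension f (fourier _)); apply/funext => x.
  have [phx|phx] := eqVneq (phi j x) 0; first by rewrite phx !mul0r.
  rewrite (invfourier_approx_id c0 Sk plateau)//; first exact: pow2_gt0.
  move=> i; have hx : enorm x <= 2 ^ (j + 1).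
    by apply: contraNT phx => hx; rewrite dyadic_support// negb_and hx orbT.
  (* The frequency is at most [2 ^ (j + 1)] and the width at most [2 ^ (- j)]; times
   [2 pi] this stays below 16. *)
have xi2 : pow2 k%:~R * `|x ord0 i| <= 2.
    rewrite (@le_trans _ _ (pow2 k%:~R * pow2 (j + 1)%:~R))//.
      by rewrite ler_wpM2l ?pow2_ge0// (le_trans (coord_le_enorm _ _))// pow2_int.
    rewrite -pow2D -intrD -[leRHS](powRr1 (ler0n R 2)) ler_pow2E -[1]/(1%:~R) ler_int; lia.
  rewrite !normrM (gtr0_norm (pow2_gt0 _)) (gtr0_norm (pi_gt0 R)) ger0_norm//.
  have pi4 : pi <= 4 :> R by have /andP[_ /ltW] := pihalf_02 R; lra.
  rewrite mulrCA (@le_trans _ _ (2 * 4 * 2))//.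
    by apply: ler_pM => //; rewrite ?mulr_ge0 ?pow2_ge0 ?pi_ge0// ler_wpM2l.
  by rewrite -!natrM.
have bR : (`|cRe g y|%:E <= C%:E * \int[lebn]_x (`|cRe g x|%:E * (w x)%:E))%E.
  apply: (CP _ _ _ (complex.Re (v y))) => // k kj; have [[iR _] <-] := test k kj.
  have E x : cRe (fun x => g x * (approx_id kap c (pow2 k%:~R) y x)%:C%C) x =
      cRe g x * approx_id kap c (pow2 k%:~R) y x.
    by rewrite /cRe; case: (g x) => a b /=; rewrite mulr0 subr0.
  split; last by rewrite /cintegral/=; apply: eq_Rintegral => x _; rewrite E.
  by move: iR; congr (integrable _ _ _); apply/funext => x; rewrite /= E.
have bI : (`|cIm g y|%:E <= C%:E * \int[lebn]_x (`|cIm g x|%:E * (w x)%:E))%E.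
  apply: (CP _ _ _ (complex.Im (v y))) => // k kj; have [[_ iI] <-] := test k kj.
  have E x : cIm (fun x => g x * (approx_id kap c (pow2 k%:~R) y x)%:C%C) x =
      cIm g x * approx_id kap c (pow2 k%:~R) y x.
    by rewrite /cIm; case: (g x) => a b /=; rewrite mulr0 add0r.
  split; last by rewrite /cintegral/=; apply: eq_Rintegral => x _; rewrite E.
  by move: iI; congr (integrable _ _ _); apply/funext => x; rewrite /= E.
have part (h : E -> R) : continuous h -> (forall x, `|h x| <= cmod (g x)) ->
    (\int[lebn]_x (`|h x|%:E * (w x)%:E) <= \int[lebn]_x ((cmod (g x))%:E * (w x)%:E))%E.
  move=> ch hg; apply: ge0_le_integral => //.
  - by move=> x _; rewrite mule_ge0 ?lee_fin.
  - apply: emeasurable_funM; apply/measurable_EFinP => //.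
    by apply: measurableT_comp => //; exact: continuous_measurable_rV.
  - by apply: emeasurable_funM; apply/measurable_EFinP.
  - by move=> x _; apply: lee_wpmul2r; rewrite lee_fin.
apply: (@le_trans _ _ (`|cRe g y|%:E + `|cIm g y|%:E)%E).
  by rewrite -EFinD lee_fin; exact: cmod_le_ReIm.
rewrite mulr2n [X in (_ <= X * _)%E]EFinD ge0_muleDl ?lee_fin ?(ltW C0)//; apply: leeD.
  apply: (le_trans bR); apply: lee_wpmul2l; first by rewrite lee_fin ltW.
  by apply: part => // x; exact: Re_le_cmod.
apply: (le_trans bI); apply: lee_wpmul2l; first by rewrite lee_fin ltW.
by apply: part => // x; exact: Im_le_cmod.
Qed.

(** The block of index [j] lives at the scale [2 ^ (- j)], whence [i + j] as the
    argument of the majorant. *)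
Lemma block_le_levels : exists2 C : R, 0 < C &
  forall f s (G : E -> \bar R) (a : int -> \bar R),
  measurable_fun setT G -> (forall k, (0 <= a k)%E) -> tail_le lebn n%:R G a ->
  (forall j x, ((pow2 (j%:~R * s) * cmod (dyadic_block phi j f x))%:E <= G x)%E) ->
  forall j y, ((pow2 (j%:~R * s) * cmod (dyadic_block phi j f y))%:E <=
    C%:E * zsum (fun i => (majorant R n (i + j))%:E * a i))%E.
Proof.
have [C C0 CP] := block_le_average.
exists (C * pow2 (2 * n.+1%:R)); first by rewrite mulr_gt0// pow2_gt0.
move=> f s G a mG a0 tG hG j y.
have G0 x : (0 <= G x)%E.
  by apply: le_trans (hG 0 x); rewrite lee_fin mulr_ge0 ?cmod_ge0 ?pow2_ge0.
have w0 x : 0 <= decay_weight (pow2 (- j)%:~R) y x by apply: decay_weight_ge0; exact: pow2_gt0.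
have mw : measurable_fun setT (decay_weight (pow2 (- j)%:~R) y).
  by apply: continuous_measurable_rV; apply: continuous_decay_weight; exact: pow2_gt0.
have mI : measurable_fun setT (fun x => (cmod (dyadic_block phi j f x))%:E *
    (decay_weight (pow2 (- j)%:~R) y x)%:E)%E.
  by apply: emeasurable_funM; apply/measurable_EFinP => //; exact: measurable_cmod_block.
have := integral_decay_weight_le n_gt0 mG G0 a0 tG (- j) y.
under eq_zsum do rewrite opprK.
move=> hav; rewrite [X in (_ <= X * _)%E]EFinM -muleA.
apply: le_trans (lee_wpmul2l _ hav); last by rewrite lee_fin ltW.
rewrite EFinM; apply: le_trans (lee_wpmul2l _ (CP f j y)) _; first by rewrite lee_fin pow2_ge0.
rewrite muleCA; apply: lee_wpmul2l; first by rewrite lee_fin ltW.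
rewrite -ge0_integralZl//; last 2 first.
- by move=> x _; rewrite mule_ge0 ?lee_fin ?cmod_ge0.
- by rewrite lee_fin pow2_ge0.
apply: ge0_le_integral => //.
- by move=> x _; rewrite !mule_ge0 ?lee_fin ?cmod_ge0 ?pow2_ge0.
- exact: measurable_funeM.
- by apply: emeasurable_funM => //; apply/measurable_EFinP.
- by move=> x _; rewrite muleA; apply: lee_wpmul2r; [rewrite lee_fin|rewrite -EFinM; exact: hG].
Qed.

End dyadic_bound.

(** * Interpolation of the levels *)

Section smear.
Variable R : realType.
Local Open Scope ereal_scope.
Implicit Types (u v : int -> \bar R) (g : R).

Definition smear g u : int -> \bar R :=
  fun k => zsum (fun i => (decay g (i - k))%:E * u i).

Lemma smear_ge0 g u k : (forall j, 0 <= u j) -> 0 <= smear g u k.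
Proof. by move=> u0; apply: zsum_ge0 => i; rewrite mule_ge0 ?lee_fin ?decay_ge0. Qed.

Lemma smear_ge g u k : (forall j, 0 <= u j) -> u k <= smear g u k.
Proof.
move=> u0; have := @zsum_ge_term _ (fun i => (decay g (i - k))%:E * u i) k.
rewrite subrr decay0 mul1e; apply=> j.
by rewrite mule_ge0 ?lee_fin ?decay_ge0.
Qed.

Lemma decay_anti (g g' : R) (d : int) : (g' <= g)%R -> (decay g d <= decay g' d)%R.
Proof. by move=> gg; rewrite ler_pow2E lerN2 ler_wpM2r// ler0z. Qed.

Lemma smear_anti g g' u k : (g' <= g)%R -> (forall j, 0 <= u j) -> smear g u k <= smear g' u k.
Proof.
move=> gg u0; apply: le_zsum => i; apply: lee_wpmul2r => //.
by rewrite lee_fin decay_anti.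
Qed.

(** The form in which minima of two geometric sequences occur between two endpoints
    of an interpolation that differ by [delta], of either sign. *)
Lemma zsum_two_sided (delta t : R) : delta != 0%R -> (0 < t < 1)%R ->
  exists2 C : R, (0 < C)%R & forall A B : \bar R, 0 <= A -> 0 <= B ->
  zsum (fun j => mine ((pow2 (j%:~R * (t * delta)))%:E * A)
                      ((pow2 (- (j%:~R * ((1 - t) * delta))))%:E * B)) <=
  C%:E * (A `^ (1 - t) * B `^ t).
Proof.
move=> d0 /andP[t0 t1]; have t1' : (0 < 1 - t)%R by rewrite subr_gt0.
have s : (t * delta + (1 - t) * delta = delta)%R by ring.
have e1 : ((1 - t) * delta / (t * delta + (1 - t) * delta) = 1 - t)%R by rewrite s mulfK.
have e2 : (t * delta / (t * delta + (1 - t) * delta) = t)%R by rewrite s mulfK.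
have [dp|dn] := ltP 0%R delta.
  have := zsum_min_geometric (mulr_gt0 t0 dp) (mulr_gt0 t1' dp).
  by rewrite e1 e2.
have dn' : (delta < 0)%R by rewrite lt_neqAle d0.
have n1 : (t * delta < 0)%R by rewrite pmulr_rlt0.
have n2 : ((1 - t) * delta < 0)%R by rewrite pmulr_rlt0.
have := zsum_min_geometric_neg n1 n2.
by rewrite e1 e2.
Qed.

End smear.

Section levels.
Context d (T : measurableType d) (R : realType).
Variables (mu : {measure set T -> \bar R}) (n : nat).
Hypothesis n_gt0 : (0 < n)%N.
Local Notation nu := (n%:R : R).
Local Open Scope ereal_scope.
Implicit Types (F : int -> T -> R) (a b : int -> \bar R).

Let nu0 : (0 < nu)%R. Proof. by rewrite ltr0n. Qed.

Definition tl_function (s : R) (r : \bar R) F (x : T) : \bar R :=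
  lq r (fun j => (pow2 (j%:~R * s) * F j x)%:E).

Section positive_sequence.
Variable F : int -> T -> R.
Hypotheses (mF : forall j, measurable_fun setT (F j)) (F0 : forall j x, (0 <= F j x)%R).

Lemma tl_term_ge0 s j x : 0 <= (pow2 (j%:~R * s) * F j x)%:E.
Proof. by rewrite lee_fin mulr_ge0 ?pow2_ge0. Qed.

Lemma tl_function_ge0 s r x : 0 <= tl_function s r F x.
Proof. by apply: lq_ge0 => j; exact: tl_term_ge0. Qed.

Lemma tl_term_le s r j x : 1 <= r -> (pow2 (j%:~R * s) * F j x)%:E <= tl_function s r F x.
Proof.
move=> r1; apply: (@lq_ge_term _ r (fun j => (pow2 (j%:~R * s) * F j x)%:E)) => // i.
exact: tl_term_ge0.
Qed.

Lemma tl_function_le_sum s r x : 1 <= r ->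
  tl_function s r F x <= zsum (fun j => (pow2 (j%:~R * s) * F j x)%:E).
Proof.
move=> r1; rewrite -lq1; last by move=> j; exact: tl_term_ge0.
by apply: lq_nested => // j; exact: tl_term_ge0.
Qed.

Lemma measurable_tl_function s r : measurable_fun setT (tl_function s r F).
Proof.
have mt j : measurable_fun setT (fun x => (pow2 (j%:~R * s) * F j x)%:E).
  by apply/measurable_EFinP; exact: measurable_funM.
rewrite /tl_function; case: r => [r| |] /=; last exact: measurable_cst.
  apply: (measurableT_comp (@measurable_poweR R _)).
  apply: measurable_zsum => // [k|k x _]; last by rewrite lee_fin powR_ge0.
  exact: (measurableT_comp (@measurable_poweR R r) (mt k)).
have := measurable_fun_esups (f := fun i x => (pow2 ((nat_to_int i)%:~R * s) * F (nat_to_int i) x)%:E)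
  (fun i => mt (nat_to_int i)) 0%N.
congr measurable_fun; apply/funext => x; rewrite /esups; congr ereal_sup.
apply/seteqP; split => [_ [i _ <-]|_ [j _ <-]]; first by exists (nat_to_int i).
have [_ _ /(_ j I)[i _ <-]] := nat_to_int_bij.
by exists i.
Qed.

End positive_sequence.

Lemma tail_le_mono (f : T -> \bar R) a b : measurable_fun setT f ->
  (forall k, a k <= b k) -> tail_le mu nu f a -> tail_le mu nu f b.
Proof.
move=> mf ab tf k; apply: le_trans (tf k); apply: le_measure; rewrite ?inE.
- by rewrite -[X in measurable X]setTI; exact: emeasurable_fun_o_infty.
- by rewrite -[X in measurable X]setTI; exact: emeasurable_fun_o_infty.
- by move=> x /=; exact: le_lt_trans.
Qed.

(** Two exceptional sets together have at most the measure allowed at the next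
    level. *)
Lemma tail_le_two (f g h : T -> \bar R) a b c :
  measurable_fun setT f -> measurable_fun setT g -> measurable_fun setT h ->
  tail_le mu nu g a -> tail_le mu nu h b ->
  (forall k x, g x <= a k -> h x <= b k -> f x <= c k) ->
  tail_le mu nu f (fun k => c (k - 1)%R).
Proof.
move=> mf mg mh tg th H k.
have ml (u : T -> \bar R) (e : \bar R) : measurable_fun setT u -> measurable [set x | e < u x].
  by move=> mu'; rewrite -[X in measurable X]setTI; exact: emeasurable_fun_o_infty.
apply: (@le_trans _ _ (mu ([set x | a (k - 1)%R < g x] `|` [set x | b (k - 1)%R < h x]))).
  apply: le_measure; rewrite ?inE; [exact: ml|apply: measurableU; exact: ml|].
  move=> x /= fx; have [ga|ga] := leP (g x) (a (k - 1)%R); last by left.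
  right; rewrite ltNge; apply/negP => hb.
  by move: fx; rewrite ltNge (H _ _ ga hb).
apply: (@le_trans _ _ (mu [set x | a (k - 1)%R < g x] + mu [set x | b (k - 1)%R < h x])).
  by apply: measureU2; exact: ml.
apply: le_trans (leeD (tg _) (th _)) _.
rewrite -EFinD lee_fin rmorphB/= mulrBl mul1r pow2D pow2N -mulrDr.
rewrite ler_piMr ?pow2_ge0// (_ : _ + _ = 2 / pow2 nu)%R; last by ring.
rewrite ler_pdivrMr ?pow2_gt0// mul1r.
by rewrite -[leLHS](powRr1 (ler0n R 2)) ler_pow2E ler1n.
Qed.

Lemma lq_lorentz_seq_shift (p : R) (q : \bar R) c : 1 <= q -> (forall k, 0 <= c k) ->
  lq q (lorentz_seq nu p (fun k => c (k - 1)%R)) <= (pow2 (nu / p))%:E * lq q (lorentz_seq nu p c).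
Proof.
move=> q1 c0; have l0 k : 0 <= lorentz_seq nu p c k by rewrite mule_ge0 ?lee_fin ?pow2_ge0.
apply: le_trans (lqZ q1 (pow2_ge0 _) l0).
rewrite -[leRHS](lq_shift q _ (-1)); apply: le_lq => // k.
  by rewrite mule_ge0 ?lee_fin ?pow2_ge0.
rewrite /lorentz_seq muleA -EFinM -pow2D intrD.
by rewrite (_ : (nu / p + (k%:~R + (-1)%:~R) * nu / p = k%:~R * nu / p)%R)//; ring.
Qed.

End levels.

Lemma min_shift (l j : int) : Num.min (- (l - j)) j = j - Num.max l 0.
Proof. by lia. Qed.

Section interpolation.
Context d (T : measurableType d) (R : realType).
Variables (mu : {measure set T -> \bar R}) (n : nat).
Hypothesis n_gt0 : (0 < n)%N.
Local Notation nu := (n%:R : R).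
Local Open Scope ereal_scope.
Implicit Types (F : int -> T -> R) (a b : int -> \bar R).

(** What the band limitation of the terms of [F] amounts to: control of their
    size on most of the space controls them everywhere. *)
Definition level_bounded (C : R) F := forall (s : R) (G : T -> \bar R) a,
  measurable_fun setT G -> (forall k, 0 <= a k) -> tail_le mu nu G a ->
  (forall j x, (pow2 (j%:~R * s) * F j x)%:E <= G x) ->
  forall j y, (pow2 (j%:~R * s) * F j y)%:E <=
    C%:E * zsum (fun i => (majorant R n (i + j))%:E * a i).

Definition block_sequence (C : R) F := [/\ forall j, measurable_fun setT (F j),
  forall j x, (0 <= F j x)%R & level_bounded C F].

Variables (s1 s2 p1 p2 t C0 : R) (q1 q2 r1 r2 : \bar R).
Hypotheses (p11 : (1 < p1)%R) (p21 : (1 < p2)%R) (t01 : (0 < t < 1)%R) (C00 : (0 < C0)%R).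
Hypotheses (q11 : 1 <= q1) (q21 : 1 <= q2) (r11 : 1 <= r1) (r21 : 1 <= r2).
Local Notation g := (tl_function s1 r1).
Local Notation h := (tl_function s2 r2).

Let nu0 : (0 < nu)%R. Proof. by rewrite ltr0n. Qed.
Let t0 : (0 < t)%R. Proof. by case/andP: t01. Qed.
Let t1 : (0 < 1 - t)%R. Proof. by case/andP: t01 => _; rewrite subr_gt0. Qed.
Let p10 : (0 < p1)%R. Proof. exact: lt_trans p11. Qed.
Let p20 : (0 < p2)%R. Proof. exact: lt_trans p21. Qed.

Definition mean (x y : \bar R) : \bar R := x `^ (1 - t) * y `^ t.

Lemma mean_ge0 x y : 0 <= mean x y.
Proof. by rewrite mule_ge0 ?poweR_ge0. Qed.

Lemma le_mean x y x' y' : 0 <= x -> 0 <= y -> x <= x' -> y <= y' -> mean x y <= mean x' y'.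
Proof.
move=> x0 y0 xx yy; apply: lee_pmul; rewrite ?poweR_ge0//; apply: lee_poweR => //; exact: ltW.
Qed.

Lemma meanM (u v : R) x y : (0 <= u)%R -> (0 <= v)%R -> 0 <= x -> 0 <= y ->
  mean (u%:E * x) (v%:E * y) = (u `^ (1 - t) * v `^ t)%:E * mean x y.
Proof.
by move=> u0 v0 x0 y0; rewrite /mean !poweRM ?lee_fin// EFinM !poweR_EFin muleACA.
Qed.

Lemma mean_pow2 (u v : R) : (pow2 u `^ (1 - t) * pow2 v `^ t = pow2 (u * (1 - t) + v * t))%R.
Proof. by rewrite pow2D !pow2M. Qed.

Lemma mean_term F (s : R) j x : (forall j x, (0 <= F j x)%R) -> (s = (1 - t) * s1 + t * s2)%R ->
  (pow2 (j%:~R * s) * F j x)%:E =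
  mean (pow2 (j%:~R * s1) * F j x)%:E (pow2 (j%:~R * s2) * F j x)%:E.
Proof.
move=> F0 ->; rewrite /mean !poweR_EFin -EFinM !powRM ?pow2_ge0// mulrACA -!pow2M -pow2D.
rewrite -powRD; last by rewrite subrK oner_eq0.
by rewrite subrK powRr1//; congr (pow2 _ * _)%:E; ring.
Qed.

Lemma lorentz_seq_mean (p : R) a b k : (p^-1 = (1 - t) / p1 + t / p2)%R ->
  (forall k, 0 <= a k) -> (forall k, 0 <= b k) ->
  lorentz_seq nu p (fun k => mean (a k) (b k)) k =
  mean (lorentz_seq nu p1 a k) (lorentz_seq nu p2 b k).
Proof.
move=> hp a0 b0; rewrite /lorentz_seq meanM ?pow2_ge0// mean_pow2.
by congr ((pow2 _)%:E * _); rewrite hp; ring.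
Qed.

Let source a b := mean (lq q1 (lorentz_seq nu p1 a)) (lq q2 (lorentz_seq nu p2 b)).

Lemma lorentz_seq_ge0 (p : R) a : (forall k, 0 <= a k) -> forall k, 0 <= lorentz_seq nu p a k.
Proof. by move=> a0 k; rewrite mule_ge0 ?lee_fin ?pow2_ge0. Qed.

Lemma lq_lorentz_seq_mean (p : R) (qs q : \bar R) a b :
  (p^-1 = (1 - t) / p1 + t / p2)%R -> 1 / qs = (1 - t)%:E / q1 + t%:E / q2 -> qs <= q ->
  (forall k, 0 <= a k) -> (forall k, 0 <= b k) ->
  lq q (lorentz_seq nu p (fun k => mean (a k) (b k))) <= source a b.
Proof.
move=> hp hqs qsq a0 b0.
have m0 k : 0 <= lorentz_seq nu p (fun k => mean (a k) (b k)) k.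
  by apply: lorentz_seq_ge0 => i; exact: mean_ge0.
have qs1 : 1 <= qs by exact: holder_exponent_ge1 hqs.
apply: le_trans (lq_nested qs1 qsq m0) _.
apply: le_trans (lq_holder t01 q11 q21 hqs (lorentz_seq_ge0 p1 a0) (lorentz_seq_ge0 p2 b0)).
by apply: le_lq => // k; rewrite lorentz_seq_mean.
Qed.

Lemma lorentz_norm_ge0 (p : R) (q : \bar R) (f : T -> \bar R) : 0 <= lorentz_norm mu p q f.
Proof.
case: q => [q| |] //=; first exact: poweR_ge0.
apply: (@le_trans _ _ (1%:E * distr_fun mu f 1 `^ p^-1)).
  by rewrite mule_ge0 ?poweR_ge0.
by apply: ereal_sup_ubound; exists 1%R => //; rewrite /= in_itv/= ltr01.
Qed.

(** What is left of the inequality for one condition on the exponents, when the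
    measure space is seen through levels only; the constant depends on the
    functions [F] through the constant [C0] of their band limitation. *)
Definition level_inequality (s p : R) (q r : \bar R) := exists2 C : R, (0 < C)%R &
  forall F a b, block_sequence C0 F ->
  (forall k, 0 <= a k) -> (forall k, 0 <= b k) ->
  tail_le mu nu (g F) a -> tail_le mu nu (h F) b ->
  exists c, [/\ forall k, 0 <= c k,
    forall k x, g F x <= a k -> h F x <= b k -> tl_function s r F x <= c k &
    lq q (lorentz_seq nu p c) <= C%:E * source a b].

(** The exceptional sets of the two sources add up to one of the next level, which
    is harmless since shifting the levels changes their weighted norm by a constant
    factor. *)
Lemma lorentz_interpolation (s p : R) (q r : \bar R) : (0 < p)%R -> 1 <= q -> 1 <= r ->
  level_inequality s p q r ->
  exists2 C : R, (0 < C)%R & forall F, block_sequence C0 F ->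
    lorentz_norm mu p q (tl_function s r F) <=
    C%:E * mean (lorentz_norm mu p1 q1 (g F)) (lorentz_norm mu p2 q2 (h F)).
Proof.
move=> p0 qq rr [C C_0 CP].
have [K1 K10 K1P] := lorentz_norm_levels mu nu0 p10 q11.
have [K2 K20 K2P] := lorentz_norm_levels mu nu0 p20 q21.
have [K K_0 KP] := lorentz_norm_le_levels mu nu0 p0 qq.
have KK : (0 < K1 `^ (1 - t) * K2 `^ t)%R by rewrite mulr_gt0 ?powR_gt0.
exists (K * (pow2 (nu / p) * (C * (K1 `^ (1 - t) * K2 `^ t))))%R.
  by rewrite !mulr_gt0 ?pow2_gt0 ?powR_gt0.
move=> F BF; have [mF F0 _] := BF.
have mg := measurable_tl_function mF s1 r1; have g0 := tl_function_ge0 F0 s1 r1.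
have mh := measurable_tl_function mF s2 r2; have h0 := tl_function_ge0 F0 s2 r2.
have mf := measurable_tl_function mF s r; have f0 := tl_function_ge0 F0 s r.
have [a [a0 ta la]] := K1P _ mg g0; have [b [b0 tb lb]] := K2P _ mh h0.
have [c [c0 cH lc]] := CP F a b BF a0 b0 ta tb.
have tc := tail_le_two n_gt0 mf mg mh ta tb cH.
have c0' k : 0 <= c (k - 1)%R by [].
apply: le_trans (KP _ _ mf f0 c0' tc) _.
rewrite [in X in _ <= X]EFinM -muleA; apply: lee_wpmul2l; first by rewrite lee_fin ltW.
apply: le_trans (lq_lorentz_seq_shift n p qq c0) _.
rewrite [in X in _ <= X]EFinM -muleA; apply: lee_wpmul2l; first by rewrite lee_fin pow2_ge0.
apply: (le_trans lc).
rewrite [in X in _ <= X]EFinM -muleA; apply: lee_wpmul2l; first by rewrite lee_fin ltW.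
have [l1 l2] : 0 <= lorentz_norm mu p1 q1 (g F) /\ 0 <= lorentz_norm mu p2 q2 (h F).
  by split; exact: lorentz_norm_ge0.
rewrite -meanM ?(ltW K10) ?(ltW K20)//; apply: le_mean => //.
  by apply: lq_ge0; exact: lorentz_seq_ge0.
by apply: lq_ge0; exact: lorentz_seq_ge0.
Qed.

(** If the target function is pointwise dominated by the geometric mean of the
    source functions, the levels follow suit. *)
Lemma level_inequality_mean (s p K : R) (qs q r : \bar R) : (0 < K)%R ->
  (p^-1 = (1 - t) / p1 + t / p2)%R -> 1 / qs = (1 - t)%:E / q1 + t%:E / q2 -> qs <= q ->
  (forall F x, block_sequence C0 F -> tl_function s r F x <= K%:E * mean (g F x) (h F x)) ->
  level_inequality s p q r.
Proof.
move=> K0 hp hqs qsq HK; exists K => // F a b BF a0 b0 ta tb; have [mF F0 _] := BF.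
have q1' : 1 <= q by apply: le_trans qsq; exact: holder_exponent_ge1 hqs.
have K0' : (0 <= K)%R by exact: ltW.
exists (fun k => K%:E * mean (a k) (b k)); split => [k|k x ga hb|].
- by rewrite mule_ge0 ?lee_fin ?mean_ge0.
- apply: le_trans (HK F x BF) _; apply: lee_wpmul2l; first by rewrite lee_fin.
  by apply: le_mean => //; exact: tl_function_ge0.
have m0 k : 0 <= lorentz_seq nu p (fun k => mean (a k) (b k)) k.
  by apply: lorentz_seq_ge0 => i; exact: mean_ge0.
apply: (@le_trans _ _ (K%:E * lq q (lorentz_seq nu p (fun k => mean (a k) (b k))))).
  apply: le_trans (lqZ q1' K0' m0); apply: le_lq => // k; rewrite /lorentz_seq.
    apply: mule_ge0; first by rewrite lee_fin pow2_ge0.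
    by apply: mule_ge0; [rewrite lee_fin|exact: mean_ge0].
  by rewrite muleCA.
by apply: lee_wpmul2l; rewrite ?lee_fin//; exact: lq_lorentz_seq_mean hqs qsq _ _.
Qed.

(** Hölder's inequality for the sums over the blocks. *)
Lemma level_inequality_holder (s p : R) (qs q rs r : \bar R) :
  (s = (1 - t) * s1 + t * s2)%R ->
  (p^-1 = (1 - t) / p1 + t / p2)%R -> 1 / qs = (1 - t)%:E / q1 + t%:E / q2 -> qs <= q ->
  1 / rs = (1 - t)%:E / r1 + t%:E / r2 -> rs <= r -> level_inequality s p q r.
Proof.
move=> hs hp hqs qsq hrs rsr; apply: (level_inequality_mean ltr01 hp hqs qsq) => F x [_ F0 _].
rewrite mul1e; have rs1 : 1 <= rs by exact: holder_exponent_ge1 hrs.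
have u0 (u : R) j : 0 <= (pow2 (j%:~R * u) * F j x)%:E by exact: tl_term_ge0.
apply: le_trans (lq_nested rs1 rsr (u0 s)) _.
apply: le_trans (lq_holder t01 r11 r21 hrs (u0 s1) (u0 s2)).
by apply: le_lq => // j; rewrite (mean_term j x F0 hs).
Qed.

(** Relative to the two sources, the terms of the target grow geometrically in one
    case and decrease in the other, because [s1] and [s2] differ. *)
Lemma level_inequality_sum (s p : R) (qs q r : \bar R) : 1 <= r -> s1 != s2 ->
  (s = (1 - t) * s1 + t * s2)%R ->
  (p^-1 = (1 - t) / p1 + t / p2)%R -> 1 / qs = (1 - t)%:E / q1 + t%:E / q2 -> qs <= q ->
  level_inequality s p q r.
Proof.
move=> rr s12 hs hp hqs qsq.
have d0 : (s2 - s1 != 0)%R by rewrite subr_eq0 eq_sym.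
have [K K0 KP] := zsum_two_sided d0 t01.
apply: (level_inequality_mean K0 hp hqs qsq) => F x [_ F0 _].
apply: le_trans (tl_function_le_sum F0 s x rr) _.
apply: le_trans (KP _ _ (tl_function_ge0 F0 s1 r1 x) (tl_function_ge0 F0 s2 r2 x)).
apply: le_zsum => j; rewrite le_min; apply/andP; split.
  apply: le_trans (lee_wpmul2l _ (tl_term_le F0 s1 j x r11)); last by rewrite lee_fin pow2_ge0.
  rewrite -EFinM mulrA -pow2D lee_fin.
  by rewrite (_ : j%:~R * (t * (s2 - s1)) + j%:~R * s1 = j%:~R * s)%R//; rewrite hs; ring.
apply: le_trans (lee_wpmul2l _ (tl_term_le F0 s2 j x r21)); last by rewrite lee_fin pow2_ge0.
rewrite -EFinM mulrA -pow2D lee_fin.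
by rewrite (_ : - (j%:~R * ((1 - t) * (s2 - s1))) + j%:~R * s2 = j%:~R * s)%R//; rewrite hs; ring.
Qed.

(** At equal smoothness the target is below both sources; since [p1] and [p2]
    differ, the two weights on the levels are different powers of 2, and the
    smaller of the two bounds is summable. *)
Lemma level_inequality_min (s p : R) (q r : \bar R) : 1 <= q ->
  s = s1 -> s1 = s2 -> p1 != p2 -> maxe r1 r2 <= r ->
  (p^-1 = (1 - t) / p1 + t / p2)%R -> level_inequality s p q r.
Proof.
move=> qq hs s12 p12; rewrite ge_max => /andP[r1r r2r] hp.
have d0 : (nu / p2 - nu / p1 != 0)%R.
  rewrite -mulrBr mulf_neq0 ?(gt_eqF nu0)//.
  by apply: contra p12; rewrite subr_eq0 => /eqP/invr_inj ->.
have [K K0 KP] := zsum_two_sided d0 t01.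
exists K => // F a b [mF F0 _] a0 b0 ta tb.
have u0 (u : R) x j : 0 <= (pow2 (j%:~R * u) * F j x)%:E by exact: tl_term_ge0.
have c0 k : 0 <= mine (a k) (b k) by rewrite le_min a0 b0.
exists (fun k => mine (a k) (b k)); split => // [k x ga hb|].
  rewrite le_min; apply/andP; split.
    by apply: le_trans ga; rewrite hs; exact: lq_nested.
  by apply: le_trans hb; rewrite hs s12; exact: lq_nested.
have l0 := lorentz_seq_ge0 p c0.
apply: le_trans (lq_nested (lexx 1) qq l0) _; rewrite lq1//.
rewrite /source; set A := lq q1 _; set B := lq q2 _.
have A0 : 0 <= A by apply: lq_ge0; exact: lorentz_seq_ge0.
have B0 : 0 <= B by apply: lq_ge0; exact: lorentz_seq_ge0.
apply: le_trans (KP A B A0 B0); apply: le_zsum => k; rewrite le_min; apply/andP; split.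
  apply: (@le_trans _ _ ((pow2 (k%:~R * (t * (nu / p2 - nu / p1))))%:E * lorentz_seq nu p1 a k)).
    rewrite /lorentz_seq muleA -EFinM -pow2D.
    rewrite (_ : _ + _ = k%:~R * nu / p)%R; last by rewrite -[in RHS]mulrA hp; ring.
    by apply: lee_wpmul2l; rewrite ?lee_fin ?pow2_ge0// ge_min lexx.
  by apply: lee_wpmul2l; rewrite ?lee_fin ?pow2_ge0//; apply: lq_ge_term => //; exact: lorentz_seq_ge0.
apply: (@le_trans _ _ ((pow2 (- (k%:~R * ((1 - t) * (nu / p2 - nu / p1)))))%:E * lorentz_seq nu p2 b k)).
  rewrite /lorentz_seq muleA -EFinM -pow2D.
  rewrite (_ : _ + _ = k%:~R * nu / p)%R; last by rewrite -[in RHS]mulrA hp; ring.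
  by apply: lee_wpmul2l; rewrite ?lee_fin ?pow2_ge0// ge_min lexx orbT.
by apply: lee_wpmul2l; rewrite ?lee_fin ?pow2_ge0//; apply: lq_ge_term => //; exact: lorentz_seq_ge0.
Qed.

(** Weighting by a power passes through the average with the majorant as long
    as the power is below the dimension, that is for exponents above one. *)
Lemma lorentz_seq_majorant (p : R) a m : (0 < p)%R -> (forall k, 0 <= a k) ->
  lorentz_seq nu p (fun m => zsum (fun i => (majorant R n (i - m))%:E * a i)) m <=
  smear (Num.min 1%R (nu - nu / p)%R) (lorentz_seq nu p a) m.
Proof.
move=> p0 a0; rewrite /lorentz_seq -zsumZ ?lee_fin ?pow2_ge0//; last first.
  by move=> i; rewrite mule_ge0 ?lee_fin ?majorant_ge0.
apply: le_zsum => i; rewrite !muleA -!EFinM; apply: lee_wpmul2r => //; rewrite lee_fin.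
have x0 : (0 <= nu / p)%R by rewrite divr_ge0// ltW.
apply: (@le_trans _ _ (pow2 (- ((i - m)%:~R * (nu / p))) * majorant R n (i - m) *
    pow2 (i%:~R * nu / p))%R); last by rewrite ler_wpM2r ?pow2_ge0// majorant_decay.
rewrite [leRHS]mulrAC -pow2D ler_wpM2r ?majorant_ge0// ler_pow2E rmorphB/=.
by rewrite le_eqVlt; apply/orP; left; apply/eqP; ring.
Qed.

(** The Sobolev embedding at the level of the geometric mean [G] of the sources: the
    smoothness drops from [ss] to [s] while [ps] rises to [p].  At level [k] the
    blocks of frequency above [2 ^ (- k)] are bounded by the level itself, and those
    below by the average that band limitation gives. *)
Lemma level_inequality_embedding (s ss p ps : R) (qs q r : \bar R) : (0 < p)%R -> 1 <= r ->
  (ss = (1 - t) * s1 + t * s2)%R -> (ps^-1 = (1 - t) / p1 + t / p2)%R ->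
  (ss - s = nu / ps - nu / p)%R -> (s < ss)%R ->
  1 / qs = (1 - t)%:E / q1 + t%:E / q2 -> qs <= q -> level_inequality s p q r.
Proof.
move=> p0 rr hss hps hsc sss hqs qsq.
have qq : 1 <= q by apply: le_trans qsq; exact: holder_exponent_ge1 hqs.
pose sig := (ss - s)%R; have sig0 : (0 < sig)%R by rewrite subr_gt0.
have ps0 : (0 < ps)%R by rewrite -invr_gt0 hps addr_gt0 ?divr_gt0.
have psn : (nu / ps < nu)%R.
  rewrite gtr_pMr// hps [X in (_ < X)%R](_ : 1 = (1 - t) + t)%R; last by rewrite subrK.
  by apply: ltrD; rewrite gtr_pMr// invf_lt1.
have hx : (nu / ps = sig + nu / p)%R by rewrite /sig hsc subrK.
pose gam := (Num.min (Num.min 1 (nu - nu / ps)) (Num.min sig (nu / p)))%R.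
have gam0 : (0 < gam)%R by rewrite !lt_min ltr01 subr_gt0 psn sig0 divr_gt0.
have [gam1 gam2 gam3] : [/\ gam <= Num.min 1 (nu - nu / ps), gam <= sig & gam <= nu / p]%R.
  split; rewrite /gam ge_min; first by rewrite lexx.
    by apply/orP; right; rewrite ge_min lexx.
  by apply/orP; right; rewrite ge_min lexx orbT.
have [C1 C10 C1P] := zsum_decay sig0.
have [C2 C20 C2P] := lq_decay gam0.
pose K := (C1 * pow2 gam + C0)%R.
have K0 : (0 < K)%R by rewrite addr_gt0// mulr_gt0// pow2_gt0.
exists (K * (C2 * (C2 * pow2 (nu / ps))))%R; first by rewrite !mulr_gt0 ?pow2_gt0.
move=> F a b BF a0 b0 ta tb; have [mF F0 lF] := BF.
pose c k := mean (a k) (b k); pose e k := c (k - 1)%R.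
have c0 k : 0 <= c k by exact: mean_ge0.
have e0 k : 0 <= e k by exact: mean_ge0.
pose E := lorentz_seq nu ps e; have E0 : forall k, 0 <= E k := lorentz_seq_ge0 ps e0.
pose M m := zsum (fun i => (majorant R n (i - m))%:E * e i).
have M0 m : 0 <= M m by apply: zsum_ge0 => i; rewrite mule_ge0 ?lee_fin ?majorant_ge0.
have SE0 k : 0 <= smear gam E k by exact: smear_ge0.
have mg := measurable_tl_function mF s1 r1; have mh := measurable_tl_function mF s2 r2.
have g0 := tl_function_ge0 F0 s1 r1; have h0 := tl_function_ge0 F0 s2 r2.
pose G x := mean (g F x) (h F x).
have mG : measurable_fun setT G.
  by apply: emeasurable_funM; apply: (measurableT_comp (@measurable_poweR R _)).
have cG k x : g F x <= a k -> h F x <= b k -> G x <= c k by move=> ga hb; exact: le_mean.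
have tG : tail_le mu nu G e := tail_le_two n_gt0 mG mg mh ta tb cG.
have FG j x : (pow2 (j%:~R * ss) * F j x)%:E <= G x.
  rewrite (mean_term j x F0 hss); apply: le_mean; by [exact: tl_term_ge0|exact: tl_term_le].
have FM m x : (pow2 ((- m)%:~R * ss) * F (- m)%R x)%:E <= C0%:E * M m.
  by have := lF ss G e mG e0 tG FG (- m)%R x; apply: le_trans.
have ME m : lorentz_seq nu ps M m <= smear gam E m.
  apply: le_trans (lorentz_seq_majorant m ps0 e0) _; exact: smear_anti.
exists (fun k => (pow2 (- (k%:~R * nu / p)))%:E * (K%:E * smear gam (smear gam E) k)); split.
- move=> k; rewrite !mule_ge0 ?lee_fin ?pow2_ge0 ?(ltW K0)//; exact: smear_ge0.
- move=> k x ga hb; set y := (k%:~R * nu / p)%R.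
  have -> : tl_function s r F x = (pow2 (- y))%:E * ((pow2 y)%:E * tl_function s r F x).
    by rewrite muleA -EFinM -pow2D addNr pow20 mul1e.
  apply: lee_wpmul2l; first by rewrite lee_fin pow2_ge0.
  apply: (@le_trans _ _ ((pow2 y)%:E * zsum (fun j => (pow2 (j%:~R * s) * F j x)%:E))).
    by apply: lee_wpmul2l; rewrite ?lee_fin ?pow2_ge0//; exact: tl_function_le_sum.
  rewrite (zsum_rev _ 0) -zsumZ ?lee_fin ?pow2_ge0//; last by move=> j; exact: tl_term_ge0.
  (* The level [c k] is the term of index [k + 1] of [e], hence of the smeared
   sequence. *)
have ck : (pow2 (k%:~R * nu / ps))%:E * c k <= (pow2 gam)%:E * smear gam E k.
    apply: (@le_trans _ _ (E (k + 1)%R)).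
      rewrite /E /lorentz_seq /e addrK; apply: lee_wpmul2r => //.
      rewrite lee_fin ler_pow2E intrD -!mulrA mulrDl mul1r lerDl.
      by rewrite divr_ge0// ltW.
    have -> : E (k + 1)%R = (pow2 gam)%:E * ((decay gam ((k + 1) - k))%:E * E (k + 1)%R).
      rewrite muleA -EFinM /decay -pow2D addrAC subrr add0r normr1 mulr1 subrr pow20.
      by rewrite mul1e.
    apply: lee_wpmul2l; first by rewrite lee_fin pow2_ge0.
    apply: (@zsum_ge_term _ (fun i => (decay gam (i - k))%:E * E i)) => j.
    by rewrite mule_ge0 ?lee_fin ?decay_ge0.
  apply: (@le_trans _ _ (zsum (fun m => (decay sig (m - k))%:E * ((pow2 gam)%:E * smear gam E k) +
      C0%:E * ((decay gam (m - k))%:E * smear gam E m)))).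
    apply: le_zsum => m; rewrite sub0r.
    have -> : ((pow2 y)%:E * (pow2 ((- m)%:~R * s) * F (- m)%R x)%:E =
        (pow2 (y + m%:~R * sig))%:E * (pow2 ((- m)%:~R * ss) * F (- m)%R x)%:E).
      rewrite -!EFinM !mulrA -!pow2D; congr (pow2 _ * _)%:E.
      by rewrite /sig rmorphN/=; ring.
    have d1 : 0 <= (decay sig (m - k))%:E * ((pow2 gam)%:E * smear gam E k).
      by rewrite !mule_ge0 ?lee_fin ?pow2_ge0.
    have d2 : 0 <= C0%:E * ((decay gam (m - k))%:E * smear gam E m).
      by rewrite !mule_ge0 ?lee_fin ?(ltW C00) ?decay_ge0.
    have [mk|km] := leP m k.
      apply: (@le_trans _ _ ((decay sig (m - k))%:E * ((pow2 gam)%:E * smear gam E k))); last by rewrite leeDl.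
      apply: le_trans (lee_wpmul2l _ ck); last by rewrite lee_fin decay_ge0.
      rewrite muleA -[X in _ <= X * _]EFinM /decay -pow2D.
      have -> : (y + m%:~R * sig = - (sig * `|m - k|%:~R) + k%:~R * nu / ps)%R.
        rewrite ler0_norm ?subr_le0// opprB rmorphB/= /y -!mulrA hx; ring.
      apply: lee_wpmul2l; first by rewrite lee_fin pow2_ge0.
      exact: le_trans (FG _ _) (cG _ _ ga hb).
    apply: (@le_trans _ _ (C0%:E * ((decay gam (m - k))%:E * smear gam E m))); last by rewrite leeDr.
    apply: (@le_trans _ _ ((pow2 (y + m%:~R * sig))%:E * (C0%:E * M m))).
      by apply: lee_wpmul2l; rewrite ?lee_fin ?pow2_ge0//; exact: FM.
    rewrite muleCA; apply: lee_wpmul2l; first by rewrite lee_fin ltW.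
    apply: (@le_trans _ _ ((decay (nu / p) (m - k))%:E * lorentz_seq nu ps M m)).
      rewrite /lorentz_seq muleA -EFinM /decay -pow2D.
      rewrite (_ : - (nu / p * `|m - k|%:~R) + m%:~R * nu / ps = y + m%:~R * sig)%R//.
      by rewrite gtr0_norm ?subr_gt0// rmorphB/= /y -[in LHS](mulrA m%:~R) hx -!mulrA; ring.
    apply: lee_pmul; rewrite ?lee_fin ?decay_ge0//; first by rewrite mule_ge0 ?lee_fin ?pow2_ge0.
    exact: decay_anti.
  rewrite zsumD; last 2 first.
  - by move=> m; rewrite !mule_ge0 ?lee_fin ?pow2_ge0.
  - by move=> m; rewrite !mule_ge0 ?lee_fin ?(ltW C00) ?decay_ge0.
  rewrite zsumZ ?lee_fin ?(ltW C00)//; last by move=> m; rewrite !mule_ge0 ?lee_fin ?decay_ge0.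
  rewrite /K [in X in _ <= X]EFinD ge0_muleDl ?lee_fin ?mulr_ge0 ?pow2_ge0 ?(ltW C10) ?(ltW C00)//.
  apply: leeD; last exact: lexx.
  under eq_zsum do rewrite muleC.
  rewrite zsumZ; last 2 first.
  - by rewrite mule_ge0 ?lee_fin ?pow2_ge0.
  - by move=> m; rewrite lee_fin decay_ge0.
  apply: (@le_trans _ _ ((pow2 gam)%:E * smear gam E k * C1%:E)).
    by apply: lee_wpmul2l; [rewrite mule_ge0 ?lee_fin ?pow2_ge0|exact: C1P].
  rewrite muleC muleA -EFinM; apply: lee_wpmul2l; last exact: smear_ge.
  by rewrite lee_fin mulr_ge0 ?pow2_ge0 ?ltW.
have SSE0 k : 0 <= smear gam (smear gam E) k by exact: smear_ge0.
apply: (@le_trans _ _ (lq q (fun k => K%:E * smear gam (smear gam E) k))).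
  apply: le_lq => // k.
    by rewrite /lorentz_seq !mule_ge0 ?lee_fin ?pow2_ge0 ?(ltW K0).
  by rewrite /lorentz_seq muleA -EFinM -pow2D subrr pow20 mul1e.
apply: le_trans (lqZ qq (ltW K0) SSE0) _.
rewrite [in X in _ <= X]EFinM -muleA; apply: lee_wpmul2l; first by rewrite lee_fin ltW.
apply: le_trans (C2P q _ qq SE0) _.
rewrite [in X in _ <= X]EFinM -muleA; apply: lee_wpmul2l; first by rewrite lee_fin ltW.
apply: le_trans (C2P q _ qq E0) _.
rewrite [in X in _ <= X]EFinM -muleA; apply: lee_wpmul2l; first by rewrite lee_fin ltW.
apply: le_trans (lq_lorentz_seq_shift n ps qq c0) _.
apply: lee_wpmul2l; first by rewrite lee_fin pow2_ge0.
exact: lq_lorentz_seq_mean hps hqs qsq a0 b0.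
Qed.

(** A single source, in weak Lorentz form: at level [k] the term of index [j] is
    governed by the coarser of the scales [k] and [- j]. *)
Lemma weak_term_bound (s' p' : R) (q' r' : \bar R) : (1 < p')%R -> 1 <= q' -> 1 <= r' ->
  exists2 K : R, (0 < K)%R & forall F a, block_sequence C0 F -> (forall k, 0 <= a k) ->
  tail_le mu nu (tl_function s' r' F) a ->
  forall k x, tl_function s' r' F x <= a k -> forall j,
  (pow2 (j%:~R * s') * F j x)%:E <=
  (pow2 ((Num.min (- k) j)%:~R * nu / p'))%:E * (K%:E * lq q' (lorentz_seq nu p' a)).
Proof.
move=> p'1 q'1 r'1; have p'0 : (0 < p')%R by exact: lt_trans p'1.
have g0 : (0 < Num.min 1 (nu - nu / p'))%R.
  by rewrite lt_min ltr01 subr_gt0 gtr_pMr// invf_lt1.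
have [C C_0 CP] := zsum_decay g0.
exists (C0 * C + 1)%R; first by rewrite addr_gt0// mulr_gt0.
move=> F a BF a0 ta k x fa j; have [mF F0 lF] := BF.
set A := lq q' _; have A0 : 0 <= A by apply: lq_ge0; exact: lorentz_seq_ge0.
have mf := measurable_tl_function mF s' r'.
pose a' i := (pow2 (- (i%:~R * nu / p')))%:E * A.
have a'0 i : 0 <= a' i by rewrite mule_ge0 ?lee_fin ?pow2_ge0.
have aa' i : a i <= a' i.
  have -> : a i = (pow2 (- (i%:~R * nu / p')))%:E * lorentz_seq nu p' a i.
    by rewrite muleA -EFinM -pow2D addNr pow20 mul1e.
  apply: lee_wpmul2l; first by rewrite lee_fin pow2_ge0.
  by apply: lq_ge_term => //; exact: lorentz_seq_ge0.
have KA : (C0 * C)%:E * A <= (C0 * C + 1)%:E * A /\ A <= (C0 * C + 1)%:E * A.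
  have CC : (0 <= C0 * C)%R by rewrite mulr_ge0 ?ltW.
  split; first by apply: lee_wpmul2r; rewrite ?lee_fin ?lerDl.
  by rewrite -[leLHS]mul1e; apply: lee_wpmul2r; rewrite ?lee_fin ?lerDr.
have [kj|jk] := leP (- k)%R j.
  apply: le_trans (tl_term_le F0 s' j x r'1) _; apply: (le_trans fa); apply: le_trans (aa' k) _.
  rewrite /a' rmorphN/= !mulNr; apply: lee_wpmul2l; last exact: KA.2.
  by rewrite lee_fin pow2_ge0.
apply: le_trans (lF s' _ a' mf a'0 (tail_le_mono mf aa' ta) (fun j x => tl_term_le F0 s' j x r'1) j x) _.
apply: (@le_trans _ _ ((pow2 (j%:~R * nu / p'))%:E * ((C0 * C)%:E * A))); last first.
  by apply: lee_wpmul2l; [rewrite lee_fin pow2_ge0|exact: KA.1].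
have -> : zsum (fun i => (majorant R n (i + j))%:E * a' i) = (pow2 (j%:~R * nu / p'))%:E *
    lorentz_seq nu p' (fun m => zsum (fun i => (majorant R n (i - m))%:E * a' i)) (- j)%R.
  rewrite /lorentz_seq muleA -EFinM -pow2D rmorphN/= !mulNr subrr pow20 mul1e.
  by apply: eq_zsum => i; rewrite opprK.
rewrite muleCA; apply: lee_wpmul2l; first by rewrite lee_fin pow2_ge0.
rewrite EFinM -muleA; apply: lee_wpmul2l; first by rewrite lee_fin ltW.
apply: le_trans (lorentz_seq_majorant _ p'0 a'0) _.
have -> : lorentz_seq nu p' a' = fun=> A.
  by apply/funext => i; rewrite /lorentz_seq muleA -EFinM -pow2D subrr pow20 mul1e.
rewrite /smear; under eq_zsum do rewrite muleC.
rewrite zsumZ//; last by move=> i; rewrite lee_fin decay_ge0.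
by rewrite muleC; apply: lee_wpmul2r; [exact: A0|exact: CP].
Qed.

(** Only suprema over the levels of [a] and [b] are used, through [weak_term_bound],
    and the bound obtained for [c] is in l^1, thus in every l^q.  Along [l = j + k] fixed
    the bounds from the two sources are geometric in [j] with different exponents,
    as [del] is nonzero. *)
Lemma level_inequality_generic (s ss p ps : R) (q r : \bar R) : (0 < p)%R -> 1 <= q -> 1 <= r ->
  (ss = (1 - t) * s1 + t * s2)%R -> (ps^-1 = (1 - t) / p1 + t / p2)%R ->
  (ss - s = nu / ps - nu / p)%R -> (s < ss)%R ->
  (s2 - s1 != nu / p2 - nu / p1)%R -> level_inequality s p q r.
Proof.
move=> p0 qq rr hss hps hsc sss hne.
pose del := (s2 - s1 - (nu / p2 - nu / p1))%R; have del0 : (del != 0)%R by rewrite subr_eq0.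
pose sig := (ss - s)%R; have sig0 : (0 < sig)%R by rewrite subr_gt0.
have hx : (nu / ps = sig + nu / p)%R by rewrite /sig hsc subrK.
have hy : (nu / ps = (1 - t) * (nu / p1) + t * (nu / p2))%R by rewrite hps; ring.
have e0 : (s - nu / p = ss - nu / ps)%R by rewrite hx /sig; ring.
have e1 : (s - s1 - nu / p + nu / p1 = t * del)%R.
  rewrite (_ : s - s1 - nu / p + nu / p1 = (s - nu / p) - s1 + nu / p1)%R; last by ring.
  by rewrite e0 hy hss /del; ring.
have e2 : (s - s2 - nu / p + nu / p2 = - ((1 - t) * del))%R.
  rewrite (_ : s - s2 - nu / p + nu / p2 = (s - nu / p) - s2 + nu / p2)%R; last by ring.
  by rewrite e0 hy hss /del; ring.
pose gam := Num.min sig (nu / p)%R.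
have gam0 : (0 < gam)%R by rewrite lt_min sig0 divr_gt0.
have [K1 K10 K1P] := weak_term_bound s1 p11 q11 r11.
have [K2 K20 K2P] := weak_term_bound s2 p21 q21 r21.
have [C C_0 CP] := zsum_two_sided del0 t01.
have [D D0 DP] := zsum_decay gam0.
exists (C * (D * (K1 `^ (1 - t) * K2 `^ t)))%R; first by rewrite !mulr_gt0 ?powR_gt0.
move=> F a b BF a0 b0 ta tb; have [mF F0 lF] := BF.
rewrite /source; set A := lq q1 _; set B := lq q2 _.
have A0 : 0 <= A by apply: lq_ge0; exact: lorentz_seq_ge0.
have B0 : 0 <= B by apply: lq_ge0; exact: lorentz_seq_ge0.
pose A' := K1%:E * A; pose B' := K2%:E * B.
have A'0 : 0 <= A' by rewrite mule_ge0 ?lee_fin ?(ltW K10).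
have B'0 : 0 <= B' by rewrite mule_ge0 ?lee_fin ?(ltW K20).
pose ex (s' p' : R) (j k : int) := (j%:~R * (s - s') + (Num.min (- k) j)%:~R * nu / p')%R.
pose tm j k := mine ((pow2 (ex s1 p1 j k))%:E * A') ((pow2 (ex s2 p2 j k))%:E * B').
have tm0 j k : 0 <= tm j k.
  by rewrite le_min; apply/andP; split; apply: mule_ge0; rewrite ?lee_fin ?pow2_ge0.
exists (fun k => zsum (fun j => tm j k)); split.
- by move=> k; exact: zsum_ge0.
- move=> k x ga hb; apply: le_trans (tl_function_le_sum F0 s x rr) _.
  have step (s' p' : R) (E : \bar R) j :
      (pow2 (j%:~R * s') * F j x)%:E <= (pow2 ((Num.min (- k) j)%:~R * nu / p'))%:E * E ->
      (pow2 (j%:~R * s) * F j x)%:E <= (pow2 (ex s' p' j k))%:E * E.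
    move=> hE; rewrite /ex pow2D [X in _ <= X * _]EFinM -muleA.
    apply: le_trans (lee_wpmul2l _ hE); last by rewrite lee_fin pow2_ge0.
    by rewrite -EFinM mulrA -pow2D mulrBr subrK.
  apply: le_zsum => j; rewrite le_min; apply/andP; split; apply: step.
    exact: K1P BF a0 ta k x ga j.
  exact: K2P BF b0 tb k x hb j.
(* The exponents that remain when the dependence on [j] is split off. *)
pose w (p' : R) (l : int) := (l%:~R * nu / p - (Num.max l 0)%:~R * nu / p')%R.
have l0 k : 0 <= lorentz_seq nu p (fun k => zsum (fun j => tm j k)) k.
  by apply: lorentz_seq_ge0 => i; exact: zsum_ge0.
apply: le_trans (lq_nested (lexx 1) qq l0) _; rewrite lq1//.
have ptm0 j k : 0 <= (pow2 (k%:~R * nu / p))%:E * tm j k by rewrite mule_ge0 ?lee_fin ?pow2_ge0.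
have -> : zsum (lorentz_seq nu p (fun k => zsum (fun j => tm j k))) =
    zsum (fun l => zsum (fun j => (pow2 ((l - j)%:~R * nu / p))%:E * tm j (l - j)%R)).
  transitivity (zsum (fun k => zsum (fun j => (pow2 (k%:~R * nu / p))%:E * tm j k))).
    by apply: eq_zsum => k; rewrite /lorentz_seq zsumZ// lee_fin pow2_ge0.
  rewrite (@zsum_swap _ (fun k j => (pow2 (k%:~R * nu / p))%:E * tm j k) (fun k j => ptm0 j k)).
  rewrite [RHS](@zsum_swap _ (fun l j => (pow2 ((l - j)%:~R * nu / p))%:E * tm j (l - j)%R) (fun l j => ptm0 j (l - j)%R)).
  by apply: eq_zsum => j; exact: (zsum_shift _ (- j)).
apply: (@le_trans _ _ (zsum (fun l => (C%:E * (K1 `^ (1 - t) * K2 `^ t)%:E * mean A B) * (decay gam (l - 0))%:E))).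
  apply: le_zsum => l.
  have -> : C%:E * (K1 `^ (1 - t) * K2 `^ t)%:E * mean A B * (decay gam (l - 0))%:E =
      C%:E * ((decay gam l)%:E * mean A' B').
    rewrite /A' /B' meanM ?(ltW K10) ?(ltW K20)// subr0.
    have assoc (x y z u : \bar R) : x * y * z * u = x * (u * (y * z)).
      by rewrite [u * _]muleC !muleA.
    exact: assoc.
  apply: (@le_trans _ _ (C%:E * mean ((pow2 (w p1 l))%:E * A') ((pow2 (w p2 l))%:E * B'))).
    apply: le_trans (CP _ _ _ _); last 2 first.
    - by apply: mule_ge0; rewrite ?lee_fin ?pow2_ge0.
    - by apply: mule_ge0; rewrite ?lee_fin ?pow2_ge0.
    apply: le_zsum => j.
    have hm : (Num.min (- (l - j)) j = j - Num.max l 0)%R by exact: min_shift.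
    have ge (E : R) (X Y : \bar R) : X <= Y -> (pow2 E)%:E * X <= (pow2 E)%:E * Y.
      by move=> XY; apply: lee_wpmul2l; rewrite ?lee_fin ?pow2_ge0.
    have pp (u v : R) (X : \bar R) : (pow2 u)%:E * ((pow2 v)%:E * X) = (pow2 (u + v))%:E * X.
      by rewrite muleA -EFinM -pow2D.
    rewrite le_min; apply/andP; split.
      apply: (@le_trans _ _ ((pow2 ((l - j)%:~R * nu / p))%:E * ((pow2 (ex s1 p1 j (l - j)%R))%:E * A'))).
        by apply: ge; rewrite ge_min lexx.
      rewrite !pp le_eqVlt; apply/orP; left; apply/eqP; congr ((pow2 _)%:E * _).
      by rewrite /ex /w hm !rmorphB/= -e1; ring.
    apply: (@le_trans _ _ ((pow2 ((l - j)%:~R * nu / p))%:E * ((pow2 (ex s2 p2 j (l - j)%R))%:E * B'))).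
      by apply: ge; rewrite ge_min lexx orbT.
    rewrite !pp le_eqVlt; apply/orP; left; apply/eqP; congr ((pow2 _)%:E * _).
    by rewrite -mulrN /ex /w hm !rmorphB/= -e2; ring.
  apply: lee_wpmul2l; first by rewrite lee_fin ltW.
  rewrite meanM ?pow2_ge0// mean_pow2; apply: lee_wpmul2r; first exact: mean_ge0.
  rewrite lee_fin /decay ler_pow2E.
  have -> : (w p1 l * (1 - t) + w p2 l * t = l%:~R * (nu / p) - (Num.max l 0)%:~R * (nu / ps))%R.
    by rewrite /w hy; ring.
  have [l1|l1] := leP 0%R l.
    rewrite ger0_norm// hx -mulrBr opprD addrCA subrr addr0 mulrN lerN2 mulrC.
    by rewrite ler_wpM2l ?ler0z// ge_min lexx.
  rewrite mul0r subr0 ltr0_norm// rmorphN/= mulrN opprK mulrC.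
  by rewrite ler_wnM2r ?ge_min ?lexx ?orbT// ltW// ltrz0.
rewrite zsumZ; last 2 first.
- apply: mule_ge0; last exact: mean_ge0.
  by rewrite -EFinM lee_fin !mulr_ge0 ?powR_ge0 ?(ltW C_0).
- by move=> l; rewrite lee_fin decay_ge0.
move: (mean A B) (mean_ge0 A B) => m m0.
rewrite [in X in _ <= X]EFinM [in X in _ <= X]EFinM -!muleA; apply: lee_wpmul2l; first by rewrite lee_fin ltW.
rewrite [X in _ <= X]muleCA; apply: lee_wpmul2l; first by rewrite lee_fin mulr_ge0 ?powR_ge0.
by rewrite muleC; apply: lee_wpmul2r.
Qed.

End interpolation.

Theorem theorem3p8 (R : realType) (n : nat) (n_gt0 : (0 < n)%N)
    (phi : int -> 'rV[R]_n -> R[i]) (hphi : dyadic_partition phi)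
    (s s1 s2 p p1 p2 : R) (q q1 q2 r r1 r2 : \bar R) (theta : R)
    (hp : 1 < p) (hp1 : 1 < p1) (hp2 : 1 < p2)
    (hq : (1 <= q)%E) (hq1 : (1 <= q1)%E) (hq2 : (1 <= q2)%E)
    (hr : (1 <= r)%E) (hr1 : (1 <= r1)%E) (hr2 : (1 <= r2)%E)
    (htheta : 0 < theta < 1)
    (ss ps : R) (qs rs : \bar R)
    (hss : ss = (1 - theta) * s1 + theta * s2)
    (hps : 1 / ps = (1 - theta) / p1 + theta / p2)
    (hqs : (1 / qs = (1 - theta)%:E / q1 + theta%:E / q2)%E)
    (hrs : (1 / rs = (1 - theta)%:E / r1 + theta%:E / r2)%E)
    (hscale : ss - s = n%:R / ps - n%:R / p)
    (hscale_ge0 : 0 <= ss - s)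
    (hcond :
      ((qs <= q)%E /\ (rs <= r)%E)
      \/ [/\ s = s1, s1 = s2, p1 <> p2 & (maxe r1 r2 <= r)%E]
      \/ [/\ ss = s, s1 <> s2 & (qs <= q)%E]
      \/ (s < ss /\ (qs <= q)%E)
      \/ (s < ss /\ s2 - s1 <> n%:R / p2 - n%:R / p1)) :
  exists C : R, 0 < C /\
    forall f : ('rV[R]_n -> R[i]) -> R[i],
      (tll_space phi s1 r1 p1 q1 `&` tll_space phi s2 r2 p2 q2) f ->
      (tll_norm phi s r p q f <=
        C%:E * tll_norm phi s1 r1 p1 q1 f `^ (1 - theta)
             * tll_norm phi s2 r2 p2 q2 f `^ theta)%E.
Proof.
have [C0 C00 C0P] := block_le_levels n_gt0 hphi.
have n0 : (0 < n%:R :> R) by rewrite ltr0n.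
have p0 : 0 < p by exact: lt_trans hp.
have hps' : ps^-1 = (1 - theta) / p1 + theta / p2 by rewrite -hps div1r.
have critical : ss = s -> p^-1 = (1 - theta) / p1 + theta / p2.
  move=> sss; rewrite -hps'; apply: (mulfI (lt0r_neq0 n0)); apply/eqP.
  by rewrite -subr_eq0 -opprB oppr_eq0 -hscale sss subrr.
suff level : level_inequality (lebesgue_rV R n) n s1 s2 p1 p2 theta C0 q1 q2 r1 r2 s p q r.
  have [C C_0 CP] := lorentz_interpolation n_gt0 hp1 hp2 htheta hq1 hq2 p0 hq hr level.
  exists C; split => // f _; pose F (j : int) x := cmod (dyadic_block phi j f x).
  have normE (s' p' : R) (q' r' : \bar R) :
      tll_norm phi s' r' p' q' f = lorentz_norm (lebesgue_rV R n) p' q' (tl_function s' r' F).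
    rewrite /tll_norm; congr lorentz_norm; apply/funext => x; rewrite lr_normE.
    by congr lq; apply/funext => j; rewrite ger0_norm// mulr_ge0 ?powR_ge0 ?cmod_ge0.
  rewrite !normE -muleA; apply: CP; split.
  - by move=> j; exact: measurable_cmod_block.
  - by move=> j x; exact: cmod_ge0.
  - by move=> s' G a mG a0 tG FG j y; exact: (C0P f s' G a mG a0 tG FG j y).
have strict : s < ss -> (qs <= q)%E ->
    level_inequality (lebesgue_rV R n) n s1 s2 p1 p2 theta C0 q1 q2 r1 r2 s p q r.
  by move=> sss qsq; exact: (level_inequality_embedding _ n_gt0 hp1 hp2 htheta C00 hq1 hq2 hr1 hr2
    p0 hr hss hps' hscale sss hqs qsq).
case: hcond => [[qsq rsr]|[[s1E s12 p12 rr]|[[sss s12 qsq]|[[sss qsq]|[sss hne]]]]].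
- have [sss|sss] := eqVneq ss s; last by apply: strict => //; rewrite lt_neqAle eq_sym sss -subr_ge0.
  apply: (level_inequality_holder _ _ _ htheta hq1 hq2 hr1 hr2 _ (critical sss) hqs qsq hrs rsr).
  by rewrite -sss.
- have sss : ss = s by rewrite hss s1E -s12; ring.
  by apply: (level_inequality_min _ n_gt0 _ htheta hq1 hq2 hr1 hr2 hq s1E s12 _ rr (critical sss)); apply/eqP.
- apply: (level_inequality_sum _ _ _ htheta hq1 hq2 hr1 hr2 hr _ _ (critical sss) hqs qsq).
    exact/eqP.
  by rewrite -sss.
- exact: strict.
- apply: (level_inequality_generic _ n_gt0 hp1 hp2 htheta C00 hq1 hq2 hr1 hr2 p0 hq hr hss hps' hscale sss).
  exact/eqP.
Qed.
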